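(* Let $\boldsymbol\lambda=(\lambda^{(1)},\dots,\lambda^{(k)})$ be non-degenerate $\mathfrak{gl}_{1|1}$-weights, $\boldsymbol b\in\mathbb{C}^k$, $Q=\mathrm{diag}(q_1,q_2)$ with $q_1,q_2\in\mathbb{C}^\times$. Suppose $L(\boldsymbol\lambda,\boldsymbol b)$ is an irreducible $\mathrm{Y}(\mathfrak{gl}_{1|1})$-module, and if $q_1=q_2$ suppose in addition $\sum_{s=1}^k(\lambda^{(s)}_1+\lambda^{(s)}_2)\ne0$. If $q_1\varphi_{\boldsymbol\lambda,\boldsymbol b}-q_2\psi_{\boldsymbol\lambda,\boldsymbol b}$ has no multiple roots, then the transfer matrix $\mathcal T_Q(x)$ is diagonalizable on $L(\boldsymbol\lambda,\boldsymbol b)$ and the Bethe ansatz is complete. In particular, for any given $\boldsymbol\lambda$ (with $\sum_s(\lambda^{(s)}_1+\lambda^{(s)}_2)\ne0$ if $q_1=q_2$) and generic $\boldsymbol b$, $\mathcal T_Q(x)$ is diagonalizable and the Bethe ansatz is complete.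
   Context: $\mathbb{C}^{1|1}$ with basis $v_1$ (even), $v_2$ (odd), $|1|=\bar0,|2|=\bar1$; $\mathfrak{gl}_{1|1}$ with basis $e_{ij}$, $[e_{ij},e_{rs}]=\delta_{jr}e_{is}-(-1)^{(|i|+|j|)(|r|+|s|)}\delta_{is}e_{rj}$. $P=\sum_{i,j}(-1)^{|j|}E_{ij}\otimes E_{ji}$, $\mathcal R(x)=1+P/x$. $\mathrm{Y}(\mathfrak{gl}_{1|1})$ is generated by $T^{(r)}_{ij}$ ($r\ge1$, parity $|i|+|j|$) with $\mathcal R^{(12)}(x_1-x_2)T^{(13)}(x_1)T^{(23)}(x_2)=T^{(23)}(x_2)T^{(13)}(x_1)\mathcal R^{(12)}(x_1-x_2)$, $T_{ij}(x)=\delta_{ij}+\sum_rT^{(r)}_{ij}x^{-r}$; coproduct $\Delta(T_{ij}(x))=\sum_rT_{rj}(x)\otimes T_{ir}(x)$; $e_{ij}\mapsto(-1)^{|i|}T^{(1)}_{ji}$. Evaluation module $M(z)$: $T_{ij}(x)$ acts by $\delta_{ij}+(-1)^{|j|}e_{ji}(x-z)^{-1}$. A weight $\lambda=(\lambda_1,\lambda_2)\in\mathbb{C}^2$ is non-degenerate if $\lambda_1+\lambda_2\ne0$; $L_\lambda$ is the (two-dimensional) irreducible module generated by even $v_\lambda$ with $e_{12}v_\lambda=0$, $e_{ii}v_\lambda=\lambda_iv_\lambda$. $L(\boldsymbol\lambda,\boldsymbol b)=\bigotimes_sL_{\lambda^{(s)}}(b_s)$, vacuum $|0\rangle=\otimes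 v_{\lambda^{(s)}}$. $\varphi_{\boldsymbol\lambda,\boldsymbol b}(x)=\prod_s(x-b_s+\lambda^{(s)}_1)$, $\psi_{\boldsymbol\lambda,\boldsymbol b}(x)=\prod_s(x-b_s-\lambda^{(s)}_2)$. $\mathcal T_Q(x)=q_1T_{11}(x)-q_2T_{22}(x)$; diagonalizable means the commuting coefficients of $\mathcal T_Q(x)$ are simultaneously diagonalizable. Singular vectors: $e_{12}v=0$. Bethe vectors: for $\boldsymbol t\in\mathbb{C}^l$, $y_{\boldsymbol t}=\prod(x-t_i)$; $\boldsymbol t$ is a solution of the Bethe ansatz equation if $y_{\boldsymbol t}\mid q_1\varphi_{\boldsymbol\lambda,\boldsymbol b}-q_2\psi_{\boldsymbol\lambda,\boldsymbol b}$; $\widehat{\mathbb B}_l(\boldsymbol t)=\prod_{i,s}(t_i-b_s)\prod_{i<j}(t_j-t_i+1)^{-1}T_{12}(t_1)\cdots T_{12}(t_l)|0\rangle$ ($T_{12}(t)$: the rational operator $T_{12}(x)$ on $L(\boldsymbol\lambda,\boldsymbol b)$ at $x=t$, extended by continuity), on-shell if $\boldsymbol t$ is a solution. The Bethe ansatz is complete if (1) all on-shell Bethe vectors are non-zero and (2) every eigenvector of $\mathcal T_Q(x)$ in $L(\boldsymbol\lambda,\boldsymbol b)$ if $q_1\ne q_2$, resp. in the singular subspace if $q_1=q_2$, is a non-zero multiple of some on-shell Bethe vector. *)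

(* Defs.v *)
From HB Require Import structures.
From mathcomp Require Import all_boot all_order all_algebra.
From mathcomp Require Import reals.
From mathcomp.real_closed Require Import complex.
From mathcomp Require Import mpoly.
Set Implicit Arguments.
Unset Strict Implicit.
Unset Printing Implicit Defensive.
Import GRing.Theory Num.Theory.
Local Open Scope ring_scope.

(* Conventions.
   * gl(1|1) indices 1,2 are encoded by bool: false = 1 (even), true = 2 (odd);
     so the parity |i| of an index i is the boolean i itself.
   * Basis of L_lambda: false = v_lambda (even), true = e21 v_lambda (odd).
     In this basis (computed from the commutation relations):
       e11 = diag(l1, l1-1), e22 = diag(l2, l2+1),
       e21 v = w, e21 w = 0,  e12 v = 0, e12 w = (l1+l2) v.
   * The tensor product L(lam,b) = L_{lam^(1)}(b_1) (x) ... (x) L_{lam^(k)}(b_k)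
     has basis indexed by beta : {ffun 'I_k -> bool}; operators are kernels
     I -> I -> C  (entry (out, in)), then turned into matrices acting on
     column vectors of size #|I| = 2^k. *)

Section Yangian.
Variable R : realType.
Local Notation C := (R[i])%C.

Definition sgn (b : bool) : C := if b then -1 else 1.

Definition e_site (lam : C * C) (a c : bool) (out inp : bool) : C :=
  match a, c with
  | false, false => if out == inp then lam.1 - (inp : nat)%:R else 0
  | true, true   => if out == inp then lam.2 + (inp : nat)%:R else 0
  | true, false  => if out && ~~ inp then 1 else 0
  | false, true  => if ~~ out && inp then lam.1 + lam.2 else 0
  end.

(* Coefficient of x^{-r} of T_ij(x) on the evaluation module L_lam(z):
   T_ij(x) = delta_ij + (-1)^{|j|} e_ji (x - z)^{-1}
           = delta_ij + sum_{r>=1} (-1)^{|j|} z^{r-1} e_ji x^{-r}. *)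
Definition site_ser (lam : C * C) (z : C) (i j : bool) (r : nat)
    (out inp : bool) : C :=
  if r == 0%N then ((i == j) && (out == inp))%:R
  else sgn j * z ^+ r.-1 * e_site lam j i out inp.

(* (x - z) T_ij(x) on L_lam(z), evaluated at x (a polynomial in x). *)
Definition site_pol (lam : C * C) (z : C) (i j : bool) (x : C)
    (out inp : bool) : C :=
  ((i == j) && (out == inp))%:R * (x - z) + sgn j * e_site lam j i out inp.

Variable k : nat.
Definition Idx := {ffun 'I_k -> bool}.

(* k-fold coproduct: Delta^(k)(T_ij) = sum_{a_0 = j, a_k = i}
   T_{a_1 a_0} (x) T_{a_2 a_1} (x) ... (x) T_{a_k a_{k-1}},
   acting on homogeneous tensors with the super sign rule
   (X_1 (x) ... (x) X_k)(v_1 (x) ... (x) v_k)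
     = (-1)^{sum_s |X_s| (|v_1|+...+|v_{s-1}|)} X_1 v_1 (x) ... (x) X_k v_k.
   F s a' a out inp is the entry of the site operator "T_{a' a}" at site s. *)
Definition ktensor (F : 'I_k -> bool -> bool -> bool -> bool -> C)
    (i j : bool) (out inp : Idx) : C :=
  \sum_(a : {ffun 'I_k.+1 -> bool} | (a ord0 == j) && (a ord_max == i))
    sgn (odd (\sum_(s < k)
          ((a (lift ord0 s) (+) a (widen_ord (leqnSn k) s)) : nat) *
          \sum_(t < k | (t < s)%N) (inp t : nat)))
    * \prod_(s < k) F s (a (lift ord0 s)) (a (widen_ord (leqnSn k) s))
                      (out s) (inp s).

Variables (lam : 'I_k -> C * C) (b : 'I_k -> C).

(* coefficient T^{(r)}_{ij} (coefficient of x^{-r} in T_ij(x)) acting on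
   L(lam, b): product of the site series = sum over r_1+...+r_k = r. *)
Definition Tcoef_ker (i j : bool) (r : nat) (out inp : Idx) : C :=
  \sum_(rho : {ffun 'I_k -> 'I_r.+1} | (\sum_(s < k) (rho s : nat) == r)%N)
    ktensor (fun s a' a => site_ser (lam s) (b s) a' a (rho s)) i j out inp.

(* prod_s (x - b_s) T_ij(x) acting on L(lam, b), at x *)
Definition Tpol_ker (i j : bool) (x : C) (out inp : Idx) : C :=
  ktensor (fun s a' a => site_pol (lam s) (b s) a' a x) i j out inp.

Definition dim := #|{: Idx}|.

Definition ker_mx (K : Idx -> Idx -> C) : 'M[C]_dim :=
  \matrix_(p, q) K (enum_val p) (enum_val q).

Definition Tcoef (i j : bool) (r : nat) : 'M[C]_dim := ker_mx (Tcoef_ker i j r).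
Definition Tpol (i j : bool) (x : C) : 'M[C]_dim := ker_mx (Tpol_ker i j x).

Definition vac : 'cV[C]_dim :=
  \col_p ((enum_val p == [ffun => false]) : nat)%:R.

Definition TQ (q1 q2 : C) (r : nat) : 'M[C]_dim :=
  q1 *: Tcoef false false r - q2 *: Tcoef true true r.

(* irreducible Y(gl(1|1))-module: no invariant subspace other than 0 and
   the whole space (subspaces of column vectors as row spaces of U^T). *)
Definition irreducible_mod : Prop :=
  forall U : 'M[C]_dim,
    (forall i j r, (U *m (Tcoef i j r)^T <= U)%MS) ->
    U = 0 \/ row_full U.

Definition TQ_diagonalizable (q1 q2 : C) : Prop :=
  exists P : 'M[C]_dim, P \in unitmx /\
    forall r, is_diag_mx (invmx P *m TQ q1 q2 r *m P).

Definition TQ_eigenvector (q1 q2 : C) (v : 'cV[C]_dim) : Prop :=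
  v != 0 /\ forall r, exists mu : C, TQ q1 q2 r *m v = mu *: v.

(* singular vector: e12 v = 0, where e12 acts by (-1)^{|1|} T^{(1)}_{21} *)
Definition singular (v : 'cV[C]_dim) : Prop := Tcoef true false 1 *m v = 0.

Definition phi_pol : {poly C} := \prod_(s < k) ('X - (b s - (lam s).1)%:P).
Definition psi_pol : {poly C} := \prod_(s < k) ('X - (b s + (lam s).2)%:P).

Definition y_pol (l : nat) (t : 'I_l -> C) : {poly C} :=
  \prod_(m < l) ('X - (t m)%:P).

Definition BAE (q1 q2 : C) (l : nat) (t : 'I_l -> C) : Prop :=
  y_pol t %| (q1 *: phi_pol - q2 *: psi_pol).

Definition bethe_num (l : nat) (t : 'I_l -> C) : 'cV[C]_dim :=
  foldr (fun m v => Tpol false true (t m) *m v) vac (enum 'I_l).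

Definition bethe_den (l : nat) (t : 'I_l -> C) : C :=
  \prod_(m1 < l) \prod_(m2 < l | (m1 < m2)%N) (t m2 - t m1 + 1).

(* v is the Bethe vector \hat B_l(t): the rational function num/den of t,
   extended by continuity, i.e. the value at t of the (unique) polynomial
   map F with F * den = num identically. *)
Definition bethe_vector (l : nat) (t : 'I_l -> C) (v : 'cV[C]_dim) : Prop :=
  exists F : 'I_dim -> {mpoly C[l]},
    (forall (s : 'I_l -> C) p, (F p).@[s] * bethe_den s = bethe_num s p ord0)
    /\ forall p, v p ord0 = (F p).@[t].

Definition bethe_complete (q1 q2 : C) : Prop :=
  (forall l (t : 'I_l -> C), BAE q1 q2 t ->
     exists v, bethe_vector t v /\ v != 0)
  /\ (forall v, TQ_eigenvector q1 q2 v -> (q1 = q2 -> singular v) ->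
       exists l (t : 'I_l -> C) v0 (c : C),
         BAE q1 q2 t /\ bethe_vector t v0 /\ c != 0 /\ v = c *: v0).

End Yangian.

Definition no_multiple_roots (F : fieldType) (p : {poly F}) : Prop :=
  forall a : F, ~~ (('X - a%:P) ^+ 2 %| p).

(* Main.v *)
(* The Jordan-Wigner signs turn L(lambda, b) into the Fock space of k fermions c_s, and at
   each site the L-operator of gl(1|1) has entries x - b_s + l1 - n_s, x - b_s - l2 - n_s,
   - c_s^+ and (l1 + l2) c_s with n_s = c_s^+ c_s. It is therefore Gaussian (the
   exponential of a quadratic expression in the fermions and an auxiliary one), and so is
   the monodromy matrix: T_11 c^+(v) = c^+(A v) T_11 for a k x k matrix A, T_12 =
   c^+(f) T_11, and T_21, T_22 obey similar relations. Consequently the transfer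
   matrix acts on the Fock space as the exterior power of a one-particle k x k matrix,
   times its vacuum eigenvalue (q1 phi - q2 psi)(x) = G(x). The one-particle vectors p(t)
   proportional to f(t) are eigenvectors, with eigenvalue 1 - 1/(x - t), exactly when G(t)
   = 0, and the Bethe vector of t_1, ..., t_l is, up to sign, the wedge p(t_1) ^ ... ^
   p(t_l) divided by the Vandermonde determinant. The rows e(x) of the dual Fock space
   satisfy the Bezout identity (t - x) e(x) p(t) = phi(x) psi(t) - psi(x) phi(t), so at the
   simple roots of G the e(t_i) are dual to the p(t_j) as soon as phi and psi are coprime.
   Hence the wedges of the p(t_i) form an eigenbasis, completed for q1 = q2 by the vector p
   at infinity. A common root of phi and psi produces a proper submodule, which is how
   irreducibility enters. *)
Require Import Defs.
From HB Require Import structures.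
From mathcomp Require Import all_boot all_order all_algebra.
From mathcomp Require Import reals.
From mathcomp.real_closed Require Import complex.
From mathcomp Require Import mpoly.
From mathcomp Require Import ring zify.
Set Implicit Arguments.
Unset Strict Implicit.
Unset Printing Implicit Defensive.
Import GRing.Theory Num.Theory.
Local Open Scope ring_scope.

(** * Fermions and the monodromy matrix *)

(** The Gaussian form divides by the vacuum eigenvalue of [T_11], so the operator relations are
    available only where [phi] does not vanish, whereas the claims concern the series coefficients
    [Tcoef] and Bethe vectors at arbitrary points. Both gaps are closed by density: each matrix
    element of [Tpol] and [Tcoef] comes from a single polynomial in [1/x], and a polynomial identity
    in the Bethe parameters only has to be checked off a hypersurface. Completeness further needs
    eigenvalues that tell the wedges apart. The eigenvalue of a set of roots is [G(x)] times the
    product of the [(x - z - 1) / (x - z)], and two sets with the same product have multiplicities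
    whose difference is invariant under [z -> z + 1], hence zero. The mode at infinity contributes
    the factor 1 and is invisible here; singularity excludes it. For generic [b] the conditions are
    polynomial in [b], so one good point is enough. All parameters but one are placed so that [phi]
    and [psi] are coprime, and the last one avoids the finitely many values that create a double
    root. *)

Section Fermions.
Variables (K : numFieldType) (k n : nat) (cr an : 'I_k -> 'M[K]_n).

Definition anticommutation : Prop :=
  [/\ forall s t, cr s *m cr t = - (cr t *m cr s),
      forall s t, an s *m an t = - (an t *m an s) &
      forall s t, an s *m cr t = (s == t)%:R%:M - cr t *m an s].

Definition crv (v : 'cV[K]_k) : 'M[K]_n := \sum_s v s 0 *: cr s.
Definition anv (u : 'rV[K]_k) : 'M[K]_n := \sum_s u 0 s *: an s.

Lemma crvD v w : crv (v + w) = crv v + crv w.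
Proof. by rewrite -big_split; apply: eq_bigr => s _; rewrite mxE scalerDl. Qed.

Lemma crvZ a v : crv (a *: v) = a *: crv v.
Proof. by rewrite scaler_sumr; apply: eq_bigr => s _; rewrite mxE scalerA. Qed.

Lemma crv0 : crv 0 = 0.
Proof. by rewrite -[0 in LHS](scale0r 0) crvZ scale0r. Qed.

Lemma crvN v : crv (- v) = - crv v.
Proof. by rewrite -scaleN1r crvZ scaleN1r. Qed.

Lemma crvB v w : crv (v - w) = crv v - crv w.
Proof. by rewrite crvD crvN. Qed.

Lemma anvD u w : anv (u + w) = anv u + anv w.
Proof. by rewrite -big_split; apply: eq_bigr => s _; rewrite mxE scalerDl. Qed.

Lemma anvZ a u : anv (a *: u) = a *: anv u.
Proof. by rewrite scaler_sumr; apply: eq_bigr => s _; rewrite mxE scalerA. Qed.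

Lemma anv0 : anv 0 = 0.
Proof. by rewrite -[0 in LHS](scale0r 0) anvZ scale0r. Qed.

Lemma anvN u : anv (- u) = - anv u.
Proof. by rewrite -scaleN1r anvZ scaleN1r. Qed.

Lemma anvB u w : anv (u - w) = anv u - anv w.
Proof. by rewrite anvD anvN. Qed.

Lemma anv_sum (I : Type) (r : seq I) (P : pred I) (F : I -> 'rV[K]_k) :
  anv (\sum_(i <- r | P i) F i) = \sum_(i <- r | P i) anv (F i).
Proof. exact: (big_morph anv anvD anv0). Qed.

Lemma crv_delta s : crv (delta_mx s 0) = cr s.
Proof.
rewrite /crv (bigD1 s) //= mxE !eqxx scale1r big1 ?addr0 // => t ts.
by rewrite mxE (negPf ts) scale0r.
Qed.

Lemma anv_delta s : anv (delta_mx 0 s) = an s.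
Proof.
rewrite /anv (bigD1 s) //= mxE !eqxx scale1r big1 ?addr0 // => t ts.
by rewrite mxE (negPf ts) scale0r.
Qed.

Hypothesis car : anticommutation.

Lemma crv_anti v w : crv v *m crv w = - (crv w *m crv v).
Proof.
case: car => crC _ _; rewrite /crv !mulmx_suml -sumrN.
under eq_bigr do rewrite mulmx_sumr.
under [RHS]eq_bigr do rewrite mulmx_sumr -sumrN.
rewrite exchange_big; apply: eq_bigr => s _; apply: eq_bigr => t _.
by rewrite -!scalemxAl -!scalemxAr crC !scalerN !scalerA mulrC.
Qed.

Lemma anv_anti v w : anv v *m anv w = - (anv w *m anv v).
Proof.
case: car => _ anC _; rewrite /anv !mulmx_suml -sumrN.
under eq_bigr do rewrite mulmx_sumr.
under [RHS]eq_bigr do rewrite mulmx_sumr -sumrN.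
rewrite exchange_big; apply: eq_bigr => s _; apply: eq_bigr => t _.
by rewrite -!scalemxAl -!scalemxAr anC !scalerN !scalerA mulrC.
Qed.

Lemma anv_crv u v : anv u *m crv v = (u *m v) 0 0 *: 1%:M - crv v *m anv u.
Proof.
case: car => _ _ acC.
have -> : (u *m v) 0 0 *: 1%:M =
    \sum_s \sum_t (u 0 s * v t 0 * (s == t)%:R) *: 1%:M :> 'M[K]_n.
  rewrite mxE scaler_suml; apply: eq_bigr => s _.
  rewrite (bigD1 s) //= eqxx mulr1 big1 ?addr0 // => t ts.
  by rewrite eq_sym (negPf ts) mulr0 scale0r.
rewrite /anv /crv !mulmx_suml.
under eq_bigr do rewrite mulmx_sumr.
under [X in _ - X]eq_bigr do rewrite mulmx_sumr.
rewrite [X in _ - X]exchange_big -sumrB; apply: eq_bigr => s _.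
rewrite -sumrB; apply: eq_bigr => t _.
rewrite -!scalemxAl -!scalemxAr acC !scalerBr !scalerA -scalemx1 scalerA.
by rewrite [v t 0 * _]mulrC.
Qed.

Lemma eq_opp0 (m p : nat) (X : 'M[K]_(m, p)) : X = - X -> X = 0.
Proof.
move=> /matrixP e; apply/matrixP => i j; have := e i j; rewrite !mxE => /eqP.
by rewrite -addr_eq0 -mulr2n mulrn_eq0 /= => /eqP.
Qed.

Lemma crv_sqr v : crv v *m crv v = 0.
Proof. by apply: eq_opp0; rewrite -crv_anti. Qed.

Lemma anv_sqr v : anv v *m anv v = 0.
Proof. by apply: eq_opp0; rewrite -anv_anti. Qed.

End Fermions.

(** Noncommutative products are frozen as atoms: once both sides are in normal order, what remains
    is a linear identity that [ring] or [field] closes entrywise. *)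
Ltac mx_linear :=
  repeat match goal with
  | |- context [ ?X *m ?Y ] => move: (X *m Y) => ?
  | |- context [ crv ?c ?v ] => move: (crv c v) => ?
  | |- context [ anv ?c ?v ] => move: (anv c v) => ?
  | |- context [ @scalar_mx ?K ?n ?c ] => move: (@scalar_mx K n c) => ?
  end;
  apply/matrixP => ? ?; rewrite !mxE.

Ltac mx_expand :=
  rewrite ?(mulmxBl, mulmxBr, mulmxDl, mulmxDr, mulmxN, mulNmx, mulmx0, mul0mx,
            mul1mx, mulmx1, =^~ scalemxAl, =^~ scalemxAr, =^~ mulmxA).

Section Monodromy.
Variables (K : numFieldType) (k n : nat) (cr an : 'I_k -> 'M[K]_n).
Hypothesis car : anticommutation cr an.
Variables al be : 'I_k -> K.

(* Here [al s = x - b_s + l1] and [be s = x - b_s - l2] at a fixed [x]. *)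
Definition site_op (s : 'I_k) (i j : bool) : 'M[K]_n :=
  match i, j with
  | false, false => al s *: 1%:M - cr s *m an s
  | true, true => be s *: 1%:M - cr s *m an s
  | false, true => - cr s
  | true, false => (al s - be s) *: an s
  end.

Fixpoint monodromy (r : seq 'I_k) (i j : bool) : 'M[K]_n :=
  if r is s :: r' then
    site_op s false j *m monodromy r' i false + site_op s true j *m monodromy r' i true
  else if i == j then 1%:M else 0.

(* [fvec], [gscal], [Amx] and [Crow] are the blocks of the monodromy matrix acting on the
   one-particle space of the sites and the auxiliary fermion, divided by the vacuum
   eigenvalue of [T_11]. *)
Fixpoint fvec (r : seq 'I_k) : 'cV[K]_k :=
  if r is s :: r' then
    - (al s)^-1 *: delta_mx s 0 + (be s / al s) *: fvec r'
  else 0.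

Fixpoint gscal (r : seq 'I_k) : K :=
  if r is s :: r' then gscal r' * (be s / al s) else 1.

(** A rank one perturbation of the identity: the one-particle action of [Gop s f], as [Gop_crv]
    shows. *)
Definition Gmx s (f : 'cV[K]_k) : 'M[K]_k :=
  1%:M - (al s)^-1 *: ((delta_mx s 0 + (al s - be s) *: f) *m delta_mx 0 s).

Fixpoint Amx (r : seq 'I_k) : 'M[K]_k :=
  if r is s :: r' then Gmx s (fvec r') *m Amx r' else 1%:M.

Fixpoint Crow (r : seq 'I_k) : 'rV[K]_k :=
  if r is s :: r' then
    Crow r' + (gscal r' * (al s - be s) / al s) *: delta_mx 0 s
  else 0.

Hypothesis al0 : forall s, al s != 0.
Local Notation crv := (crv cr).
Local Notation anv := (anv an).

Lemma fvec_notin r s : s \notin r -> fvec r s 0 = 0.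
Proof.
elim: r => [|t r IH] /=; first by rewrite mxE.
rewrite inE negb_or => /andP[st sr].
by rewrite !mxE (negPf st) IH // !mulr0 addr0.
Qed.

Lemma delta_mul_Amx r s : s \notin r -> delta_mx 0 s *m Amx r = delta_mx 0 s :> 'rV_k.
Proof.
elim: r => [|t r IH] /=; first by rewrite mulmx1.
rewrite inE negb_or => /andP[st sr].
rewrite mulmxA /Gmx mulmxBr mulmx1 -scalemxAr mulmxA mulmxDr -scalemxAr.
rewrite mul_delta_mx_0 // add0r -rowE.
have -> : row s (fvec r) = 0.
  by apply/rowP=> i; rewrite !mxE ord1 fvec_notin.
by rewrite scaler0 mul0mx scaler0 subr0 IH.
Qed.

Lemma Amx_mul_delta r s : s \notin r -> Amx r *m delta_mx s 0 = delta_mx s 0 :> 'cV_k.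
Proof.
elim: r => [|t r IH] /=; first by rewrite mul1mx.
rewrite inE negb_or => /andP[st sr].
rewrite -mulmxA IH // /Gmx mulmxBl mul1mx -scalemxAl -mulmxA.
rewrite eq_sym in st; by rewrite mul_delta_mx_0 // mulmx0 scaler0 subr0.
Qed.

Lemma Crow_mul_delta r s : s \notin r -> Crow r *m delta_mx s 0 = 0 :> 'cV_1.
Proof.
elim: r => [|t r IH] /=; first by rewrite mul0mx.
rewrite inE negb_or => /andP[st sr].
rewrite eq_sym in st; by rewrite mulmxDl IH // add0r -scalemxAl mul_delta_mx_0 // scaler0.
Qed.

(** The left factor in the recursion for [T_11]: after substituting [T_12 = c^+(f) T_11] for the
    shorter chain, [c_s] is moved past [c^+(f)], with a sign only because [f] has no component at
    [s]. *)
Definition Gop s (f : 'cV[K]_k) : 'M[K]_n :=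
  site_op s false false - crv f *m site_op s true false.

Lemma an_crv s (w : 'cV_k) : an s *m crv w = w s 0 *: 1%:M - crv w *m an s.
Proof. by rewrite -anv_delta (anv_crv car) -rowE mxE. Qed.

Lemma anv_cr (u : 'rV_k) s : anv u *m cr s = u 0 s *: 1%:M - cr s *m anv u.
Proof. by rewrite -crv_delta (anv_crv car) -colE mxE. Qed.

Lemma Gmx_col s (f w : 'cV_k) :
  Gmx s f *m w = w - (w s 0 / al s) *: (delta_mx s 0 + (al s - be s) *: f).
Proof.
rewrite /Gmx mulmxBl mul1mx -scalemxAl -mulmxA -rowE.
rewrite [w s 0 / _]mulrC -scalerA; congr (_ - _ *: _).
by apply/colP=> i; rewrite mxE big_ord1 !mxE mulrC.
Qed.

Lemma row_Gmx s (f : 'cV_k) (u : 'rV_k) :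
  u *m Gmx s f =
  u - ((u 0 s + (al s - be s) * (u *m f) 0 0) / al s) *: delta_mx 0 s.
Proof.
rewrite mulmxBr mulmx1 -scalemxAr mulmxA mulmxDr -colE -scalemxAr.
rewrite [col s u + _]mx11_scalar mul_scalar_mx scalerA.
by rewrite !mxE mulrC.
Qed.

Lemma crv_Gmx s (f w : 'cV_k) :
  crv (Gmx s f *m w) = crv w - (w s 0 / al s) *: (cr s + (al s - be s) *: crv f).
Proof. by rewrite Gmx_col crvB crvZ crvD crvZ crv_delta. Qed.

Lemma Gop_crv s (f w : 'cV_k) : f s 0 = 0 ->
  Gop s f *m crv w = crv (Gmx s f *m w) *m Gop s f.
Proof.
move=> fs0.
rewrite crv_Gmx /Gop /=.
have e1 X : crv f *m (cr s *m X) = - (cr s *m (crv f *m X)).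
  by rewrite !mulmxA -crv_delta (crv_anti car) mulNmx.
have e2 X : cr s *m (cr s *m X) = 0.
  by rewrite mulmxA -crv_delta (crv_sqr car) mul0mx.
have e3 X : crv f *m (crv f *m X) = 0.
  by rewrite mulmxA (crv_sqr car) mul0mx.
have e4 X : crv f *m (crv w *m X) = - (crv w *m (crv f *m X)).
  by rewrite !mulmxA (crv_anti car) mulNmx.
have e5 X : cr s *m (crv w *m X) = - (crv w *m (cr s *m X)).
  by rewrite !mulmxA -crv_delta (crv_anti car) mulNmx.
mx_expand; rewrite !an_crv; mx_expand; rewrite !(e1, e2, e3, e4, e5).
by mx_linear; field.
Qed.

(** The right-hand side is [site_op s false true + site_op s true true *m crv f], the left factor of
    the recursion for [T_12]; this is the inductive step for [T_12 = c^+(f) T_11], and it serves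
    [T_22] as well. *)
Lemma fvec_Gop s (f : 'cV_k) : f s 0 = 0 ->
  (- (al s)^-1 *: cr s + (be s / al s) *: crv f) *m Gop s f =
  - cr s + (be s *: crv f - cr s *m an s *m crv f).
Proof.
move=> fs0; rewrite /Gop /=.
have e1 X : crv f *m (cr s *m X) = - (cr s *m (crv f *m X)).
  by rewrite !mulmxA -crv_delta (crv_anti car) mulNmx.
have e2 X : cr s *m (cr s *m X) = 0.
  by rewrite mulmxA -crv_delta (crv_sqr car) mul0mx.
have e3 X : crv f *m (crv f *m X) = 0.
  by rewrite mulmxA (crv_sqr car) mul0mx.
mx_expand; rewrite !an_crv fs0 scale0r sub0r; mx_expand; rewrite !(e1, e2, e3).
by mx_linear; field.
Qed.

(** The last relation says, formally, that the Schur complement [T_22 - T_12 T_11^-1 T_21] is a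
    scalar multiple of [T_11]. *)
Definition gaussian_relations (r : seq 'I_k) : Prop :=
  [/\ forall v, monodromy r false false *m crv v = crv (Amx r *m v) *m monodromy r false false,
      monodromy r false true = crv (fvec r) *m monodromy r false false,
      forall v, monodromy r true false *m crv v =
        (Crow r *m v) 0 0 *: monodromy r false false
        - crv (Amx r *m v) *m monodromy r true false &
      monodromy r true true =
        gscal r *: monodromy r false false + crv (fvec r) *m monodromy r true false].

Lemma an_crv0 s (f : 'cV_k) m (X : 'M_(n, m)) : f s 0 = 0 ->
  an s *m (crv f *m X) = - (crv f *m (an s *m X)).
Proof. by move=> f0; rewrite mulmxA an_crv f0 scale0r sub0r mulNmx mulmxA. Qed.

Lemma monodromy_consA s r : monodromy r false true = crv (fvec r) *m monodromy r false false ->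
  s \notin r ->
  monodromy (s :: r) false false = Gop s (fvec r) *m monodromy r false false.
Proof.
move=> /= -> sr; rewrite /Gop /=; mx_expand; rewrite an_crv0 ?fvec_notin //.
by mx_linear; ring.
Qed.

Lemma monodromy_consC s r :
  monodromy r true true =
        gscal r *: monodromy r false false + crv (fvec r) *m monodromy r true false ->
  s \notin r ->
  monodromy (s :: r) true false = Gop s (fvec r) *m monodromy r true false
    + (gscal r * (al s - be s)) *: (an s *m monodromy r false false).
Proof.
move=> /= -> sr; rewrite /Gop /=; mx_expand; rewrite an_crv0 ?fvec_notin //.
by mx_linear; ring.
Qed.

(* Adding a site multiplies [T_11] on the left by [Gop], itself Gaussian by [Gop_crv]. *)
Lemma monodromy_rel r : uniq r -> gaussian_relations r.
Proof.
elim: r => [_|s r IH /= /andP[sr /IH [R1 R2 R3 R4]]].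
  split=> [v||v|] /=.
  - by rewrite !mul1mx mulmx1.
  - by rewrite crv0 mul0mx.
  - by rewrite !mul0mx mulmx0 mxE scale0r subr0.
  - by rewrite scale1r mulmx0 addr0.
have A' := monodromy_consA R2 sr; have C' := monodromy_consC R4 sr.
have fs0 := fvec_notin sr.
split.
- by move=> v; rewrite A' -mulmxA R1 mulmxA Gop_crv // !mulmxA.
- rewrite A' mulmxA crvD !crvZ crv_delta fvec_Gop // /= R2.
  by mx_expand; mx_linear; ring.
- move=> v; rewrite A' C' mulmxDl -mulmxA R3 -scalemxAl -[an s *m _ *m _]mulmxA R1.
  rewrite mulmxBr -scalemxAr !mulmxA Gop_crv // an_crv -mulmxA.
  have vs : (Amx r *m v) s 0 = v s 0.
    have /matrixP/(_ 0 0) := congr1 (mulmx^~ v) (delta_mul_Amx sr).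
    by rewrite -mulmxA -!rowE !mxE.
  have -> : (Crow (s :: r) *m v) 0 0 =
      (Crow r *m v) 0 0 + gscal r * (al s - be s) / al s * v s 0.
    by rewrite mulmxDl -scalemxAl -rowE !mxE.
  have -> : Amx (s :: r) *m v = Gmx s (fvec r) *m (Amx r *m v) by rewrite mulmxA.
  rewrite [in RHS]mulmxDr crv_Gmx vs scalerDl.
  mx_expand; rewrite /Gop /=; mx_expand.
  by mx_linear; field.
- rewrite A' C' mulmxDr /= crvD !crvZ crv_delta !mulmxA fvec_Gop // R4.
  by rewrite /Gop /=; mx_expand; mx_linear; field.
Qed.

Lemma anv_Gop s (f : 'cV_k) (u : 'rV_k) : f s 0 = 0 ->
  anv u *m Gop s f = Gop s f *m anv (u *m Gmx s f).
Proof.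
move=> fs0.
rewrite row_Gmx anvB anvZ anv_delta /Gop /=.
have e1 X : an s *m (an s *m X) = 0.
  by rewrite mulmxA -anv_delta (anv_sqr car) mul0mx.
have e2 : an s *m an s = 0 by rewrite -anv_delta (anv_sqr car).
have e3 : anv u *m an s = - (an s *m anv u).
  by rewrite -anv_delta (anv_anti car).
mx_expand; rewrite ![anv u *m (_ *m _)]mulmxA anv_cr (anv_crv car).
mx_expand; rewrite ?(e1, e2, e3); mx_expand.
by mx_linear; field.
Qed.

(** The companion of [gaussian_relations] for annihilators, on which [Amx] acts through rows. It is
    used where a submodule is cut out as a common kernel of annihilators. *)
Lemma anv_mono r u : uniq r ->
  anv u *m monodromy r false false = monodromy r false false *m anv (u *m Amx r) /\
  anv u *m monodromy r true false = - (monodromy r true false *m anv (u *m Amx r)).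
Proof.
elim: r u => [|s r IH] u.
  by rewrite /= mulmx1 !(mulmx1, mul1mx, mulmx0, mul0mx) oppr0.
rewrite cons_uniq => /andP[sr ur].
have [R1 R2 R3 R4] := monodromy_rel ur.
have A' := monodromy_consA R2 sr; have C' := monodromy_consC R4 sr.
have fs0 := fvec_notin sr; have [I1 I2] := IH (u *m Gmx s (fvec r)) ur; split.
  by rewrite A' mulmxA anv_Gop // -mulmxA I1 !mulmxA.
have [I3 _] := IH u ur; have [I4 _] := IH (delta_mx 0 s) ur.
have e3 : anv u *m an s = - (an s *m anv u).
  by rewrite -anv_delta (anv_anti car).
(* By the relation for [c_s] itself this is [c_s c_s T_11 = 0], so the correction that [Gmx] adds to
   [u] disappears behind [c_s T_11]. *)
have e4 : an s *m monodromy r false false *m anv (delta_mx 0 s *m Amx r) = 0.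
  by rewrite -mulmxA -I4 anv_delta mulmxA -anv_delta (anv_sqr car) mul0mx.
have e5 : u *m Gmx s (fvec r) *m Amx r = u *m Amx r -
  ((u 0 s + (al s - be s) * (u *m fvec r) 0 0) / al s) *: (delta_mx 0 s *m Amx r).
  by rewrite row_Gmx mulmxBl -scalemxAl.
have e6 : anv u *m (an s *m monodromy r false false) =
    - (an s *m monodromy r false false *m anv (u *m Gmx s (fvec r) *m Amx r)).
  rewrite e5 anvB anvZ mulmxBr -scalemxAr e4 scaler0 subr0.
  by rewrite mulmxA e3 mulNmx -mulmxA I3 mulmxA.
rewrite C' mulmxDr -scalemxAr e6 mulmxA anv_Gop // -mulmxA I2 mulmxN mulmxA.
by rewrite mulmxDl opprD scalerN /= -scalemxAl !mulmxA.
Qed.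

Lemma gscalE r : gscal r * (\prod_(s <- r) al s) = \prod_(s <- r) be s.
Proof.
elim: r => [|s r IH] /=; first by rewrite !big_nil mulr1.
by rewrite !big_cons -IH; field.
Qed.

Lemma monodromy_vac r (vac : 'cV_n) : (forall s, an s *m vac = 0) -> uniq r ->
  [/\ monodromy r false false *m vac = (\prod_(s <- r) al s) *: vac,
      monodromy r true false *m vac = 0 &
      monodromy r true true *m vac = (\prod_(s <- r) be s) *: vac].
Proof.
move=> av ur.
suff [eA eC] : monodromy r false false *m vac = (\prod_(s <- r) al s) *: vac /\
    monodromy r true false *m vac = 0.
  have [_ _ _ R4] := monodromy_rel ur; split=> //.
  by rewrite R4 mulmxDl -scalemxAl eA -mulmxA eC mulmx0 addr0 scalerA gscalE.
elim: r ur => [_|s r IH].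
  by rewrite !big_nil !scale1r !mul1mx mul0mx.
rewrite cons_uniq => /andP[sr ur]; have [eA eC] := IH ur.
have [R1 R2 R3 R4] := monodromy_rel ur.
rewrite (monodromy_consA R2 sr) (monodromy_consC R4 sr) mulmxDl -!scalemxAl -!mulmxA eA eC.
rewrite -!scalemxAr av !mulmx0 !scaler0 addr0 /Gop /=; split=> //.
rewrite mulmxBl -!mulmxA -scalemxAl mulmxBl -!mulmxA -scalemxAl mul1mx av.
by rewrite !mulmx0 scaler0 mulmx0 !subr0 scalerA big_cons mulrC.
Qed.

(** The transfer matrix is [(q1 - q2 g) T_11 - q2 c^+(f) T_21]. Moving [c^+(v)] through it leaves
    one contraction, a multiple of [c^+(f) T_11]; as [c^+(f)] squares to zero, this is again
    [c^+(f)] times the whole transfer matrix, up to the factor [q1 - q2 g]. *)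
Lemma transfer_crv r q1 q2 v : uniq r -> q1 - q2 * gscal r != 0 ->
  (q1 *: monodromy r false false - q2 *: monodromy r true true) *m crv v =
  crv (Amx r *m v - (q2 / (q1 - q2 * gscal r) * (Crow r *m v) 0 0) *: fvec r)
  *m (q1 *: monodromy r false false - q2 *: monodromy r true true).
Proof.
move=> ur q0; have [R1 _ R3 ->] := monodromy_rel ur; rewrite crvB crvZ.
have e3 X : crv (fvec r) *m (crv (fvec r) *m X) = 0.
  by rewrite mulmxA (crv_sqr car) mul0mx.
have e4 w X : crv (fvec r) *m (crv w *m X) = - (crv w *m (crv (fvec r) *m X)).
  by rewrite !mulmxA (crv_anti car) mulNmx.
mx_expand; rewrite !(R1, R3); mx_expand; rewrite !(e3, e4).
by mx_linear; field.
Qed.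

End Monodromy.

(** * One-particle identities *)

Section SpectralParameter.
Variables (K : numFieldType) (k : nat) (a h : 'I_k -> K).

Definition alx (x : K) (s : 'I_k) : K := x - a s.
Definition bex (x : K) (s : 'I_k) : K := x - a s - h s.

Definition phis (r : seq 'I_k) : {poly K} := \prod_(s <- r) ('X - (a s)%:P).
Definition psis (r : seq 'I_k) : {poly K} := \prod_(s <- r) ('X - (a s + h s)%:P).

(** Entry [i] is the product of the factors of [psi] at the sites before [i] and of the factors of
    [phi] at the sites after [i]. These are the numerators of [fvec] over the common denominator
    [phi]. *)
Fixpoint ppol (r : seq 'I_k) (i : 'I_k) : {poly K} :=
  if r is s :: r' then (i == s)%:R *: phis r' + ('X - (a s + h s)%:P) * ppol r' i
  else 0.

Definition pvec r x : 'cV[K]_k := \col_i (ppol r i).[x].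

(** The mirror image of [ppol]: entry [i] is [h i] times the factors of [phi] before [i] and those
    of [psi] after [i]. *)
Fixpoint erow (r : seq 'I_k) (x : K) : 'rV[K]_k :=
  if r is s :: r' then
    (h s * (psis r').[x]) *: delta_mx 0 s + (x - a s) *: erow r' x
  else 0.

(* Leading coefficient of [pvec]: the one-particle vector attached to [t] at infinity. *)
Fixpoint ones (r : seq 'I_k) : 'cV[K]_k :=
  if r is s :: r' then delta_mx s 0 + ones r' else 0.

(** The leading coefficient of [erow]; by [Tcoef21] it is also the row through which [e12] acts. *)
Fixpoint hrow (r : seq 'I_k) : 'rV[K]_k :=
  if r is s :: r' then h s *: delta_mx 0 s + hrow r' else 0.

Lemma phis_cons s r x : (phis (s :: r)).[x] = (x - a s) * (phis r).[x].
Proof. by rewrite /phis big_cons hornerM hornerXsubC. Qed.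

Lemma psis_cons s r x : (psis (s :: r)).[x] = (x - a s - h s) * (psis r).[x].
Proof. by rewrite /psis big_cons hornerM hornerXsubC opprD addrA. Qed.

Lemma pvec_cons s r x :
  pvec (s :: r) x = (phis r).[x] *: delta_mx s 0 + (x - a s - h s) *: pvec r x.
Proof.
apply/colP=> i; rewrite !mxE /= hornerD hornerZ hornerM hornerXsubC andbT.
by rewrite opprD addrA mulrC.
Qed.

Lemma prod_alx r x : \prod_(s <- r) alx x s = (phis r).[x].
Proof. by rewrite /phis horner_prod; apply: eq_bigr => s _; rewrite hornerXsubC. Qed.

Lemma prod_bex r x : \prod_(s <- r) bex x s = (psis r).[x].
Proof.
rewrite /psis horner_prod; apply: eq_bigr => s _.
by rewrite hornerXsubC opprD addrA.
Qed.

Lemma pvec_notin r s x : s \notin r -> pvec r x s 0 = 0.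
Proof.
elim: r => [|t r IH] /=; first by rewrite mxE horner0.
rewrite inE negb_or => /andP[st sr]; rewrite pvec_cons !mxE (negPf st) mulr0 add0r.
by have := IH sr; rewrite mxE => ->; rewrite mulr0.
Qed.

Lemma size_phis r : size (phis r) = (size r).+1.
Proof. by rewrite /phis size_prod_XsubC. Qed.

Lemma size_ppol r i : (size (ppol r i) <= size r)%N.
Proof.
elim: r => [|s r IH] /=; first by rewrite size_poly0.
apply: leq_trans (size_polyD _ _) _; rewrite geq_max; apply/andP; split.
  by apply: leq_trans (size_scale_leq _ _) _; rewrite size_phis.
apply: leq_trans (size_polyMleq _ _) _; rewrite size_XsubC /=.
by rewrite ltnS.
Qed.

Lemma erow_mul_delta r s x : s \notin r -> erow r x *m delta_mx s 0 = 0 :> 'M_1.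
Proof.
elim: r => [|u r IH] /=; first by rewrite mul0mx.
rewrite inE negb_or eq_sym => /andP[us sr].
by rewrite mulmxDl -!scalemxAl mul_delta_mx_0 // IH // !scaler0 addr0.
Qed.

Lemma hrow_mul_delta r s : s \notin r -> hrow r *m delta_mx s 0 = 0 :> 'M_1.
Proof.
elim: r => [|u r IH] /=; first by rewrite mul0mx.
rewrite inE negb_or eq_sym => /andP[us sr].
by rewrite mulmxDl -!scalemxAl mul_delta_mx_0 // IH // !scaler0 addr0.
Qed.

Lemma delta_mul_pvec r s x : s \notin r -> delta_mx 0 s *m pvec r x = 0 :> 'M_1.
Proof.
by move=> sr; rewrite -rowE; apply/matrixP=> i j; rewrite !ord1 mxE pvec_notin ?mxE.
Qed.

Lemma delta_mul_ones r s : s \notin r -> delta_mx 0 s *m ones r = 0 :> 'M_1.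
Proof.
elim: r => [|u r IH] /=; first by rewrite mulmx0.
rewrite inE negb_or => /andP[us sr].
by rewrite mulmxDr mul_delta_mx_0 // IH // addr0.
Qed.

Lemma erow_pvec r x t : uniq r ->
  (t - x) *: (erow r x *m pvec r t) =
  ((phis r).[x] * (psis r).[t] - (psis r).[x] * (phis r).[t])%:M.
Proof.
elim: r => [_|s r IH].
  by rewrite mul0mx scaler0 /phis /psis !big_nil !hornerC subrr raddf0.
rewrite cons_uniq => /andP[sr /IH {}IH].
rewrite pvec_cons !phis_cons !psis_cons /=.
have e1 := delta_mul_pvec t sr.
have e2 := erow_mul_delta x sr.
rewrite mulmxDl !mulmxDr -!scalemxAl -!scalemxAr e1 e2 mul_delta_mx.
move: IH => /matrixP/(_ 0 0); rewrite !mxE eqxx !mulr1n => IH.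
apply/matrixP=> i j; rewrite !ord1 !mxE !eqxx !mulr1n.
set E := \sum__ _ in IH *; set p := (phis r).[x] in IH *.
apply: (@eq_trans _ _ ((t - x) * (h s * (psis r).[x] * (phis r).[t]) +
  (x - a s) * (t - a s - h s) * ((t - x) * E))); first by ring.
by rewrite IH; ring.
Qed.

(** This identity and the next two are the leading terms of [erow_pvec] when [t], both variables, or
    [x] tend to infinity. *)
Lemma erow_ones r x : uniq r ->
  erow r x *m ones r = ((phis r).[x] - (psis r).[x])%:M.
Proof.
elim: r => [_|s r IH].
  by rewrite mul0mx /phis /psis !big_nil !hornerC subrr raddf0.
rewrite cons_uniq => /andP[sr /IH {}IH] /=.
rewrite !phis_cons !psis_cons mulmxDl !mulmxDr -!scalemxAl.
rewrite delta_mul_ones // erow_mul_delta // mul_delta_mx IH.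
apply/matrixP=> i j; rewrite !ord1 !mxE !eqxx !mulr1n; ring.
Qed.

Lemma hrow_ones r : uniq r -> hrow r *m ones r = (\sum_(s <- r) h s)%:M.
Proof.
elim: r => [_|s r IH]; first by rewrite mul0mx big_nil raddf0.
rewrite cons_uniq => /andP[sr /IH {}IH] /=.
rewrite mulmxDl !mulmxDr -!scalemxAl delta_mul_ones // hrow_mul_delta //.
rewrite mul_delta_mx IH big_cons.
apply/matrixP=> i j; rewrite !ord1 !mxE !eqxx !mulr1n; ring.
Qed.

Lemma hrow_pvec r t : uniq r ->
  hrow r *m pvec r t = ((phis r).[t] - (psis r).[t])%:M.
Proof.
elim: r => [_|s r IH].
  by rewrite mul0mx /phis /psis !big_nil !hornerC subrr raddf0.
rewrite cons_uniq => /andP[sr /IH {}IH] /=.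
rewrite !phis_cons !psis_cons pvec_cons mulmxDl !mulmxDr -!scalemxAl -!scalemxAr.
rewrite delta_mul_pvec // hrow_mul_delta // mul_delta_mx IH.
apply/matrixP=> i j; rewrite !ord1 !mxE !eqxx !mulr1n; ring.
Qed.

Variable x : K.
Hypothesis alx0 : forall s, alx x s != 0.
Local Notation f := (fvec (alx x) (bex x)).
Local Notation g := (gscal (alx x) (bex x)).
Local Notation A := (Amx (alx x) (bex x)).
Local Notation C := (Crow (alx x) (bex x)).

Lemma phis_neq0 r : (phis r).[x] != 0.
Proof. by rewrite -prod_alx prodf_seq_neq0; apply/allP=> s _; apply/implyP. Qed.

Lemma fvec_pvec r : f r = - (phis r).[x]^-1 *: pvec r x.
Proof.
elim: r => [|s r IH] /=.
  by apply/colP=> i; rewrite !mxE horner0 mulr0.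
rewrite IH pvec_cons phis_cons; apply/colP=> i; rewrite !mxE.
have := alx0 s; have := phis_neq0 r; rewrite /bex /alx.
move: (nat_of_bool _) => b ? ?; field; exact/andP.
Qed.

Lemma Gmx_mul s (v w : 'cV[K]_k) :
  Gmx (alx x) (bex x) s v *m w =
  w - (w s 0 / alx x s) *: (delta_mx s 0 + h s *: v).
Proof. by rewrite Gmx_col /bex /alx opprB addrCA subrr addr0. Qed.

Lemma delta_mul_A r s (v : 'cV[K]_k) : s \notin r -> (A r *m v) s 0 = v s 0.
Proof.
move=> sr; have /matrixP/(_ 0 0) := congr1 (mulmx^~ v) (delta_mul_Amx (alx x) (bex x) sr).
by rewrite -mulmxA -!rowE !mxE.
Qed.

(** Here and in [Crow_ones] stand the leading terms in [t] of [Amx_pvec] and [Crow_pvec]; they make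
    [ones] the one-particle vector of a root at infinity. *)
Lemma Amx_ones r : uniq r -> A r *m ones r = ones r + f r.
Proof.
elim: r => [_|s r IH]; first by rewrite /= mul1mx addr0.
rewrite cons_uniq => /andP[sr /IH {}IH] /=.
have e : (ones r) s 0 = 0.
  by have /matrixP/(_ 0 0) := delta_mul_ones sr; rewrite -rowE !mxE.
rewrite -mulmxA Gmx_mul delta_mul_A // mulmxDr Amx_mul_delta // IH.
apply/colP=> i; rewrite !mxE e !eqxx /= /bex addr0.
have := alx0 s; rewrite /alx => ?; move: (nat_of_bool _) => b; by field.
Qed.

Lemma Crow_ones r : uniq r -> C r *m ones r = (1 - g r)%:M.
Proof.
elim: r => [_|s r IH]; first by rewrite mul0mx subrr raddf0.
rewrite cons_uniq => /andP[sr /IH {}IH] /=.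
rewrite mulmxDl !mulmxDr -!scalemxAl delta_mul_ones // Crow_mul_delta //.
rewrite mul_delta_mx IH.
apply/matrixP=> i j; rewrite !ord1 !mxE !eqxx !mulr1n /bex.
by have := alx0 s; rewrite /alx => ?; field.
Qed.

(** The one-particle form of the exchange relation between [T_11(x)] and [T_12(t)]: a wanted term
    with factor [1 - 1/(x - t)] and an unwanted term along [p(x)]. *)
Lemma Amx_pvec r t : uniq r ->
  (x - t) *: (A r *m pvec r t) =
  (x - t - 1) *: pvec r t + ((phis r).[t] / (phis r).[x]) *: pvec r x.
Proof.
elim: r => [_|s r IH].
  rewrite mul1mx /phis !big_nil !hornerC.
  by apply/colP=> i; rewrite !mxE !horner0 !mulr0 addr0.
rewrite cons_uniq => /andP[sr /IH {}IH].
have -> : A (s :: r) = Gmx (alx x) (bex x) s (f r) *m A r by [].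
rewrite -mulmxA Gmx_mul delta_mul_A // !pvec_cons mulmxDr -!scalemxAr.
rewrite Amx_mul_delta // fvec_pvec !phis_cons.
move/colP: IH => IH; apply/colP=> i; have {IH} := IH i.
have := alx0 s; have := phis_neq0 r; have := pvec_notin t sr; rewrite /alx.
rewrite !mxE !eqxx => -> q0 a0; rewrite mulr1 mulr0 addr0.
move: (\sum__ _) (nat_of_bool _) => E b IH.
set P := (phis r).[t] in IH *; set Q := (phis r).[x] in q0 IH *.
set px := (ppol r i).[x] in IH *.
apply: (@eq_trans _ _ ((t - a s - h s) * ((x - t) * E) +
  (x - t) * (P * b%:R - P / (x - a s) * (b%:R - h s * px / Q)))).
  by field; apply/andP.
by rewrite IH; field; apply/andP.
Qed.

Lemma Crow_pvec r t : uniq r ->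
  (x - t) *: (C r *m pvec r t) = ((phis r).[t] * g r - (psis r).[t])%:M.
Proof.
elim: r => [_|s r IH].
  rewrite mul0mx scaler0 /phis /psis !big_nil !hornerC mulr1 subrr.
  by rewrite raddf0.
rewrite cons_uniq => /andP[sr /IH {}IH] /=.
rewrite !phis_cons !psis_cons pvec_cons mulmxDl !mulmxDr -!scalemxAl -!scalemxAr.
rewrite delta_mul_pvec // Crow_mul_delta // mul_delta_mx.
move/matrixP/(_ 0 0): IH; rewrite !mxE !mulr1n => IH.
apply/matrixP=> i j; rewrite !ord1 !mxE !eqxx !mulr1n /bex.
have := alx0 s; rewrite /alx => a0.
move: (\sum__ _) IH => E IH; set P := (phis r).[t] in IH *.
apply: (@eq_trans _ _ ((t - a s - h s) * ((x - t) * E) +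
  (x - t) * g r * h s / (x - a s) * P)); first by field.
by rewrite IH; field.
Qed.

End SpectralParameter.

(** * Fock space realization of the tensor product *)

Section FockSpace.
Variables (R : realType) (k : nat).
Local Notation C := (R[i])%C.
Local Notation I := (Idx k).
Local Notation n := (Defs.dim k).

Definition flip (s : 'I_k) (J : I) : I := [ffun t => J t (+) (t == s)].
Definition par (s : 'I_k) (J : I) : bool := odd (\sum_(t < k | (t < s)%N) (J t : nat)).

Definition basis_vec (J : I) : 'cV[C]_n := \col_p (enum_val p == J)%:R.

Definition cre (s : 'I_k) : 'M[C]_n :=
  ker_mx (fun out inp => ((out == flip s inp) && ~~ inp s)%:R * sgn R (par s inp)).
Definition ann (s : 'I_k) : 'M[C]_n :=
  ker_mx (fun out inp => ((out == flip s inp) && inp s)%:R * sgn R (par s inp)).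

Lemma ker_mx_basis (F : I -> I -> C) J p : (ker_mx F *m basis_vec J) p 0 = F (enum_val p) J.
Proof.
rewrite mxE (bigD1 (enum_rank J)) //= !mxE enum_rankK eqxx mulr1 big1 ?addr0 // => q qJ.
rewrite !mxE; case: eqP => [e|]; last by rewrite mulr0.
by rewrite -e enum_valK eqxx in qJ.
Qed.

Lemma basis_ext (m : nat) (M N : 'M[C]_(m, n)) :
  (forall J, M *m basis_vec J = N *m basis_vec J) -> M = N.
Proof.
move=> e; apply/matrixP=> i q; have /matrixP/(_ i 0) := e (enum_val q).
have h (P : 'M[C]_(m, n)) : (P *m basis_vec (enum_val q)) i 0 = P i q.
  rewrite mxE (bigD1 q) //= !mxE eqxx mulr1 big1 ?addr0 // => p pq.
  by rewrite !mxE (inj_eq enum_val_inj) (negPf pq) mulr0.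
by rewrite !h.
Qed.

Lemma cre_basis s J :
  cre s *m basis_vec J = ((~~ J s)%:R * sgn R (par s J)) *: basis_vec (flip s J).
Proof.
apply/colP=> p; rewrite ker_mx_basis !mxE.
by case: eqP => _; rewrite ?mul0r ?mulr0 ?mulr1.
Qed.

Lemma ann_basis s J :
  ann s *m basis_vec J = ((J s)%:R * sgn R (par s J)) *: basis_vec (flip s J).
Proof.
apply/colP=> p; rewrite ker_mx_basis !mxE.
by case: eqP => _; rewrite ?mul0r ?mulr0 ?mulr1.
Qed.

Lemma flipC s t J : flip s (flip t J) = flip t (flip s J).
Proof. by apply/ffunP=> u; rewrite !ffunE addbAC. Qed.

Lemma flipK s : involutive (flip s).
Proof. by move=> J; apply/ffunP=> u; rewrite !ffunE addbK. Qed.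

Lemma par_flip s t J : par s (flip t J) = par s J (+) (t < s)%N.
Proof.
rewrite /par; case: (ltnP t s) => ts; last first.
  rewrite addbF; congr odd; apply: eq_bigr => u us; rewrite ffunE.
  case: eqP => [e|]; last by rewrite addbF.
  by rewrite -e leqNgt us in ts.
rewrite (bigD1 t) //= [in RHS](bigD1 t) //= !oddD !oddb ffunE eqxx addbT addbAC.
rewrite addbT !addNb; congr (~~ (_ (+) odd _)); apply: eq_bigr => u /andP[_ ut].
by rewrite ffunE (negPf ut) addbF.
Qed.

Lemma sgn_addb b c : sgn R (b (+) c) = sgn R b * sgn R c.
Proof. by case: b c => [] [] /=; rewrite ?mulr1 ?mul1r ?mulrNN ?mulr1. Qed.

Lemma sgn_sqr b : sgn R b * sgn R b = 1.
Proof. by rewrite -sgn_addb addbb. Qed.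

Lemma car_cre_ann : anticommutation cre ann.
Proof.
split=> [s t|s t|s t]; apply: basis_ext => J.
- rewrite mulNmx -!mulmxA !cre_basis -!scalemxAr !cre_basis !scalerA flipC.
  rewrite -scaleNr; congr (_ *: _).
  rewrite !par_flip !sgn_addb !ffunE [t == s]eq_sym -val_eqE /=.
  by case: (ltngtP s t) => [_|_|/val_inj ->];
     case: (J s) (J t) (par s J) (par t J) => [] [] [] []; rewrite /sgn /=; ring.
- rewrite mulNmx -!mulmxA !ann_basis -!scalemxAr !ann_basis !scalerA flipC.
  rewrite -scaleNr; congr (_ *: _).
  rewrite !par_flip !sgn_addb !ffunE [t == s]eq_sym -val_eqE /=.
  by case: (ltngtP s t) => [_|_|/val_inj ->];
     case: (J s) (J t) (par s J) (par t J) => [] [] [] []; rewrite /sgn /=; ring.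
- rewrite mulmxBl -!mulmxA !cre_basis !ann_basis -!scalemxAr !cre_basis !ann_basis.
  rewrite !scalerA -scalemx1 -scalemxAl mul1mx flipC.
  rewrite !par_flip !sgn_addb !ffunE [t == s]eq_sym -val_eqE /=.
  case: (ltngtP s t) => [_|_|/val_inj ->]; last first.
    rewrite flipK -scalerBl; congr (_ *: _).
    by case: (J t) (par t J) => [] []; rewrite /sgn /=; ring.
  all: rewrite mulr0n scale0r sub0r -scaleNr; congr (_ *: _).
  all: by case: (J s) (J t) (par s J) (par t J) => [] [] [] []; rewrite /sgn /=; ring.
Qed.

Lemma vacE : vac R k = basis_vec [ffun=> false].
Proof. by apply/colP=> p; rewrite !mxE; case: eqP. Qed.

Lemma ann_vac s : ann s *m vac R k = 0.
Proof. by rewrite vacE ann_basis ffunE mul0r scale0r. Qed.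

End FockSpace.

(** * Sums over auxiliary paths as products of two by two matrices *)

Section PathSums.
Variable S : comPzRingType.

(** An entry of the ordered product of the two by two matrices [g s], the head of the list standing
    rightmost. *)
Fixpoint pathsum (I : Type) (g : I -> bool -> bool -> S) (r : seq I) (i j : bool) : S :=
  if r is s :: r' then
    g s false j * pathsum g r' i false + g s true j * pathsum g r' i true
  else (i == j)%:R.

Lemma pathsum_map (I J : Type) (f : J -> I) (g : I -> bool -> bool -> S) r i j :
  pathsum g (map f r) i j = pathsum (g \o f) r i j.
Proof. by elim: r j => //= s r IH j; rewrite !IH. Qed.

(** A path is its initial value together with its shift; splitting off that value and then summing
    over the next one reproduces the recursion of [pathsum]. *)
Lemma pathsum_ffun k (g : 'I_k -> bool -> bool -> S) i j :
  \sum_(a : {ffun 'I_k.+1 -> bool} | (a ord0 == j) && (a ord_max == i))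
     \prod_(s < k) g s (a (lift ord0 s)) (a (widen_ord (leqnSn k) s)) =
  pathsum g (enum 'I_k) i j.
Proof.
elim: k g j => [|k IH] g j.
  have -> : enum 'I_0 = [::] by apply: size0nil; rewrite size_enum_ord.
  rewrite /=; under eq_bigr do rewrite big_ord0.
  rewrite sumr_const; case: eqP => [->|ij].
    rewrite (@eq_card1 _ [ffun=> j]) // => a; rewrite !inE.
    apply/andP/eqP => [[/eqP aj _]|->].
      by apply/ffunP=> u; rewrite ffunE ord1.
    by rewrite !ffunE.
  rewrite eq_card0 // => a; rewrite !inE.
  by apply/negP=> /andP[/eqP aj /eqP ai]; apply: ij; rewrite -ai -aj; congr (a _); apply: val_inj.
pose F (p : bool * {ffun 'I_k.+1 -> bool}) : {ffun 'I_k.+2 -> bool} :=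
  [ffun u => if unlift (ord0 : 'I_k.+2) u is Some v then p.2 v else p.1].
pose G (a : {ffun 'I_k.+2 -> bool}) := (a ord0, [ffun v => a (lift ord0 v)]).
have FK : cancel F G.
  case=> c a; rewrite /G /F !ffunE unlift_none /=; congr pair.
  by apply/ffunP=> v; rewrite !ffunE liftK.
have GK : cancel G F.
  move=> a; apply/ffunP=> u; rewrite ffunE; case: unliftP => [v ->|-> //].
  by rewrite ffunE.
rewrite (reindex F) /=; last by exists G => ? _; [exact: FK|exact: GK].
rewrite (eq_bigl (fun p : bool * {ffun 'I_k.+1 -> bool} =>
  (p.1 == j) && (p.2 ord_max == i))); last first.
  case=> c a; rewrite !ffunE unlift_none /=.
  have -> : ord_max = lift ord0 ord_max :> 'I_k.+2 by apply: val_inj.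
  by rewrite liftK.
rewrite -(pair_big_dep (fun c => c == j) (fun _ (a : {ffun 'I_k.+1 -> bool}) => a ord_max == i)
  (fun c a => \prod_(s < k.+1)
    g s (F (c, a) (lift ord0 s)) (F (c, a) (widen_ord (leqnSn k.+1) s)))) /=.
rewrite big_pred1_eq.
have e a :
    \prod_(s < k.+1) g s (F (j, a) (lift ord0 s)) (F (j, a) (widen_ord (leqnSn k.+1) s)) =
    g ord0 (a ord0) j *
    \prod_(s < k) g (lift ord0 s) (a (lift ord0 s)) (a (widen_ord (leqnSn k) s)).
  rewrite big_ord_recl /F !ffunE liftK.
  rewrite (_ : widen_ord _ _ = ord0); last exact: val_inj.
  rewrite unlift_none /=; congr (_ * _); apply: eq_bigr => s _; rewrite !ffunE liftK.
  rewrite (_ : widen_ord _ _ = lift ord0 (widen_ord (leqnSn k) s)); last exact: val_inj.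
  by rewrite liftK.
under eq_bigr do rewrite e.
rewrite (bigID (fun a : {ffun _} => a ord0)) /= addrC enum_ordSl /=.
rewrite !(pathsum_map (lift ord0)) -!IH !mulr_sumr; congr (_ + _).
  apply: eq_big => a; first by rewrite andbC eqbF_neg.
  by move=> /andP[_ /negPf ->].
apply: eq_big => a; first by rewrite andbC eqb_id.
by move=> /andP[_ ->].
Qed.

End PathSums.

Lemma eq_pathsum (S : comPzRingType) (I : eqType) (g g' : I -> bool -> bool -> S) r i j :
  {in r, forall s a c, g s a c = g' s a c} -> pathsum g r i j = pathsum g' r i j.
Proof.
elim: r j => //= s r IH j e; rewrite !e ?mem_head //.
by rewrite !IH // => t tr; apply: e; rewrite inE tr orbT.
Qed.

Section Realization.
Variables (R : realType) (k : nat).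
Local Notation C := (R[i])%C.
Local Notation I := (Idx k).
Local Notation n := (Defs.dim k).
Variables (lam : 'I_k -> C * C) (b : 'I_k -> C).

Definition wa s := b s - (lam s).1.
Definition wh s := (lam s).1 + (lam s).2.

(** The super sign is multiplicative over the sites, and its factor at [s] depends only on the step
    of the path at [s] and on the input before [s]; it can therefore be absorbed into local
    weights. *)
Lemma ktensor_pathsum (F : 'I_k -> bool -> bool -> bool -> bool -> C) i j (out inp : I) :
  ktensor F i j out inp =
  pathsum (fun s a c => sgn R ((a (+) c) && par s inp) * F s a c (out s) (inp s))
    (enum 'I_k) i j.
Proof.
rewrite -pathsum_ffun; apply: eq_bigr => a _; rewrite big_split; congr (_ * _) => /=.
have e : {morph odd : x y / (x + y)%N >-> x (+) y} by move=> x y; rewrite oddD.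
rewrite (big_morph odd e (erefl : odd 0 = false)).
rewrite (big_morph (sgn R) (@sgn_addb R) (erefl : sgn R false = 1)).
by apply: eq_bigr => s _; rewrite oddM oddb.
Qed.

Lemma ker_mx_mul (F G : I -> I -> C) :
  ker_mx F *m ker_mx G = ker_mx (fun out inp => \sum_mid F out mid * G mid inp).
Proof.
apply/matrixP=> p q; rewrite !mxE [RHS](reindex (@enum_val I predT)) /=.
  by apply: eq_bigr => u _; rewrite !mxE.
by apply: onW_bij; exact: enum_val_bij.
Qed.

Definition agree (P : pred 'I_k) (out inp : I) : bool :=
  [forall t, P t ==> (out t == inp t)].

Lemma agreeP (P : pred 'I_k) (out inp : I) :
  reflect (forall t, P t -> out t = inp t) (agree P out inp).
Proof.
apply: (iffP forallP) => [e t Pt|e t]; first by apply/eqP; have := e t; rewrite Pt.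
by apply/implyP=> Pt; apply/eqP/e.
Qed.

Lemma flip_agree s (out inp : I) :
  (out == flip s inp) = agree [pred t | t != s] out inp && (out s == ~~ inp s).
Proof.
apply/eqP/andP => [->|[/agreeP e /eqP es]].
  rewrite ffunE eqxx addbT; split=> //; apply/agreeP=> t /negPf ts.
  by rewrite ffunE ts addbF.
apply/ffunP=> t; rewrite ffunE; case: (eqVneq t s) => [->|ts].
  by rewrite addbT.
by rewrite addbF e.
Qed.

Lemma eq_agree s (out inp : I) :
  (out == inp) = agree [pred t | t != s] out inp && (out s == inp s).
Proof.
apply/eqP/andP => [->|[/agreeP e /eqP es]]; first by split=> //; apply/agreeP.
by apply/ffunP=> t; case: (eqVneq t s) => [->//|ts]; rewrite e.
Qed.

Lemma num_basis (s : 'I_k) (J : I) :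
  cre R s *m ann R s *m basis_vec R J = (J s)%:R *: basis_vec R J.
Proof.
rewrite -mulmxA ann_basis -scalemxAr cre_basis flipK scalerA ffunE eqxx addbT negbK.
rewrite par_flip ltnn addbF; congr (_ *: _).
case: (J s); last by rewrite !mul0r.
by rewrite !mul1r sgn_sqr.
Qed.

Lemma site_op_ker x s i j :
  site_op (@cre R k) (@ann R k) (alx wa x) (bex wa wh x) s i j =
  ker_mx (fun out inp => (agree [pred t | t != s] out inp)%:R *
    (sgn R ((i (+) j) && par s inp) * site_pol (lam s) (b s) i j x (out s) (inp s))).
Proof.
apply: basis_ext => J; apply/colP=> p; rewrite ker_mx_basis.
case: i j => [] [] /=.
- rewrite mulmxBl -scalemxAl mul1mx num_basis !mxE (eq_agree s) -mulnb natrM.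
  move: (agree _ _ _)%:R => g; rewrite /site_pol /e_site /bex /wa /wh /sgn /=.
  by case: (enum_val p s) (J s) => [] []; rewrite /=; ring.
- rewrite -scalemxAl ann_basis !mxE flip_agree -mulnb natrM.
  move: (agree _ _ _)%:R => g; rewrite /site_pol /e_site /alx /bex /wa /wh /sgn /=.
  by case: (enum_val p s) (J s) (par s J) => [] [] []; rewrite /=; ring.
- rewrite mulNmx cre_basis !mxE flip_agree -mulnb natrM.
  move: (agree _ _ _)%:R => g; rewrite /site_pol /e_site /alx /bex /wa /wh /sgn /=.
  by case: (enum_val p s) (J s) (par s J) => [] [] []; rewrite /=; ring.
- rewrite mulmxBl -scalemxAl mul1mx num_basis !mxE (eq_agree s) -mulnb natrM.
  move: (agree _ _ _)%:R => g; rewrite /site_pol /e_site /alx /wa /wh /sgn /=.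
  by case: (enum_val p s) (J s) => [] []; rewrite /=; ring.
Qed.

Lemma monodromy_cons (K : numFieldType) m (cr an : 'I_k -> 'M[K]_m) al be s r i j :
  monodromy cr an al be (s :: r) i j =
    site_op cr an al be s false j *m monodromy cr an al be r i false
    + site_op cr an al be s true j *m monodromy cr an al be r i true.
Proof. by []. Qed.

(** Sortedness makes the signs agree: the head site acts last, and the sites altered before it all
    lie to its right, where they do not enter its Jordan-Wigner parity. *)
Lemma monodromy_ker x (r : seq 'I_k) i j : sorted ltn (map val r) ->
  monodromy (@cre R k) (@ann R k) (alx wa x) (bex wa wh x) r i j =
  ker_mx (fun out inp => (agree [pred t | t \notin r] out inp)%:R *
    pathsum (fun s a c => sgn R ((a (+) c) && par s inp) *
       site_pol (lam s) (b s) a c x (out s) (inp s)) r i j).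
Proof.
elim: r i j => [|s r IH] i j.
  move=> _ /=; have -> : (if i == j then 1%:M else 0) = ((i == j)%:R)%:M :> 'M[C]_n.
    by case: (i == j); rewrite ?raddf0.
  apply/matrixP=> p q; rewrite !mxE mulr_natl; congr (_ *+ nat_of_bool _).
  rewrite -(inj_eq enum_val_inj).
  apply/eqP/agreeP => [-> //|e]; apply/ffunP=> t; exact: e.
rewrite map_cons [sorted _ _]/= (path_sortedE ltn_trans) => /andP[/allP lt_sr sr].
have nsr : s \notin r.
  by apply/negP=> /(map_f val) /lt_sr /=; rewrite ltnn.
rewrite monodromy_cons !IH // !site_op_ker !ker_mx_mul.
apply/matrixP=> p q; rewrite !mxE; move: (enum_val p) (enum_val q) => out inp.
(* The only intermediate state that contributes: the sites of [r] have reached their final values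
   and [s] still has its input value. *)
pose mid : I := [ffun t => if t == s then inp s else out t].
have key a : \sum_m (agree [pred t | t != s] out m)%:R *
    (sgn R ((a (+) j) && par s m) * site_pol (lam s) (b s) a j x (out s) (m s)) *
    ((agree [pred t | t \notin r] m inp)%:R *
     pathsum (fun s a c => sgn R ((a (+) c) && par s inp) *
       site_pol (lam s) (b s) a c x (m s) (inp s)) r i a) =
  (agree [pred t | t \notin s :: r] out inp)%:R *
    ((sgn R ((a (+) j) && par s inp) * site_pol (lam s) (b s) a j x (out s) (inp s)) *
    pathsum (fun s a c => sgn R ((a (+) c) && par s inp) *
       site_pol (lam s) (b s) a c x (out s) (inp s)) r i a).
  rewrite (bigD1 mid) //= [X in _ + X]big1 ?addr0; last first.
    move=> m /eqP mm; case: agreeP => [e1|]; last by rewrite !mul0r.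
    case: agreeP => [e2|]; last by rewrite mul0r mulr0.
    case: mm; apply/ffunP=> t; rewrite ffunE; case: (eqVneq t s) => [->|ts].
      exact: e2.
    by rewrite e1.
  have -> : agree [pred t | t != s] out mid.
    by apply/agreeP=> t /negPf ts; rewrite ffunE ts.
  have -> : agree [pred t | t \notin r] mid inp = agree [pred t | t \notin s :: r] out inp.
    apply/agreeP/agreeP => e t /=.
      by rewrite inE negb_or => /andP[/negPf ts /e]; rewrite ffunE ts.
    by move=> tr; rewrite ffunE; case: (eqVneq t s) => [->//|ts]; rewrite e //= inE negb_or ts.
  case: agreeP => [e|]; last by rewrite !mul0r mulr0.
  rewrite !mul1r ffunE eqxx; congr (_ * _); last first.
    apply: eq_pathsum => t tr a' c'; rewrite ffunE.
    by case: eqP => // ts; rewrite -ts tr in nsr.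
  congr (sgn R (_ && _) * _); congr odd; apply: eq_bigr => t ts; rewrite ffunE.
  case: eqP => [->//|nts]; rewrite e //= inE negb_or; apply/andP; split; first exact/eqP.
  by apply/negP=> /(map_f val) /lt_sr /=; rewrite ltnNge (ltnW ts).
by apply: etrans (congr2 +%R (key false) (key true)) _; rewrite -mulrDr.
Qed.

Lemma Tpol_mono x i j :
  Tpol lam b i j x =
  monodromy (@cre R k) (@ann R k) (alx wa x) (bex wa wh x) (enum 'I_k) i j.
Proof.
rewrite monodromy_ker; last by rewrite val_enum_ord iota_ltn_sorted.
apply/matrixP=> p q; rewrite !mxE /Tpol_ker ktensor_pathsum.
by rewrite (_ : agree _ _ _) ?mul1r //; apply/agreeP=> t; rewrite /= mem_enum.
Qed.

End Realization.

(** * Polynomial identities on dense sets and the coefficients of the transfer matrix *)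

Lemma poly_vanish (K : numFieldType) (p : {poly K}) : (forall x, p.[x] = 0) -> p = 0.
Proof.
move=> p0; apply/eqP/negPn/negP=> pN0.
pose rs : seq K := [seq i%:R | i <- iota 0 (size p)].
have : (size rs < size p)%N.
  apply: max_poly_roots => //; first by apply/allP=> _ /mapP[i _ ->]; apply/eqP/p0.
  by rewrite map_inj_uniq ?iota_uniq // => i j /eqP; rewrite eqr_nat => /eqP.
by rewrite size_map size_iota ltnn.
Qed.

Lemma poly_vanish_gen (K : numFieldType) (g p : {poly K}) : g != 0 ->
  (forall x, g.[x] != 0 -> p.[x] = 0) -> p = 0.
Proof.
move=> g0 gp; have : p * g = 0.
  apply: poly_vanish => x; rewrite hornerM.
  by have [->|/gp ->] := eqVneq g.[x] 0; rewrite ?mulr0 ?mul0r.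
by move/eqP; rewrite mulf_eq0 (negPf g0) orbF => /eqP.
Qed.

(** The reversed polynomial [x ^+ size p * p(1/x)] vanishes off the roots of [g * 'X], and reversal
    loses no coefficient. *)
Lemma poly_vanish_inv (K : numFieldType) (g p : {poly K}) : g != 0 ->
  (forall x, x != 0 -> g.[x] != 0 -> p.[x^-1] = 0) -> p = 0.
Proof.
move=> g0 gp; pose q := \sum_(i < size p) p`_i *: 'X^(size p - i).
have qE x : x != 0 -> q.[x] = x ^+ size p * p.[x^-1].
  move=> x0; rewrite horner_sum (horner_coef p) mulr_sumr; apply: eq_bigr => i _.
  rewrite hornerZ hornerXn exprVn mulrCA; congr (_ * _).
  by rewrite -[RHS]expfB_cond ?(negPf x0) // add0n ltnW.
have q0 : q = 0.
  apply: (@poly_vanish_gen _ (g * 'X)); first by rewrite mulf_neq0 ?polyX_eq0.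
  move=> x; rewrite hornerM hornerX mulf_eq0 negb_or => /andP[gx x0].
  by rewrite qE // gp ?mulr0.
apply/polyP=> i; rewrite coef0; case: (ltnP i (size p)) => [ip|]; last exact: nth_default.
have := congr1 (fun r : {poly K} => r`_(size p - i)) q0; rewrite coef0 coef_sum.
rewrite (bigD1 (Ordinal ip)) //= coefZ coefXn eqxx mulr1 big1 ?addr0 // => j ji.
rewrite coefZ coefXn; case: eqP => [e|]; last by rewrite mulr0.
case/eqP: ji; apply: val_inj => /=; have := ltn_ord j; move: e ip => /=; lia.
Qed.

Section Coefficients.
Variables (R : realType) (k : nat).
Local Notation C := (R[i])%C.
Local Notation I := (Idx k).
Local Notation n := (Defs.dim k).
Variables (lam : 'I_k -> C * C) (b : 'I_k -> C).

(* [(1 - b_s y) T_ij(1/y)] on one site, as a polynomial in [y] *)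
Definition site_inv (s : 'I_k) (i j : bool) (out inp : bool) : {poly C} :=
  ((i == j) && (out == inp))%:R%:P +
  (sgn R j * e_site (lam s) j i out inp - b s * ((i == j) && (out == inp))%:R)%:P * 'X.

(** The product of the series [1 / (1 - b_s y)], each cut off after degree [m]. It converts
    [Tinv_ker] into the expansion of [T_ij], correctly up to order [m]. *)
Definition geom (m : nat) : {poly C} := \prod_(s < k) \poly_(l < m.+1) b s ^+ l.

Definition Tinv_ker (i j : bool) (out inp : I) : {poly C} :=
  \sum_(a : {ffun 'I_k.+1 -> bool} | (a ord0 == j) && (a ord_max == i))
    (sgn R (odd (\sum_(s < k)
          ((a (lift ord0 s) (+) a (widen_ord (leqnSn k) s)) : nat) *
          \sum_(t < k | (t < s)%N) (inp t : nat))))%:P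
    * \prod_(s < k) site_inv s (a (lift ord0 s)) (a (widen_ord (leqnSn k) s))
                      (out s) (inp s).

Lemma Tpol_ker_inv i j x out inp : x != 0 ->
  Tpol_ker lam b i j x out inp = x ^+ k * (Tinv_ker i j out inp).[x^-1].
Proof.
move=> x0; rewrite /Tinv_ker horner_sum mulr_sumr; apply: eq_bigr => a _.
rewrite hornerM hornerC mulrCA; congr (_ * _); rewrite horner_prod.
have {1}-> : x ^+ k = \prod_(s < k) x by rewrite prodr_const card_ord.
rewrite -big_split; apply: eq_bigr => s _ /=.
by rewrite /site_inv /site_pol hornerD hornerM hornerX !hornerC; field.
Qed.

Lemma coef_prod_ffun (Q : 'I_k -> {poly C}) m :
  \sum_(rho : {ffun 'I_k -> 'I_m.+1} | (\sum_(s < k) (rho s : nat) == m)%N)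
     \prod_(s < k) (Q s)`_(rho s) = (\prod_s Q s)`_m.
Proof.
(* [Q s] may have terms beyond degree [m], which [rho] does not reach; cutting them off does not
   change the coefficient at [m]. *)
pose P s := \poly_(l < m.+1) (Q s)`_l.
have -> : (\prod_s Q s)`_m = (\prod_s P s)`_m.
  suff h : forall l, (l <= m)%N -> (\prod_s Q s)`_l = (\prod_s P s)`_l by exact: h.
  elim/big_ind2: _ => // [p1 p2 q1 q2 h1 h2 l lm|s _ l lm].
    rewrite !coefM; apply: eq_bigr => j _.
    by rewrite h1 ?h2 //; have := ltn_ord j; lia.
  by rewrite coef_poly ltnS lm.
rewrite /P; under [in RHS]eq_bigr do rewrite poly_def.
rewrite bigA_distr_bigA /= coef_sum big_mkcond /=; apply: eq_bigr => rho _.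
rewrite scaler_prod prodrXr coefZ coefXn [m == _]eq_sym.
by case: eqP; rewrite ?mulr1 ?mulr0.
Qed.

Lemma Tcoef_ker_inv i j m out inp :
  Tcoef_ker lam b i j m out inp = (Tinv_ker i j out inp * geom m)`_m.
Proof.
rewrite /Tcoef_ker /ktensor exchange_big /= mulr_suml coef_sum.
apply: eq_bigr => a _; rewrite -mulrA coefCM -mulr_sumr; congr (_ * _).
rewrite -big_split /= -coef_prod_ffun; apply: eq_bigr => rho _.
apply: eq_bigr => s _; rewrite /site_inv mulrDl coefD coefCM -mulrA coefCM coefXM.
rewrite !coef_poly ltn_ord /site_ser; case: (rho s) => [[|l] lm] /=.
  by rewrite mulr0 addr0 mulr1.
by rewrite (ltnW lm) exprS; ring.
Qed.

Lemma geom_coef0 m : (geom m)`_0 = 1.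
Proof.
rewrite -horner_coef0 horner_prod big1 // => s _.
by rewrite horner_coef0 coef_poly.
Qed.

(** The cut-off varies with [m], but the resulting linear system is triangular with unit diagonal,
    since every [geom m] has constant term 1. *)
Lemma geom_mul_inj (q : {poly C}) : (forall m, (q * geom m)`_m = 0) -> q = 0.
Proof.
move=> q0; apply/polyP=> m; rewrite coef0.
elim/ltn_ind: m => m IH; have := q0 m; rewrite coefM big_ord_recr /= subnn geom_coef0.
rewrite mulr1 big1 ?add0r // => j _.
by rewrite IH ?mul0r.
Qed.

Lemma bilin_ker (u : 'rV[C]_n) (F : I -> I -> C) (w : 'cV[C]_n) :
  (u *m ker_mx F *m w) 0 0 =
  \sum_p \sum_q u 0 p * w q 0 * F (enum_val p) (enum_val q).
Proof.
rewrite -mulmxA mxE; apply: eq_bigr => p _; rewrite mxE mulr_sumr.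
by apply: eq_bigr => q _; rewrite mxE; ring.
Qed.

(** One polynomial governs both the values of [Tpol] and all the [Tcoef], so that vanishing of a
    matrix element passes in both directions. *)
Lemma Tinv_bilin (u : 'rV[C]_n) i j (w : 'cV[C]_n) : exists q : {poly C},
  (forall x, x != 0 -> (u *m Tpol lam b i j x *m w) 0 0 = x ^+ k * q.[x^-1]) /\
  (forall m, (u *m Tcoef lam b i j m *m w) 0 0 = (q * geom m)`_m).
Proof.
exists (\sum_p \sum_q (u 0 p * w q 0)%:P * Tinv_ker i j (enum_val p) (enum_val q)).
split=> [x x0|m]; rewrite bilin_ker.
  rewrite horner_sum mulr_sumr; apply: eq_bigr => p _.
  rewrite horner_sum mulr_sumr; apply: eq_bigr => q _.
  by rewrite hornerM hornerC Tpol_ker_inv //; ring.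
rewrite mulr_suml coef_sum; apply: eq_bigr => p _.
rewrite mulr_suml coef_sum; apply: eq_bigr => q _.
by rewrite Tcoef_ker_inv -coefCM mulrA.
Qed.

Definition TQpol (q1 q2 : C) x : 'M[C]_n :=
  q1 *: Tpol lam b false false x - q2 *: Tpol lam b true true x.

Lemma TQ_bilin q1 q2 (u : 'rV[C]_n) (w : 'cV[C]_n) : exists q : {poly C},
  (forall x, x != 0 -> (u *m TQpol q1 q2 x *m w) 0 0 = x ^+ k * q.[x^-1]) /\
  (forall m, (u *m TQ lam b q1 q2 m *m w) 0 0 = (q * geom m)`_m).
Proof.
have [qA [A1 A2]] := Tinv_bilin u false false w.
have [qD [D1 D2]] := Tinv_bilin u true true w.
have e (M N : 'M[C]_n) : (u *m (q1 *: M - q2 *: N) *m w) 0 0 =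
    q1 * (u *m M *m w) 0 0 - q2 * (u *m N *m w) 0 0.
  rewrite !(mulmxBr, mulmxBl) -!(scalemxAl, scalemxAr).
  by move: (u *m M *m w) (u *m N *m w) => X Y; rewrite !mxE.
exists (q1 *: qA - q2 *: qD); split=> [x x0|m].
  by rewrite e A1 // D1 // hornerD hornerN !hornerZ; ring.
by rewrite e A2 // D2 // mulrBl coefB -!scalerAl !coefZ.
Qed.

Lemma Tcoef_of_Tpol (g : {poly C}) i j (u : 'rV[C]_n) (w : 'cV[C]_n) : g != 0 ->
  (forall x, g.[x] != 0 -> u *m Tpol lam b i j x *m w = 0) ->
  forall m, u *m Tcoef lam b i j m *m w = 0.
Proof.
move=> g0 h m; have [q [q1 q2]] := Tinv_bilin u i j w.
rewrite [LHS]mx11_scalar q2 (_ : q = 0) ?mul0r ?coef0 ?raddf0 //.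
apply: (poly_vanish_inv g0) => x x0 gx; apply: (mulfI (expf_neq0 k x0)).
by rewrite -q1 // h // mxE mulr0.
Qed.

Lemma TQ_of_TQpol q1 q2 (g : {poly C}) (u : 'rV[C]_n) (w : 'cV[C]_n) : g != 0 ->
  (forall x, g.[x] != 0 -> u *m TQpol q1 q2 x *m w = 0) ->
  forall m, u *m TQ lam b q1 q2 m *m w = 0.
Proof.
move=> g0 h m; have [q [e1 e2]] := TQ_bilin q1 q2 u w.
rewrite [LHS]mx11_scalar e2 (_ : q = 0) ?mul0r ?coef0 ?raddf0 //.
apply: (poly_vanish_inv g0) => x x0 gx; apply: (mulfI (expf_neq0 k x0)).
by rewrite -e1 // h // mxE mulr0.
Qed.

Lemma TQpol_of_TQ q1 q2 (u : 'rV[C]_n) (w : 'cV[C]_n) :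
  (forall m, u *m TQ lam b q1 q2 m *m w = 0) ->
  forall x, x != 0 -> u *m TQpol q1 q2 x *m w = 0.
Proof.
move=> h x x0; have [q [e1 e2]] := TQ_bilin q1 q2 u w.
rewrite [LHS]mx11_scalar e1 // (_ : q = 0) ?horner0 ?mulr0 ?raddf0 //.
by apply: geom_mul_inj => m; rewrite -e2 h mxE.
Qed.

End Coefficients.

(** * Wedge vectors *)

Section Wedge.
Variables (K : numFieldType) (k n : nat) (cr an : 'I_k -> 'M[K]_n).
Hypothesis car : anticommutation cr an.
Variable vac : 'cV[K]_n.
Hypotheses (an_vac : forall s, an s *m vac = 0) (vac_neq0 : vac != 0).

Definition wedge (L : seq 'cV[K]_k) : 'cV[K]_n :=
  foldr (fun v w => crv cr v *m w) vac L.

Lemma anv_vac u : anv an u *m vac = 0.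
Proof.
by rewrite mulmx_suml big1 // => s _; rewrite -scalemxAl an_vac scaler0.
Qed.

Lemma anv_wedge0 u L : {in L, forall v, u *m v = 0} -> anv an u *m wedge L = 0.
Proof.
elim: L => [|v L IH] h /=; first exact: anv_vac.
rewrite mulmxA (anv_crv car) h ?mem_head // mxE scale0r sub0r mulNmx -mulmxA.
by rewrite IH ?mulmx0 ?oppr0 // => w wL; apply: h; rewrite inE wL orbT.
Qed.

Lemma wedge_map (T : 'M[K]_n) (U : 'M[K]_k) gam L :
  T *m vac = gam *: vac ->
  (forall v, T *m crv cr v = crv cr (U *m v) *m T) ->
  T *m wedge L = gam *: wedge (map (mulmx U) L).
Proof.
by move=> Tv TU; elim: L => //= v L IH; rewrite mulmxA TU -mulmxA IH -scalemxAr.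
Qed.

Lemma wedge_scale (I : eqType) (v w : I -> 'cV[K]_k) (c : I -> K) r :
  {in r, forall i, v i = c i *: w i} ->
  wedge (map v r) = (\prod_(i <- r) c i) *: wedge (map w r).
Proof.
elim: r => [|i r IH] h /=; first by rewrite big_nil scale1r.
rewrite h ?mem_head // IH; last by move=> j jr; apply: h; rewrite inE jr orbT.
by rewrite crvZ -scalemxAl -scalemxAr scalerA big_cons.
Qed.

(* Modulo the line spanned by [w], which [crv cr w] kills. *)
Lemma crv_wedge_mod (I : eqType) (v v' : I -> 'cV[K]_k) (c d e : I -> K) w r :
  {in r, forall i, c i *: v i = d i *: v' i + e i *: w} ->
  (\prod_(i <- r) c i) *: (crv cr w *m wedge (map v r)) =
  (\prod_(i <- r) d i) *: (crv cr w *m wedge (map v' r)).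
Proof.
elim: r => [|i r IH] h /=; first by rewrite !big_nil.
have {IH} IH := IH (fun j jr => h j (@mem_behead _ (i :: r) j jr)).
have swap x (y : 'cV[K]_n) : crv cr w *m (crv cr x *m y) = - (crv cr x *m (crv cr w *m y)).
  by rewrite !mulmxA (crv_anti car) mulNmx.
have w0 (y : 'cV[K]_n) : crv cr w *m (crv cr w *m y) = 0.
  by rewrite mulmxA (crv_sqr car) mul0mx.
have hi : d i *: v' i = c i *: v i - e i *: w by rewrite h ?mem_head // addrK.
rewrite !big_cons !swap !scalerN; congr (- _).
rewrite [d i * _]mulrC -[RHS]scalerA [X in _ = _ *: X]scalemxAl -crvZ hi.
rewrite crvB !crvZ mulmxBl -!scalemxAl w0 scaler0 subr0 -scalerA.
by rewrite [RHS]scalerA mulrC -scalerA; congr (c i *: _);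
  rewrite [LHS]scalemxAr [RHS]scalemxAr IH.
Qed.

Variables (I : eqType) (v : I -> 'cV[K]_k) (u : I -> 'rV[K]_k) (kap : I -> K).
Hypothesis kap0 : forall i, kap i != 0.
Hypothesis dual : forall i j, u i *m v j = (if i == j then kap i else 0)%:M.

Lemma anv_wedge_cons i r : i \notin r ->
  anv an (u i) *m wedge (map v (i :: r)) = kap i *: wedge (map v r).
Proof.
move=> ir; rewrite /= mulmxA (anv_crv car) dual eqxx mxE eqxx mulr1n mulmxBl.
rewrite -scalemxAl mul1mx -[in RHS](subr0 (kap i *: _)); congr (_ - _).
rewrite -mulmxA anv_wedge0 ?mulmx0 // => _ /mapP[j jr ->].
by rewrite dual; case: eqP => [e|]; [rewrite e jr in ir|rewrite raddf0].
Qed.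

Lemma wedge_neq0 r : uniq r -> wedge (map v r) != 0.
Proof.
elim: r => [|i r IH] //; rewrite cons_uniq => /andP[ir /IH w0].
apply: contra w0 => /eqP w0; have := anv_wedge_cons ir; rewrite w0 mulmx0.
by move/esym/eqP; rewrite scaler_eq0 (negPf (kap0 i)).
Qed.

(** The operator is [kap i] times the occupation number of the mode [i], because the modes [v] and
    [u] are dual. *)
Lemma number_wedge i r : uniq r ->
  crv cr (v i) *m anv an (u i) *m wedge (map v r) =
  (if i \in r then kap i else 0) *: wedge (map v r).
Proof.
elim: r => [_|j r IH]; first by rewrite -mulmxA anv_vac mulmx0 scale0r.
rewrite cons_uniq => /andP[jr ur]; rewrite inE; case: eqP => [->|/eqP ij] /=.
  by rewrite -mulmxA anv_wedge_cons // -scalemxAr.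
have {IH ur} := IH ur; set Z := wedge _ => IH.
rewrite -mulmxA [anv an _ *m (_ *m _)]mulmxA (anv_crv car) dual (negPf ij) mxE.
rewrite mul0rn scale0r sub0r mulNmx mulmxN -!mulmxA mulmxA (crv_anti car).
by rewrite mulNmx opprK -mulmxA [X in _ *m X]mulmxA IH -scalemxAr.
Qed.

End Wedge.

Section WedgeBasis.
Variables (K : numFieldType) (k n : nat) (cr an : 'I_k -> 'M[K]_n).
Hypothesis car : anticommutation cr an.
Variable vac : 'cV[K]_n.
Hypotheses (an_vac : forall s, an s *m vac = 0) (vac_neq0 : vac != 0).
Variables (v : 'I_k -> 'cV[K]_k) (u : 'I_k -> 'rV[K]_k) (kap : 'I_k -> K).
Hypothesis kap0 : forall i, kap i != 0.
Hypothesis dual : forall i j, u i *m v j = (if i == j then kap i else 0)%:M.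

Definition wedgeI (J : Idx k) : 'cV[K]_n :=
  wedge cr vac (map v (filter J (enum 'I_k))).

Lemma uniqI (J : Idx k) : uniq (filter J (enum 'I_k)).
Proof. exact: filter_uniq (enum_uniq _). Qed.

Lemma wedgeI_neq0 J : wedgeI J != 0.
Proof. exact: (wedge_neq0 car an_vac vac_neq0 kap0 dual (uniqI J)). Qed.

(** Occupation numbers separate the subsets: applying them one mode at a time restricts the relation
    to the [J] that agree with [J0] on more and more modes. *)
Lemma wedgeI_free (a : Idx k -> K) :
  \sum_J a J *: wedgeI J = 0 -> forall J, a J = 0.
Proof.
move=> a0 J0.
have h r : \sum_(J : Idx k | all (fun i => J i == J0 i) r) a J *: wedgeI J = 0.
  elim: r => [|i r IH] //=.
  pose N := crv cr (v i) *m anv an (u i).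
  have NJ J : N *m wedgeI J = (if J i then kap i else 0) *: wedgeI J.
    rewrite /wedgeI (number_wedge car an_vac dual) ?uniqI //.
    by rewrite mem_filter mem_enum andbT.
  have e1 : \sum_(J : Idx k | all (fun i => J i == J0 i) r && J i) a J *: wedgeI J = 0.
    have /eqP := congr1 (mulmx N) IH; rewrite mulmx0 mulmx_sumr.
    rewrite (bigID (fun J : Idx k => J i)) /= [X in _ + X]big1 ?addr0; last first.
      by move=> J1 /andP[_ /negPf Ji]; rewrite -scalemxAr NJ Ji scale0r scaler0.
    rewrite (eq_bigr (fun J => kap i *: (a J *: wedgeI J))); last first.
      by move=> J1 /andP[_ Ji]; rewrite -scalemxAr NJ Ji !scalerA mulrC.
    by rewrite -scaler_sumr scaler_eq0 (negPf (kap0 i)) => /eqP.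
  case: (J0 i).
    rewrite -[RHS]e1; apply: eq_bigl => J.
    by rewrite eqb_id andbC.
  move: IH; rewrite (bigID (fun J : Idx k => J i)) /= e1 add0r => IH.
  by rewrite -[RHS]IH; apply: eq_bigl => J; rewrite eqbF_neg andbC.
have := h (enum 'I_k); rewrite (big_pred1 J0) => [/eqP|J].
  by rewrite scaler_eq0 (negPf (wedgeI_neq0 _)) orbF => /eqP.
apply/allP/eqP => [e|-> //]; apply/ffunP=> i; apply/eqP/e; exact: mem_enum.
Qed.

End WedgeBasis.

(** * Bethe vectors *)

Section DividedDifference.
Variables (S : comNzRingType) (N : nat).

(* [(p - p(t)) / ('X - t)] for [size p <= N] *)
Definition divdiff (t : S) (p : {poly S}) : {poly S} :=
  \poly_(m < N) \sum_(j < N) p`_(m + j.+1) * t ^+ j.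

Lemma size_divdiff t p : (size (divdiff t p) <= N)%N.
Proof. exact: size_poly. Qed.

Lemma coef_divdiff t (p : {poly S}) m : (size p <= N)%N ->
  (divdiff t p)`_m = \sum_(j < N) p`_(m + j.+1) * t ^+ j.
Proof.
move=> pN; rewrite coef_poly; case: ltnP => // Nm; rewrite big1 // => j _.
by rewrite nth_default ?mul0r //; apply: leq_trans pN _; lia.
Qed.

Lemma divdiffE t (p : {poly S}) : (size p <= N)%N -> divdiff t p * ('X - t%:P) = p - p.[t]%:P.
Proof.
move=> pN; apply/polyP=> m; rewrite mulrBr coefB coefMX coefMC coefB coefC.
case: m => [|m] /=.
  rewrite sub0r coef_divdiff // (horner_coef_wide t pN).
  case: N pN => [|N'] pN.
    have -> : p = 0 by apply/eqP; rewrite -size_poly_leq0.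
    by rewrite !big_ord0 coef0 mul0r subrr oppr0.
  rewrite big_ord_recr /= [X in _ - X]big_ord_recl /= expr0 mulr1 opprD addNKr.
  rewrite nth_default // mul0r addr0 mulr_suml; congr (- _).
  by apply: eq_bigr => j _; rewrite exprSr mulrA add0n.
rewrite subr0 !coef_divdiff //.
case: N pN => [|N'] pN.
  have -> : p = 0 by apply/eqP; rewrite -size_poly_leq0.
  by rewrite !big_ord0 coef0 mul0r subrr.
rewrite big_ord_recl /= expr0 mulr1 addn1 big_ord_recr /= mulrDl mulr_suml.
rewrite [p`_(_ + N'.+1)]nth_default ?mul0r ?addr0; last by apply: leq_trans pN _; lia.
rewrite -addrA -sumrB big1 ?addr0 // => j _.
by rewrite exprSr mulrA addnS addSn subrr.
Qed.

Lemma horner_divdiff t x (p : {poly S}) : (size p <= N)%N ->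
  p.[x] = p.[t] + (x - t) * (divdiff t p).[x].
Proof.
move=> pN; have := congr1 (horner^~ x) (divdiffE t pN).
by rewrite hornerM hornerXsubC hornerD hornerN hornerC mulrC => ->; rewrite addrC subrK.
Qed.

End DividedDifference.

(** * Functions given by multivariate polynomials *)

Section PolynomialFunctions.
Variables (K : numFieldType) (l : nat).

Definition polyfun (f : ('I_l -> K) -> K) : Prop :=
  exists P : {mpoly K[l]}, forall s, P.@[s] = f s.

Lemma polyfun_const c : polyfun (fun=> c).
Proof. by exists c%:MP => s; rewrite mevalC. Qed.

Lemma polyfun_coord i : polyfun (fun s => s i).
Proof. by exists 'X_i => s; rewrite mevalXU. Qed.

Lemma polyfunD f g : polyfun f -> polyfun g -> polyfun (fun s => f s + g s).
Proof. by move=> [P eP] [Q eQ]; exists (P + Q) => s; rewrite mevalD eP eQ. Qed.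

Lemma polyfunM f g : polyfun f -> polyfun g -> polyfun (fun s => f s * g s).
Proof. by move=> [P eP] [Q eQ]; exists (P * Q) => s; rewrite mevalM eP eQ. Qed.

Lemma eq_polyfun f g : f =1 g -> polyfun f -> polyfun g.
Proof. by move=> e [P eP]; exists P => s; rewrite eP. Qed.

Lemma polyfunN f : polyfun f -> polyfun (fun s => - f s).
Proof. by move=> [P eP]; exists (- P) => s; rewrite mevalN eP. Qed.

Lemma polyfunB f g : polyfun f -> polyfun g -> polyfun (fun s => f s - g s).
Proof. by move=> pf pg; apply: polyfunD => //; apply: polyfunN. Qed.

Lemma polyfunX f m : polyfun f -> polyfun (fun s => f s ^+ m).
Proof. by move=> [P eP]; exists (P ^+ m) => s; rewrite rmorphXn /= eP. Qed.

Lemma polyfun_sum (I : Type) (r : seq I) (Q : pred I) (F : I -> ('I_l -> K) -> K) :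
  (forall i, polyfun (F i)) -> polyfun (fun s => \sum_(i <- r | Q i) F i s).
Proof.
move=> pF; elim: r => [|i r IH].
  by apply: eq_polyfun (polyfun_const 0) => s; rewrite big_nil.
case Qi: (Q i); last by apply: eq_polyfun IH => s; rewrite big_cons Qi.
by apply: eq_polyfun (polyfunD (pF i) IH) => s; rewrite big_cons Qi.
Qed.

Lemma polyfun_prod (I : Type) (r : seq I) (Q : pred I) (F : I -> ('I_l -> K) -> K) :
  (forall i, polyfun (F i)) -> polyfun (fun s => \prod_(i <- r | Q i) F i s).
Proof.
move=> pF; elim: r => [|i r IH].
  by apply: eq_polyfun (polyfun_const 1) => s; rewrite big_nil.
case Qi: (Q i); last by apply: eq_polyfun IH => s; rewrite big_cons Qi.
by apply: eq_polyfun (polyfunM (pF i) IH) => s; rewrite big_cons Qi.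
Qed.

Lemma polyfun_line f s d : polyfun f ->
  exists q : {poly K}, forall x, q.[x] = f (fun i => s i + x * d i).
Proof.
move=> [P eP]; exists (mmap polyC (fun i => (s i)%:P + d i *: 'X) P) => x.
rewrite -eP mevalE /mmap horner_sum; apply: eq_bigr => m _.
rewrite hornerM hornerC; congr (_ * _); rewrite /mmap1 horner_prod.
by apply: eq_bigr => i _; rewrite horner_exp hornerD hornerC hornerZ hornerX mulrC.
Qed.

(* Density of the complement of a hypersurface, along the line through [s] and [s0]. *)
Lemma polyfun_vanish f g s0 : polyfun f -> polyfun g -> g s0 != 0 ->
  (forall s, g s != 0 -> f s = 0) -> forall s, f s = 0.
Proof.
move=> pf pg g0 fg s.
have [qf ef] := polyfun_line s (fun i => s0 i - s i) pf.
have [qg eg] := polyfun_line s (fun i => s0 i - s i) pg.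
have [[P eP] [Q eQ]] := (pf, pg).
have q0 : qf = 0.
  apply: (@poly_vanish_gen _ qg); last by move=> x; rewrite eg ef; exact: fg.
  apply: contra_neq g0 => q0.
  have := eg 1; rewrite q0 horner0 -eQ -[X in _ -> X = _]eQ => ->.
  by apply: meval_eq => i; rewrite mul1r addrC subrK.
have := ef 0; rewrite q0 horner0 -eP -[X in _ -> X = _]eP => ->.
by apply: meval_eq => i; rewrite mul0r addr0.
Qed.

End PolynomialFunctions.

Section PairProducts.
Variables (S : comPzRingType) (F : S -> S -> S).

Fixpoint pairprod (ts : seq S) : S :=
  if ts is t :: ts' then (\prod_(x <- ts') F t x) * pairprod ts' else 1.

Lemma pairprod_ord l (t : 'I_l -> S) :
  \prod_(m1 < l) \prod_(m2 < l | (m1 < m2)%N) F (t m1) (t m2) =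
  pairprod (map t (enum 'I_l)).
Proof.
elim: l t => [|l IH] t.
  have -> : enum 'I_0 = [::] by apply: size0nil; rewrite size_enum_ord.
  by rewrite big_ord0.
rewrite big_ord_recl enum_ordSl /= -map_comp -IH big_mkcond big_ord_recl /= mul1r.
congr (_ * _); first by rewrite big_map [RHS]big_enum.
apply: eq_bigr => i _; rewrite big_mkcond big_ord_recl /= mul1r.
by rewrite [RHS]big_mkcond.
Qed.

End PairProducts.

Definition vandermonde (S : comPzRingType) : seq S -> S := pairprod (fun x y => y - x).

Lemma vandermonde_neq0 (S : idomainType) (ts : seq S) :
  uniq ts -> vandermonde ts != 0.
Proof.
elim: ts => [|t ts IH]; first by rewrite oner_neq0.
rewrite cons_uniq => /andP[tts /IH v0]; rewrite /vandermonde /= mulf_neq0 //.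
rewrite prodf_seq_neq0; apply/allP=> x xts; rewrite /= subr_eq0.
by apply: contraNneq tts => <-.
Qed.

Section BetheVectors.
Variables (R : realType) (k : nat).
Local Notation C := (R[i])%C.
Local Notation n := (Defs.dim k).
Variables (lam : 'I_k -> C * C) (b : 'I_k -> C).
Local Notation sites := (enum 'I_k).
Local Notation a := (wa lam b).
Local Notation h := (wh lam).
Local Notation phi := (phis a sites).
Local Notation psi := (psis a h sites).
Local Notation p := (pvec a h sites).
Local Notation cr := (@cre R k).
Local Notation an := (@ann R k).
Local Notation wedge := (wedge cr (vac R k)).

Definition evalv (P : 'I_k -> {poly C}) (t : C) : 'cV[C]_k := \col_i (P i).[t].

(* Newton's divided differences divide the wedge of the [P(t_i)] by the Vandermonde
   determinant while staying polynomial in the [t_i]. *)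
Fixpoint newton_wedge (P : 'I_k -> {poly C}) (ts : seq C) : 'cV[C]_n :=
  if ts is t :: ts' then
    crv cr (evalv P t) *m newton_wedge (fun i => divdiff k t (P i)) ts'
  else vac R k.

Definition bnum (ts : seq C) : 'cV[C]_n :=
  foldr (fun t v => Tpol lam b false true t *m v) (vac R k) ts.

Definition bden : seq C -> C := pairprod (fun x y => y - x + 1).

Lemma bethe_numE l (t : 'I_l -> C) : bethe_num lam b t = bnum (map t (enum 'I_l)).
Proof. by rewrite /bnum foldr_map. Qed.

Lemma bethe_denE l (t : 'I_l -> C) : bethe_den t = bden (map t (enum 'I_l)).
Proof. exact: pairprod_ord. Qed.

(** These are the column operations that evaluate a Vandermonde determinant: in a wedge with [P(t)]
    each [P(x)] may be replaced by [P(x) - P(t)], which is [x - t] times a divided difference. *)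
Lemma wedge_newton (P : 'I_k -> {poly C}) ts : (forall i, (size (P i) <= k)%N) ->
  wedge (map (evalv P) ts) = vandermonde ts *: newton_wedge P ts.
Proof.
elim: ts P => [|t ts IH] P Pk; first by rewrite scale1r.
pose dP i := divdiff k t (P i).
have := @crv_wedge_mod _ _ _ _ _ (car_cre_ann R k) (vac R k) _ (evalv P) (evalv dP)
  (fun=> 1) (fun x => x - t) (fun=> 1) (evalv P t) ts.
move=> E; have {}E : wedge (map (evalv P) (t :: ts)) =
    \prod_(x <- ts) (x - t) *: (crv cr (evalv P t) *m wedge (map (evalv dP) ts)).
  rewrite -E => [|x _]; first by rewrite big1 // scale1r.
  apply/colP=> i; rewrite !mxE !mul1r (horner_divdiff t x (Pk i)).
  by rewrite addrC.
rewrite E.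
rewrite IH => [|i]; last exact: size_divdiff.
by rewrite -scalemxAr scalerA.
Qed.

Lemma alx_neq0 x : phi.[x] != 0 -> forall s, alx a x s != 0.
Proof.
move=> px s; move: px.
by rewrite -prod_alx prodf_seq_neq0 => /allP/(_ s (mem_enum _ _)).
Qed.

Lemma Tpol12 x : phi.[x] != 0 -> forall L,
  Tpol lam b false true x *m wedge L =
  - (crv cr (p x) *m wedge (map (mulmx (Amx (alx a x) (bex a h x) sites)) L)).
Proof.
move=> phix L.
have al0 := alx_neq0 phix.
have [R1 R2 _ _] := monodromy_rel (car_cre_ann R k) (bex a h x) al0 (enum_uniq 'I_k).
have [av _ _] := monodromy_vac (car_cre_ann R k) (bex a h x) al0 (@ann_vac R k) (enum_uniq 'I_k).
rewrite Tpol_mono R2 -mulmxA (wedge_map _ av R1) prod_alx fvec_pvec //.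
rewrite crvZ -scalemxAl -scalemxAr scalerA mulNr mulVf ?scaleN1r //.
Qed.

(** The unwanted terms of [Amx_pvec] point along [p(t)] and die in the wedge with [p(t)]. Each later
    [p(x)] thus only acquires the factor [(x - t + 1) / (x - t)]; the numerators collect to [bden],
    the denominators to the Vandermonde determinant. *)
Lemma bnum_wedge ts : all (fun t => phi.[t] != 0) ts ->
  vandermonde ts *: bnum ts = ((-1) ^+ size ts * bden ts) *: wedge (map p ts).
Proof.
elim: ts => [|t ts IH] /=; first by rewrite mul1r.
move=> /andP[pt /IH {}IH].
have al0 := alx_neq0 pt.
pose A := Amx (alx a t) (bex a h t) sites.
have := @crv_wedge_mod _ _ _ _ _ (car_cre_ann R k) (vac R k) _ (fun x => A *m p x) p
  (fun x => x - t) (fun x => x - t + 1) (fun x => - (phi.[x] / phi.[t])) (p t) ts.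
move=> E.
have {E} E : \prod_(x <- ts) (x - t) *: (crv cr (p t) *m wedge (map (mulmx A) (map p ts))) =
    \prod_(x <- ts) (x - t + 1) *: (crv cr (p t) *m wedge (map p ts)).
  rewrite -map_comp; apply: E => x _.
  rewrite -opprB scaleNr (Amx_pvec _ al0) ?enum_uniq // opprD -!scaleNr; congr (_ *: _ + _).
  by ring.
rewrite /vandermonde /bden /= -/(vandermonde ts) -/(bden ts).
rewrite -scalerA [vandermonde ts *: _]scalemxAr IH -scalemxAr Tpol12 // scalerN.
rewrite scalerN scalerA [_ * (_ * bden ts)]mulrC -/A -[X in - X = _]scalerA E scalerA -scaleNr.
by congr (_ *: _); rewrite exprS; ring.
Qed.

Lemma bnum_newton ts : all (fun t => phi.[t] != 0) ts -> uniq ts ->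
  bnum ts = ((-1) ^+ size ts * bden ts) *: newton_wedge (ppol a h sites) ts.
Proof.
move=> pt uts; apply: (scalerI (vandermonde_neq0 uts)).
rewrite bnum_wedge // [RHS]scalerA [vandermonde _ * _]mulrC -[RHS]scalerA; congr (_ *: _).
rewrite -(@wedge_newton (ppol a h sites)) // => i; apply: leq_trans (size_ppol _ _ _ _) _.
by rewrite size_enum_ord.
Qed.

Lemma newton_polyfun l (L : seq 'I_l) (P : ('I_l -> C) -> 'I_k -> {poly C}) q :
  (forall s i, (size (P s i) <= k)%N) ->
  (forall i m, polyfun (fun s => (P s i)`_m)) ->
  polyfun (fun s => newton_wedge (P s) (map s L) q 0).
Proof.
elim: L P q => [|j L IH] P q Pk Pp /=; first exact: polyfun_const.
have ev i : polyfun (fun s => (P s i).[s j]).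
  apply: (@eq_polyfun _ _ (fun s => \sum_(m < k) (P s i)`_m * s j ^+ m)).
    by move=> s; rewrite (horner_coef_wide _ (Pk s i)).
  apply: polyfun_sum => m; apply: polyfunM => //; apply: polyfunX.
  exact: polyfun_coord.
apply: (@eq_polyfun _ _ (fun s => \sum_q' (\sum_i (P s i).[s j] * cr i q q') *
   newton_wedge (fun i => divdiff k (s j) (P s i)) (map s L) q' 0)).
  move=> s; rewrite mxE; apply: eq_bigr => q' _; congr (_ * _).
  by rewrite summxE; apply: eq_bigr => i _; rewrite !mxE.
apply: polyfun_sum => q'; apply: polyfunM.
  by apply: polyfun_sum => i; apply: polyfunM => //; apply: polyfun_const.
apply: (IH (fun s i => divdiff k (s j) (P s i))) => [s i|i m]; first exact: size_divdiff.
apply: (@eq_polyfun _ _ (fun s => \sum_(j' < k) (P s i)`_(m + j'.+1) * s j ^+ j')).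
  by move=> s; rewrite coef_divdiff.
apply: polyfun_sum => j'; apply: polyfunM => //; apply: polyfunX.
exact: polyfun_coord.
Qed.

Lemma Tpol_polyfun l (m : 'I_l) i j q q' : polyfun (fun s => Tpol lam b i j (s m) q q').
Proof.
apply: (@eq_polyfun _ _ (fun s => Tpol_ker lam b i j (s m) (enum_val q) (enum_val q'))).
  by move=> s; rewrite mxE.
apply: polyfun_sum => c; apply: polyfunM; first exact: polyfun_const.
apply: polyfun_prod => t; apply: polyfunD; last exact: polyfun_const.
apply: polyfunM; first exact: polyfun_const.
by apply: polyfunB; [exact: polyfun_coord|exact: polyfun_const].
Qed.

Lemma bnum_polyfun l (L : seq 'I_l) q : polyfun (fun s => bnum (map s L) q 0).
Proof.
elim: L q => [|j L IH] q /=; first exact: polyfun_const.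
apply: (@eq_polyfun _ _ (fun s => \sum_q' Tpol lam b false true (s j) q q' *
   bnum (map s L) q' 0)); first by move=> s; rewrite mxE.
by apply: polyfun_sum => q'; apply: polyfunM => //; apply: Tpol_polyfun.
Qed.

Lemma pairprod_polyfun l (F : C -> C -> C) (L : seq 'I_l) :
  (forall i j, polyfun (fun s : 'I_l -> C => F (s i) (s j))) ->
  polyfun (fun s => pairprod F (map s L)).
Proof.
move=> Fp; elim: L => [|j L IH] /=; first exact: polyfun_const.
apply: polyfunM => //.
apply: (@eq_polyfun _ _ (fun s => \prod_(i <- L) F (s j) (s i))).
  by move=> s; rewrite big_map.
by apply: polyfun_prod => i; apply: Fp.
Qed.

End BetheVectors.

Lemma poly_nonroot (K : numFieldType) (p : {poly K}) : p != 0 -> exists x, p.[x] != 0.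
Proof.
move=> p0; pose rs : seq K := [seq i%:R | i <- iota 0 (size p)].
have urs : uniq rs.
  by rewrite map_inj_uniq ?iota_uniq // => i j /eqP; rewrite eqr_nat => /eqP.
case: (boolP (all (root p) rs)) => [ap|/allPn[x _ px]]; last by exists x.
by have := max_poly_roots p0 ap urs; rewrite size_map size_iota ltnn.
Qed.

Lemma vandermonde_uniq (S : idomainType) (ts : seq S) : vandermonde ts != 0 -> uniq ts.
Proof.
elim: ts => // t ts IH; rewrite /vandermonde /= mulf_eq0 negb_or => /andP[v0 /IH ->].
rewrite andbT; apply/negP=> tts.
move: v0; rewrite prodf_seq_neq0 => /allP/(_ _ tts) /=.
by rewrite subrr eqxx.
Qed.

Section BetheVectorExistence.
Variables (R : realType) (k : nat).
Local Notation C := (R[i])%C.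
Variables (lam : 'I_k -> C * C) (b : 'I_k -> C).
Local Notation sites := (enum 'I_k).
Local Notation a := (wa lam b).
Local Notation h := (wh lam).
Local Notation phi := (phis a sites).

Lemma phi_neq0 : phi != 0.
Proof. by rewrite -size_poly_eq0 size_phis. Qed.

Definition bethe_vec l (t : 'I_l -> C) :=
  (-1) ^+ l *: newton_wedge (ppol a h sites) (map t (enum 'I_l)).

(** Both sides of the defining identity are polynomial in [s], so it suffices to compare them where
    the [s i] are distinct and avoid the roots of [phi]; there [bnum_newton] applies. *)
Lemma bethe_vec_correct l (t : 'I_l -> C) : bethe_vector lam b t (bethe_vec t).
Proof.
have Fp q : polyfun (fun s : 'I_l -> C => bethe_vec s q 0).
  apply: (@eq_polyfun _ _ (fun s => (-1) ^+ l *
      newton_wedge (ppol a h sites) (map s (enum 'I_l)) q 0)).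
    by move=> s; rewrite mxE.
  apply: polyfunM; first exact: polyfun_const.
  apply: (@newton_polyfun _ _ _ _ (fun=> ppol a h sites)) => [_ i|i m].
    by apply: leq_trans (size_ppol _ _ _ _) _; rewrite size_enum_ord.
  exact: polyfun_const.
have [F eF] := fin_all_exists Fp.
exists F; split=> [s q|q]; last by rewrite eF.
rewrite eF bethe_denE bethe_numE; apply/eqP; rewrite -subr_eq0; apply/eqP; move: s.
pose g (s : 'I_l -> C) := vandermonde (map s (enum 'I_l)) * \prod_i phi.[s i].
(* The base point [c, c + 1, ...] has distinct coordinates, and [c] is chosen so that none of them
   is a root of [phi]. *)
have [c c0] : exists c, (\prod_(i < l) (phi \Po ('X + i%:R%:P))).[c] != 0.
  apply: poly_nonroot; apply/prodf_neq0 => i _.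
  by rewrite comp_poly2_eq0 ?phi_neq0 // size_XaddC.
apply: (polyfun_vanish (g := g) (s0 := fun i => c + (i : nat)%:R)).
- apply: polyfunB; last exact: bnum_polyfun.
  apply: polyfunM => //; apply: pairprod_polyfun => i j.
  apply: polyfunD; last exact: polyfun_const.
  by apply: polyfunB; apply: polyfun_coord.
- apply: polyfunM.
    by apply: pairprod_polyfun => i j; apply: polyfunB; apply: polyfun_coord.
  apply: polyfun_prod => i.
  apply: (@eq_polyfun _ _ (fun s => \sum_(m < size phi) phi`_m * s i ^+ m)).
    by move=> s; rewrite horner_coef.
  apply: polyfun_sum => m; apply: polyfunM; first exact: polyfun_const.
  by apply: polyfunX; apply: polyfun_coord.
- rewrite mulf_neq0 //.
    apply: vandermonde_neq0; rewrite map_inj_uniq ?enum_uniq // => i j /addrI /eqP.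
    by rewrite eqr_nat => /eqP/val_inj.
  apply: contraNneq c0 => e; rewrite -e horner_prod; apply/eqP/eq_bigr => i _.
  by rewrite horner_comp hornerD hornerX hornerC.
move=> s; rewrite mulf_eq0 negb_or => /andP[/vandermonde_uniq us ps].
rewrite bnum_newton //; last first.
  by rewrite all_map; apply/allP=> i _ /=; move/prodf_neq0: ps => /(_ i); apply.
by rewrite !mxE size_map size_enum_ord; ring.
Qed.

End BetheVectorExistence.

(** * The action of [e12] as an annihilator *)

Section SingularVectors.
Variables (R : realType) (k : nat).
Local Notation C := (R[i])%C.
Local Notation n := (Defs.dim k).
Variables (lam : 'I_k -> C * C) (b : 'I_k -> C).
Local Notation sites := (enum 'I_k).
Local Notation h := (wh lam).

Lemma Tinv_pathsum i j (out inp : Idx k) :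
  Tinv_ker lam b i j out inp =
  pathsum (fun s a c => (sgn R ((a (+) c) && par s inp))%:P
                         * site_inv lam b s a c (out s) (inp s)) sites i j.
Proof.
rewrite -pathsum_ffun; apply: eq_bigr => a _; rewrite big_split; congr (_ * _) => /=.
have e : {morph odd : x y / (x + y)%N >-> x (+) y} by move=> x y; rewrite oddD.
rewrite (big_morph odd e (erefl : odd 0 = false)).
rewrite (big_morph (sgn R) (@sgn_addb R) (erefl : sgn R false = 1)) rmorph_prod.
by apply: eq_bigr => s _; rewrite oddM oddb.
Qed.

Lemma site_inv0 s i j out inp : (site_inv lam b s i j out inp)`_0 = ((i == j) && (out == inp))%:R.
Proof. by rewrite coefD coefC coefMX addr0. Qed.

Lemma site_inv1 s out inp :
  (site_inv lam b s true false out inp)`_1 = (~~ out && inp)%:R * h s.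
Proof.
rewrite coefD coefC coefMX coefC /= add0r mulr0 subr0 mul1r.
by case: ifP; rewrite ?mul1r ?mul0r.
Qed.

Lemma coef0_pathsum (out inp : Idx k) r i j :
  (pathsum (fun s a c => (sgn R ((a (+) c) && par s inp))%:P
                         * site_inv lam b s a c (out s) (inp s)) r i j)`_0 =
  ((i == j) && all (fun s => out s == inp s) r)%:R.
Proof.
elim: r j => [|s r IH] j /=; first by rewrite coefMn coef1 andbT mulr1n.
rewrite coefD !coef0M !IH !coefC /= !site_inv0.
case: i j {IH} => [] []; rewrite /= ?eqb_id ?eqbF_neg /= ?mulr0 ?add0r ?addr0 ?mul1r.
all: by case: (out s == inp s); rewrite ?mulr1n ?mul1r ?mulr0 ?mul0r ?addr0 ?add0r.
Qed.

Lemma coef1M (S : comNzRingType) (p q : {poly S}) : (p * q)`_1 = p`_0 * q`_1 + p`_1 * q`_0.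
Proof. by rewrite coefM !big_ord_recl big_ord0 addr0. Qed.

(** Off-diagonal site entries have no constant term, so at first order in [y] exactly one site
    carries the step of the path, and all others act as the identity. *)
Lemma coef1_pathsum (out inp : Idx k) r : uniq r ->
  (agree [pred t | t \notin r] out inp)%:R *
  (pathsum (fun s a c => (sgn R ((a (+) c) && par s inp))%:P
                         * site_inv lam b s a c (out s) (inp s)) r true false)`_1 =
  \sum_(s <- r) h s * (((out == flip s inp) && inp s)%:R * sgn R (par s inp)).
Proof.
elim: r => [_|s r IH]; first by rewrite big_nil /= coefC mulr0.
rewrite cons_uniq => /andP[sr ur] /=.
rewrite coefD !coef1M !coef0_pathsum !coef0M !coefC /= !site_inv0 !site_inv1 /=.
have e1 : (agree [pred t | t \notin s :: r] out inp)%:R * (out s == inp s)%:R =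
    (agree [pred t | t \notin r] out inp)%:R :> C.
  rewrite -natrM mulnb; congr (nat_of_bool _)%:R; apply/andP/agreeP => [[/agreeP e /eqP es] t tr|e].
    case: (eqVneq t s) => [-> //|ts]; apply: e.
    by rewrite /= inE negb_or ts.
  split; last by apply/eqP/e.
  by apply/agreeP=> t; rewrite /= inE negb_or => /andP[_]; apply: e.
have e2 : (agree [pred t | t \notin s :: r] out inp)%:R * (~~ out s && inp s)%:R *
    (all (fun t => out t == inp t) r)%:R = ((out == flip s inp) && inp s)%:R :> C.
  rewrite -!natrM !mulnb flip_agree; congr (nat_of_bool _)%:R.
  case: (inp s) (out s) => [] []; rewrite /= ?andbF //= !andbT.
  apply/andP/agreeP => [[/agreeP e /allP er] t /= ts|e].
    by case: (boolP (t \in r)) => tr; [apply/eqP/er|apply: e; rewrite /= inE negb_or ts].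
  split; first by apply/agreeP=> t; rewrite /= inE negb_or => /andP[ts _]; apply: e.
  by apply/allP=> t tr; apply/eqP/e => /=; apply: contraNneq sr => <-.
rewrite big_cons -(IH ur) -e1 -e2; ring.
Qed.

Lemma Tcoef21 : Tcoef lam b true false 1 = anv (@ann R k) (hrow h sites).
Proof.
apply/matrixP=> q q'; rewrite mxE Tcoef_ker_inv coef1M geom_coef0.
rewrite Tinv_pathsum coef0_pathsum mul0r add0r mulr1.
have := coef1_pathsum (enum_val q) (enum_val q') (enum_uniq 'I_k).
rewrite [agree _ _ _](_ : _ = true) ?mul1r => [->|]; last first.
  by apply/agreeP=> t; rewrite /= mem_enum.
rewrite summxE big_enum; apply: eq_bigr => s _; rewrite !mxE.
suff -> : hrow h sites 0 s = h s by [].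
have he r : uniq r -> hrow h r 0 s = if s \in r then h s else 0.
  elim: r => [_|t r IH] /=; first by rewrite mxE.
  move=> /andP[tr ur]; rewrite !mxE IH // inE /=.
  case: eqVneq => [->|_]; first by rewrite (negPf tr) addr0 mulr1.
  by rewrite mulr0 add0r.
by rewrite he ?enum_uniq // mem_enum.
Qed.

End SingularVectors.

Lemma double_root (K : fieldType) (q : {poly K}) t :
  (('X - t%:P) ^+ 2 %| q) = (q.[t] == 0) && (q^`().[t] == 0).
Proof.
apply/idP/andP => [/dvdpP[r ->]|[/factor_theorem[r ->]]].
  rewrite expr2 !derivM derivXsubC !(hornerXsubC, hornerM, hornerD, hornerC) subrr.
  by rewrite !mulr0 !mul0r addr0 mulr0 addr0.
rewrite derivM derivXsubC mulr1 !hornerE subrr mulr0 add0r => /factor_theorem[r' ->].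
by rewrite -mulrA -expr2 dvdp_mull.
Qed.

Lemma sum_ord_gt0 (V : zmodType) k (F : 'I_k -> V) : \sum_s F s != 0 -> (0 < k)%N.
Proof.
by case: k F => // F; rewrite big_ord0 eqxx.
Qed.

Section LeadingCoefficient.
Variables (S : comNzRingType) (k : nat) (a c : 'I_k -> S) (q1 q2 : S).
Let d := if q1 == q2 then k.-1 else k.
Let G := q1 *: \prod_s ('X - (a s)%:P) - q2 *: \prod_s ('X - (c s)%:P).

(** For [q1 = q2] the top terms cancel and the next coefficient comes from the sums of the roots.
    The ring is left general because this is applied both to numbers and to polynomials in [b]. *)
Lemma gamma_size : (q1 = q2 -> (0 < k)%N) ->
  (size G <= d.+1)%N /\ G`_d = (if q1 == q2 then q1 * \sum_s (c s - a s) else q1 - q2).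
Proof.
have prod_size (F : 'I_k -> S) : size (\prod_s ('X - (F s)%:P)) = k.+1.
  by rewrite size_prod_XsubC -[index_enum _]enumT size_enum_ord.
have prod_lead (F : 'I_k -> S) : (\prod_s ('X - (F s)%:P))`_k = 1.
  have := monic_prod_XsubC (index_enum 'I_k) predT F.
  by move=> /monicP; rewrite /lead_coef prod_size.
have sG : (size G <= k.+1)%N.
  apply: leq_trans (size_polyD _ _) _; rewrite size_polyN geq_max.
  by rewrite !(leq_trans (size_scale_leq _ _)) ?prod_size.
have Gk : G`_k = q1 - q2 by rewrite coefB !coefZ !prod_lead !mulr1.
rewrite /d; case: eqP => [q12 /(_ q12) k0|_ _]; last by [].
split; last first.
  have coef_prod (F : 'I_k -> S) : (\prod_s ('X - (F s)%:P))`_k.-1 = - \sum_s F s.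
    have := @coefPn_prod_XsubC _ (map F (enum 'I_k)).
    by rewrite size_map size_enum_ord -lt0n !(big_map F) !big_enum => ->.
  by rewrite coefB !coefZ !coef_prod -q12 -mulrBr opprK sumrB addrC.
rewrite prednK //; apply/leq_sizeP => j kj; case: (eqVneq j k) => [->|jk].
  by rewrite Gk q12 subrr.
by rewrite nth_default //; apply: leq_trans sG _; rewrite ltn_neqAle eq_sym jk.
Qed.

End LeadingCoefficient.

(** * Spectrum of the transfer matrix *)

Section TransferMatrix.
Variables (R : realType) (k : nat).
Local Notation C := (R[i])%C.
Local Notation n := (Defs.dim k).
Variables (lam : 'I_k -> C * C) (b : 'I_k -> C) (q1 q2 : C).
Local Notation sites := (enum 'I_k).
Local Notation a := (wa lam b).
Local Notation h := (wh lam).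
Local Notation phi := (phis a sites).
Local Notation psi := (psis a h sites).
Local Notation p := (pvec a h sites).
Local Notation cr := (@cre R k).
Local Notation an := (@ann R k).
Local Notation car := (car_cre_ann R k).
Local Notation G := (q1 *: phi - q2 *: psi).

Lemma phi_polE : phi_pol lam b = phi.
Proof. by rewrite /phis big_enum. Qed.

Lemma psi_polE : psi_pol lam b = psi.
Proof.
rewrite /psis big_enum; apply: eq_bigr => s _; congr ('X - _%:P).
by rewrite /wa /wh; ring.
Qed.

Lemma horner_G x : G.[x] = q1 * phi.[x] - q2 * psi.[x].
Proof. by rewrite hornerD hornerN !hornerZ. Qed.

Hypotheses (q1_neq0 : q1 != 0) (q2_neq0 : q2 != 0).
Hypothesis sum_neq0 : q1 = q2 -> \sum_(s < k) ((lam s).1 + (lam s).2) != 0.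
Hypothesis phi_psi : forall x, phi.[x] = 0 -> psi.[x] = 0 -> False.
Hypothesis G_simple : no_multiple_roots G.

Lemma G_neq0 : G != 0.
Proof. by apply: contraTneq (G_simple 0) => ->; rewrite dvdp0. Qed.

Lemma deriv_G_neq0 t : G.[t] = 0 -> G^`().[t] != 0.
Proof.
move=> Gt; apply: contraNneq (G_simple t) => G't.
by rewrite double_root Gt G't eqxx.
Qed.

Lemma phi_root_G t : G.[t] = 0 -> phi.[t] != 0.
Proof.
move=> Gt; apply/eqP=> pt; apply: (phi_psi pt).
by apply/eqP; move: Gt; rewrite horner_G pt mulr0 sub0r => /eqP;
  rewrite oppr_eq0 mulf_eq0 (negPf q2_neq0).
Qed.

(** Differentiating the Bezout identity at [t] gives [e(t) p(t) = phi(t) psi'(t) - psi(t) phi'(t)].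
    Since [q1 phi(t) = q2 psi(t)], multiplication by [- q2] turns this into [phi(t) G'(t)], which is
    non-zero at a simple root. *)
Lemma erow_pvec_diag t : G.[t] = 0 -> (erow a h sites t *m p t) 0 0 != 0.
Proof.
move=> Gt; pose E := \sum_i erow a h sites t 0 i *: ppol a h sites i.
have EE x : E.[x] = (erow a h sites t *m p x) 0 0.
  by rewrite horner_sum mxE; apply: eq_bigr => i _; rewrite hornerZ mxE.
have eqE : ('X - t%:P) * E = phi.[t] *: psi - psi.[t] *: phi.
  apply/eqP; rewrite -subr_eq0; apply/eqP/poly_vanish => x.
  rewrite !hornerE EE; apply/eqP; rewrite subr_eq0; apply/eqP.
  have /matrixP/(_ 0 0) := erow_pvec a h t x (enum_uniq 'I_k).
  by rewrite mxE => ->; rewrite mxE eqxx mulr1n.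
have := congr1 (fun r : {poly C} => r^`().[t]) eqE.
rewrite /= derivM derivXsubC mul1r derivB !derivZ !hornerE subrr mul0r addr0 EE => ->.
have := mulf_neq0 (phi_root_G Gt) (deriv_G_neq0 Gt).
apply: contraNneq => e; move/eqP: Gt; rewrite horner_G subr_eq0 => /eqP Gt.
have -> : phi.[t] * G^`().[t] = (q1 * phi.[t]) * phi^`().[t] - q2 * (phi.[t] * psi^`().[t]).
  by rewrite derivB !derivZ !(hornerD, hornerN, hornerZ); ring.
rewrite Gt; apply/eqP; rewrite  -[RHS](mulr0 (- q2)) -e; ring.
Qed.

Definition rootsG : seq C := sval (closed_field_poly_normal G).

Lemma G_factor : G = lead_coef G *: \prod_(z <- rootsG) ('X - z%:P).
Proof. exact: svalP (closed_field_poly_normal G). Qed.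

Lemma G_root t : (G.[t] == 0) = (t \in rootsG).
Proof.
have -> : (G.[t] == 0) = root G t by [].
by rewrite G_factor rootZ ?lead_coef_eq0 ?G_neq0 // root_prod_XsubC.
Qed.

Lemma uniq_dvd_G ts : \prod_(z <- ts) ('X - z%:P) %| G -> uniq ts.
Proof.
move=> tsG; have simple z : ~~ (('X - z%:P) ^+ 2 %| \prod_(z <- ts) ('X - z%:P)).
  by apply: contra (G_simple z) => /dvdp_trans; apply.
elim: ts simple {tsG} => // z r IH simple /=.
rewrite IH ?andbT => [|x].
  apply: contra (simple z); rewrite big_cons expr2 => zr.
  by rewrite dvdp_mul // dvdp_XsubCl root_prod_XsubC.
by apply: contra (simple x); rewrite big_cons => /dvdp_mull; apply.
Qed.

Lemma uniq_rootsG : uniq rootsG.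
Proof.
by apply: uniq_dvd_G; rewrite G_factor dvdpZr // lead_coef_eq0 G_neq0.
Qed.

Lemma size_G : size G = (size rootsG).+1.
Proof.
rewrite {1}G_factor size_scale ?size_prod_XsubC // lead_coef_eq0.
exact: G_neq0.
Qed.

Lemma size_rootsG : size rootsG = (if q1 == q2 then k.-1 else k).
Proof.
have k_gt0 : q1 = q2 -> (0 < k)%N by move/sum_neq0/sum_ord_gt0.
have [] := gamma_size a (fun s => a s + h s) k_gt0; rewrite -!big_enum.
rewrite size_G ltnS => Gd Gc; apply/eqP; rewrite eqn_leq Gd -ltnS -size_G ltnNge.
apply/negP => /(nth_default 0); rewrite Gc; case: eqVneq => [q12|q12] /eqP; last first.
  by rewrite subr_eq0 (negPf q12).
under eq_bigr do rewrite addrAC subrr add0r.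
by rewrite big_enum mulf_eq0 (negPf q1_neq0) (negPf (sum_neq0 q12)).
Qed.

Definition basis_row (i : 'I_k) : 'rV[C]_k :=
  if (i < size rootsG)%N then erow a h sites (nth 0 rootsG i) else hrow h sites.

(* When [q1 = q2] the polynomial [G] has degree [k - 1], and the missing root
   at infinity is represented by the leading coefficient [ones] of [p]. *)
Definition basis_col (i : 'I_k) : 'cV[C]_k :=
  if (i < size rootsG)%N then p (nth 0 rootsG i) else ones C sites.

Definition basis_norm (i : 'I_k) : C := (basis_row i *m basis_col i) 0 0.

Definition rho (i : 'I_k) (x : C) : C :=
  if (i < size rootsG)%N then 1 - (x - nth 0 rootsG i)^-1 else 1.

Lemma G_nth (i : 'I_k) : (i < size rootsG)%N -> G.[nth 0 rootsG i] = 0.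
Proof. by move=> ir; apply/eqP; rewrite G_root mem_nth. Qed.

Lemma outside (i : 'I_k) : ~~ (i < size rootsG)%N -> q1 = q2 /\ i = k.-1 :> nat.
Proof.
rewrite -leqNgt size_rootsG; have := ltn_ord i; case: eqP => [-> ik ki|_ ik]; last first.
  by rewrite leqNgt ik.
by split=> //; lia.
Qed.

Lemma G_q12 x : q1 = q2 -> G.[x] = 0 -> phi.[x] - psi.[x] = 0.
Proof.
move=> q12 /eqP; rewrite horner_G -q12 -mulrBr mulf_eq0 (negPf q1_neq0).
by move=> /eqP.
Qed.

Lemma basis_norm_neq0 i : basis_norm i != 0.
Proof.
rewrite /basis_norm /basis_row /basis_col; case: ifPn => [ir|/outside[q12 _]].
  exact/erow_pvec_diag/G_nth.
rewrite hrow_ones ?enum_uniq // mxE eqxx mulr1n big_enum.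
exact: sum_neq0.
Qed.

(** At every root of [G] the pair [(phi, psi)] is proportional to [(q2, q1)], so the determinant in
    the Bezout identity vanishes. *)
Lemma erow_pvec_ortho x y : G.[x] = 0 -> G.[y] = 0 -> x != y ->
  erow a h sites x *m p y = 0.
Proof.
move=> Gx Gy xy; have yx : y - x != 0 by rewrite subr_eq0 eq_sym.
apply: (scalerI yx); rewrite erow_pvec ?enum_uniq // scaler0.
suff -> : phi.[x] * psi.[y] - psi.[x] * phi.[y] = 0 by rewrite raddf0.
apply: (mulfI q2_neq0); rewrite mulr0.
move/eqP: Gx; move/eqP: Gy; rewrite !horner_G !subr_eq0 => /eqP e1 /eqP e2.
have -> : q2 * (phi.[x] * psi.[y] - psi.[x] * phi.[y]) =
  phi.[x] * (q2 * psi.[y]) - (q2 * psi.[x]) * phi.[y] by ring.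
by rewrite -e1 -e2; ring.
Qed.

Lemma basis_dual i j :
  basis_row i *m basis_col j = (if i == j then basis_norm i else 0)%:M.
Proof.
case: eqP => [<-|ij]; first exact: mx11_scalar.
rewrite /basis_row /basis_col; case: ifPn => [ir|/outside[q12 ik]];
    case: ifPn => [jr|/outside[q12' jk]].
- rewrite raddf0 erow_pvec_ortho ?G_nth // nth_uniq ?uniq_rootsG //.
  by apply/eqP=> e; apply/ij/val_inj.
- by rewrite erow_ones ?enum_uniq // G_q12 ?raddf0 // G_nth.
- by rewrite hrow_pvec ?enum_uniq // G_q12 // G_nth.
- by case: ij; apply: val_inj; rewrite /= ik jk.
Qed.

Section Generic.
Variable x : C.
Hypotheses (phix : phi.[x] != 0) (Gx : G.[x] != 0).
Local Notation A := (Amx (alx a x) (bex a h x) sites).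
Local Notation f := (fvec (alx a x) (bex a h x) sites).
Local Notation Cr := (Crow (alx a x) (bex a h x) sites).
Local Notation g := (gscal (alx a x) (bex a h x) sites).

Let al0 : forall s, alx a x s != 0 := alx_neq0 phix.

Lemma gscal_G : q1 - q2 * g = G.[x] / phi.[x].
Proof.
have := gscalE (bex a h x) al0 sites; rewrite prod_alx prod_bex => e.
by rewrite horner_G -e; field.
Qed.

Definition Umx : 'M[C]_k := A - (q2 / (q1 - q2 * g)) *: (f *m Cr).

Lemma TQpol_mono :
  TQpol lam b q1 q2 x = q1 *: monodromy cr an (alx a x) (bex a h x) sites false false
    - q2 *: monodromy cr an (alx a x) (bex a h x) sites true true.
Proof. by rewrite /TQpol !Tpol_mono. Qed.

Lemma TQpol_crv v : TQpol lam b q1 q2 x *m crv cr v = crv cr (Umx *m v) *m TQpol lam b q1 q2 x.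
Proof.
rewrite TQpol_mono transfer_crv ?enum_uniq //; first last.
- by rewrite gscal_G mulf_neq0 ?invr_eq0.
- exact: car.
congr (crv cr _ *m _); rewrite /Umx mulmxBl -scalemxAl -mulmxA -scalerA.
congr (_ - _ *: _); apply/colP=> i; rewrite [RHS]mxE big_ord1 mxE mulrC.
by [].
Qed.

Lemma gam_neq0 : q1 - q2 * g != 0.
Proof. by rewrite gscal_G mulf_neq0 ?invr_eq0. Qed.

(** The unwanted terms along [p(x)] from [A] and from [f *m Cr] add up to a multiple of [G(t)],
    which is zero at a root. For the mode at infinity, where [q1 = q2], the two contributions are
    [f] and [- f]. *)
Lemma Umx_col i : Umx *m basis_col i = rho i x *: basis_col i.
Proof.
rewrite /basis_col /rho /Umx mulmxBl -scalemxAl -mulmxA.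
case: ifPn => [ir|/outside[q12 _]].
  set t := nth 0 rootsG i; have Gt : G.[t] = 0 := G_nth ir.
  have xt : x - t != 0 by rewrite subr_eq0; apply: contraNneq Gx => ->; apply/eqP.
  apply: (scalerI xt); rewrite scalerBr Amx_pvec ?enum_uniq //.
  rewrite [_ *: (_ *: (f *m _))]scalerA [(x - t) * (q2 / _)]mulrC -[_ *: (f *m _)]scalerA.
  rewrite [(x - t) *: (f *m _)]scalemxAr.
  rewrite Crow_pvec ?enum_uniq //.
  rewrite mul_mx_scalar fvec_pvec //.
  have -> : x - t - 1 = (x - t) * (1 - (x - t)^-1) by rewrite mulrBr mulr1 mulfV.
  rewrite !scalerA -addrA -scalerBl [X in _ + X *: _](_ : _ = 0) ?scale0r ?addr0 //.
  move: Gt; rewrite horner_G => Gt; have g0 := gam_neq0.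
  have -> : phi.[t] / phi.[x] - q2 / (q1 - q2 * g) * (phi.[t] * g - psi.[t]) * - phi.[x]^-1
    = (q1 * phi.[t] - q2 * psi.[t]) / ((q1 - q2 * g) * phi.[x]).
    by field; apply/andP.
  by rewrite Gt mul0r.
rewrite Amx_ones ?enum_uniq //.
rewrite Crow_ones ?enum_uniq //.
rewrite mul_mx_scalar scalerA scale1r.
have g0 := gam_neq0; move: g0; rewrite q12 => g0.
rewrite (_ : _ * (1 - g) = 1) ?scale1r ?addrK //.
have -> : q2 - q2 * g = q2 * (1 - g) by ring.
have g1 : 1 - g != 0 by apply: contraNneq g0 => e; rewrite -{1}[q2]mulr1 -mulrBr e mulr0.
by field; rewrite g1.
Qed.

Lemma TQpol_vac : TQpol lam b q1 q2 x *m vac R k = G.[x] *: vac R k.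
Proof.
have [vA _ vD] := monodromy_vac car (bex a h x) al0 (@ann_vac R k) (enum_uniq 'I_k).
rewrite TQpol_mono mulmxBl -!scalemxAl vA vD prod_alx prod_bex.
by rewrite horner_G scalerBl !scalerA.
Qed.

Lemma TQpol_wedge r :
  TQpol lam b q1 q2 x *m wedge cr (vac R k) (map basis_col r) =
  (G.[x] * \prod_(i <- r) rho i x) *: wedge cr (vac R k) (map basis_col r).
Proof.
rewrite (wedge_map _ TQpol_vac TQpol_crv) -map_comp.
rewrite (@wedge_scale _ _ _ _ _ _ (mulmx Umx \o basis_col) basis_col (rho^~ x)) ?scalerA //.
by move=> i _; rewrite /= Umx_col.
Qed.

End Generic.

Local Notation W := (wedgeI cr (vac R k) basis_col).

Definition eigenval (J : Idx k) (x : C) : C :=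
  G.[x] * \prod_(i <- filter J sites) rho i x.

Definition wedge_mx : 'M[C]_n := \matrix_(q, q') W (enum_val q') q 0.

Lemma vac_neq0 : vac R k != 0.
Proof.
apply/eqP=> /matrixP/(_ (enum_rank [ffun=> false]) 0) /eqP.
by rewrite !mxE enum_rankK eqxx oner_eq0.
Qed.

Lemma W_free : forall c, \sum_J c J *: W J = 0 -> forall J, c J = 0.
Proof.
exact: (wedgeI_free car (@ann_vac R k) vac_neq0 basis_norm_neq0 basis_dual).
Qed.

Lemma wedge_mx_mul (c : 'cV[C]_n) : wedge_mx *m c = \sum_J c (enum_rank J) 0 *: W J.
Proof.
apply/colP=> q; rewrite mxE summxE [RHS](reindex (@enum_val (Idx k) predT)) /=.
  by apply: eq_bigr => q' _; rewrite !mxE enum_valK mulrC.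
by apply: onW_bij; exact: enum_val_bij.
Qed.

Lemma wedge_mx_unit : wedge_mx \in unitmx.
Proof.
rewrite -unitmx_tr -row_free_unit; apply: inj_row_free => c c0.
have : wedge_mx *m c^T = 0 by apply: trmx_inj; rewrite trmx_mul trmxK c0 trmx0.
rewrite wedge_mx_mul => /W_free c0'; apply/rowP=> q.
by have := c0' (enum_val q); rewrite enum_valK !mxE.
Qed.

Lemma wedge_mx_col q : col q wedge_mx = W (enum_val q).
Proof. by apply/colP=> q'; rewrite !mxE. Qed.

Lemma generic_neq0 : phi * G != 0.
Proof. by rewrite mulf_neq0 ?G_neq0 ?phi_neq0. Qed.

Lemma TQpol_W x J : (phi * G).[x] != 0 ->
  TQpol lam b q1 q2 x *m W J = eigenval J x *: W J.
Proof.
by rewrite hornerM mulf_eq0 negb_or => /andP[px gx]; apply: TQpol_wedge.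
Qed.

Lemma TQ_is_diagonalizable : TQ_diagonalizable lam b q1 q2.
Proof.
exists wedge_mx; split=> [|m]; first exact: wedge_mx_unit.
apply/is_diag_mxP => q q' qq'.
have -> : (invmx wedge_mx *m TQ lam b q1 q2 m *m wedge_mx) q q' =
    (row q (invmx wedge_mx) *m TQ lam b q1 q2 m *m col q' wedge_mx) 0 0.
  by rewrite -!row_mul colE mulmxA -colE !mxE.
rewrite (TQ_of_TQpol (g := phi * G)) ?mxE //; first exact: generic_neq0.
move=> x gx; rewrite -mulmxA wedge_mx_col TQpol_W // -scalemxAr -wedge_mx_col.
rewrite colE mulmxA -row_mul mulVmx ?wedge_mx_unit // -colE.
apply/matrixP=> ? ?; rewrite !ord1 !mxE.
have /negPf -> : q != q' := qq'.
by rewrite mulr0.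
Qed.

Lemma wedge_roots_neq0 ts : uniq ts -> {subset ts <= rootsG} ->
  wedge cr (vac R k) (map p ts) != 0.
Proof.
(* The indices are moved to the subtype of roots, because [wedge_neq0] asks for duality between all
   indices and not only those in the list. *)
move=> uts /allP /all_sigP[s e]; rewrite e -map_comp.
have us : uniq s by apply: (map_uniq (f := sval)); rewrite -e.
have Gs (z : {z | z \in rootsG}) : G.[sval z] = 0.
  by apply/eqP; rewrite G_root; exact: svalP z.
apply: (wedge_neq0 car (@ann_vac R k) vac_neq0
  (u := fun z => erow a h sites (sval z))
  (kap := fun z => (erow a h sites (sval z) *m p (sval z)) 0 0)) us.
- by move=> z; apply: erow_pvec_diag.
- move=> z z'; case: eqP => [<-|zz']; first exact: mx11_scalar.
  rewrite raddf0 /= erow_pvec_ortho //.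
  by apply/eqP=> /val_inj.
Qed.

Lemma bethe_on_shell_neq0 l (t : 'I_l -> C) : BAE lam b q1 q2 t ->
  exists v, bethe_vector lam b t v /\ v != 0.
Proof.
rewrite /BAE phi_polE psi_polE => tG; exists (bethe_vec lam b t).
split; first exact: bethe_vec_correct.
pose ts := map t (enum 'I_l).
have tsG : \prod_(z <- ts) ('X - z%:P) %| G by rewrite /ts big_map big_enum.
have sub : {subset ts <= rootsG}.
  move=> z zt; rewrite -G_root; move/dvdpP: tsG => [Q ->].
  rewrite hornerM mulf_eq0; apply/orP; right.
  by have : root (\prod_(z <- ts) ('X - z%:P)) z by rewrite root_prod_XsubC.
have := wedge_roots_neq0 (uniq_dvd_G tsG) sub.
rewrite -[map p ts]/(map (evalv (ppol a h sites)) ts) wedge_newton; last first.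
  by move=> i; apply: leq_trans (size_ppol _ _ _ _) _; rewrite size_enum_ord.
rewrite scaler_eq0 negb_or => /andP[_ w0].
by rewrite scaler_eq0 negb_or signr_eq0.
Qed.

Definition coords (v : 'cV[C]_n) (J : Idx k) : C :=
  (invmx wedge_mx *m v) (enum_rank J) 0.

Lemma coordsE v : v = \sum_J coords v J *: W J.
Proof. by rewrite -wedge_mx_mul mulKVmx ?wedge_mx_unit. Qed.

Lemma eigen_coords v J J' x : TQ_eigenvector lam b q1 q2 v ->
  coords v J != 0 -> coords v J' != 0 -> x != 0 -> (phi * G).[x] != 0 ->
  eigenval J x = eigenval J' x.
Proof.
move=> [_ ev] J0 J'0 x0 gx.
pose D : 'M[C]_n := diag_mx (\row_(q < n) eigenval (@enum_val (Idx k) predT q) x).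
have TD : TQpol lam b q1 q2 x *m wedge_mx = wedge_mx *m D.
  rewrite /D mul_mx_diag; apply/matrixP=> q q'.
  have -> : (TQpol lam b q1 q2 x *m wedge_mx) q q' =
      (TQpol lam b q1 q2 x *m col q' wedge_mx) q 0 by rewrite colE mulmxA -colE [RHS]mxE.
  by rewrite wedge_mx_col TQpol_W // !mxE mulrC.
pose c := invmx wedge_mx *m v.
(* [w] annihilates the coordinates of [v], hence those of every [TQ m *m v], whatever the
   eigenvalues are; they need not be assembled into a function of [x]. *)
pose w : 'rV[C]_n := coords v J' *: delta_mx 0 (enum_rank J)
                   - coords v J *: delta_mx 0 (enum_rank J').
have cw : w *m c = 0.
  rewrite mulmxBl -!scalemxAl -!rowE; apply/matrixP=> i j; rewrite !ord1 !mxE.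
  by rewrite /coords -/c !mxE mulrC subrr.
have vE : v = wedge_mx *m c by rewrite /c mulKVmx ?wedge_mx_unit.
have : w *m invmx wedge_mx *m TQpol lam b q1 q2 x *m v = 0.
  apply: TQpol_of_TQ => // m; have [mu e] := ev m.
  by rewrite -mulmxA e -scalemxAr -mulmxA -/c cw scaler0.
rewrite -mulmxA {1}vE [TQpol _ _ _ _ _ *m _]mulmxA TD !mulmxA mulmxKV ?wedge_mx_unit //.
rewrite mulmxBl -!scalemxAl -!rowE !row_diag_mx !mxE !enum_rankK.
have rc J1 : row (enum_rank J1) (invmx wedge_mx) *m v = (coords v J1)%:M.
  by rewrite -row_mul [LHS]mx11_scalar mxE.
rewrite !mulmxBl -!scalemxAl -!rowE !rc => /matrixP/(_ 0 0).
rewrite !mxE eqxx !mulr1n => /eqP.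
have -> : coords v J' * (eigenval J x * coords v J) - coords v J * (eigenval J' x * coords v J')
  = coords v J' * coords v J * (eigenval J x - eigenval J' x) by ring.
by rewrite !mulf_eq0 (negPf J0) (negPf J'0) subr_eq0 => /eqP.
Qed.

Definition finite_roots (J : Idx k) : seq C :=
  map (fun i : 'I_k => nth 0 rootsG i) (filter (fun i : 'I_k => J i && (i < size rootsG)%N) sites).

Lemma prod_rho (J : Idx k) x : G.[x] != 0 ->
  \prod_(i <- filter J sites) rho i x =
  \prod_(z <- finite_roots J) ((x - z - 1) / (x - z)).
Proof.
move=> Gx; rewrite big_map !big_filter big_mkcond [RHS]big_mkcond.
apply: eq_bigr => i _ /=; case: (J i) => //=; rewrite /rho; case: ifPn => // ir.
have xt : x - nth 0 rootsG i != 0.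
  by rewrite subr_eq0; apply: contraNneq Gx => ->; rewrite G_nth.
by rewrite mulrBl mulfV // mul1r.
Qed.

(* A [1]-periodic difference of multiplicities with finite support vanishes. *)
Lemma shift_perm (r s : seq C) :
  \prod_(z <- r) ('X - (z + 1)%:P) * \prod_(z <- s) ('X - z%:P) =
  \prod_(z <- s) ('X - (z + 1)%:P) * \prod_(z <- r) ('X - z%:P) -> perm_eq r s.
Proof.
rewrite -!(big_map (+%R^~ 1) xpredT (fun z => 'X - z%:P)) -!big_cat => /prod_XsubC_eq /permP rs.
have step z : (count_mem (z + 1)%R r + count_mem z s = count_mem (z + 1)%R s + count_mem z r)%N.
  have cm u : count (preim (+%R^~ 1) (pred1 (z + 1))) u = count_mem z u.
    by apply: eq_count => y /=; rewrite (inj_eq (addIr 1)).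
  have := rs (pred1 (z + 1)); rewrite !count_cat !count_map !cm => e.
  by rewrite addnC -e addnC.
apply/allP => z0 _; apply/eqP/eqP/negPn/negP => zN.
have down m : count_mem (z0 - m%:R) r != count_mem (z0 - m%:R) s.
  elim: m => [|m IH]; first by rewrite subr0.
  apply: contra IH => /eqP e; have := step (z0 - m.+1%:R).
  have -> : z0 - m.+1%:R + 1 = z0 - m%:R by rewrite -[m.+1%:R]natr1; ring.
  by rewrite e => /addIn ->.
pose l := [seq z0 - m%:R | m <- iota 0 (size (r ++ s)).+1].
have ul : uniq l.
  rewrite map_inj_uniq ?iota_uniq // => i j /addrI /oppr_inj /eqP.
  by rewrite eqr_nat => /eqP.
have : (size l <= size (r ++ s))%N.
  apply: uniq_leq_size => // _ /mapP[m _ ->]; rewrite mem_cat.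
  apply: contraTT (down m); rewrite negb_or => /andP[/count_memPn -> /count_memPn ->].
  by rewrite eqxx.
by rewrite size_map size_iota ltnn.
Qed.

(** After [G] is cancelled, clearing denominators in [prod_rho] gives the hypothesis of
    [shift_perm]; the roots being distinct, the list of roots determines [J] on the finite modes. *)
Lemma eigenval_inj J J' :
  (forall x, x != 0 -> (phi * G).[x] != 0 -> eigenval J x = eigenval J' x) ->
  forall i : 'I_k, (i < size rootsG)%N -> J i = J' i.
Proof.
move=> ee.
have /perm_mem pm : perm_eq (finite_roots J) (finite_roots J').
  apply: shift_perm; apply/eqP; rewrite -subr_eq0; apply/eqP.
  apply: (@poly_vanish_gen _ (phi * G * 'X)).
    by rewrite mulf_neq0 ?generic_neq0 ?polyX_eq0.
  move=> x; rewrite hornerM mulf_eq0 negb_or hornerX => /andP[gx x0].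
  have := ee x x0 gx; move: gx; rewrite hornerM mulf_eq0 negb_or => /andP[_ Gx].
  move=> /(mulfI Gx); rewrite !prod_rho // !prodf_div => e.
  have d0 J1 : \prod_(z <- finite_roots J1) (x - z) != 0.
    rewrite prodf_seq_neq0; apply/allP=> z zf; case: (mapP zf) => i.
    rewrite mem_filter => /andP[/andP[_ ir] _] ->.
    by rewrite /= subr_eq0; apply: contraNneq Gx => ->; rewrite G_nth.
  apply/eqP; rewrite hornerD hornerN subr_eq0 !hornerM !horner_prod.
  move/eqP: e; rewrite eqr_div // => /eqP e.
  apply/eqP; move: e.
  rewrite !(eq_bigr _ (fun z _ => hornerXsubC _ _)).
  have sh s : \prod_(z <- s) (x - (z + 1)) = \prod_(z <- s) (x - z - 1).
    by apply: eq_bigr => z _; rewrite opprD addrA.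
  by rewrite !sh.
have memf J1 (i : 'I_k) : (i < size rootsG)%N -> (nth 0 rootsG i \in finite_roots J1) = J1 i.
  move=> ir; apply/mapP/idP => [[j]|J1i].
    rewrite mem_filter => /andP[/andP[J1j jr] _] /eqP.
    by rewrite nth_uniq ?uniq_rootsG // => /eqP /val_inj ->.
  by exists i; rewrite // mem_filter J1i ir mem_enum.
by move=> i ir; rewrite -!memf // pm.
Qed.


(** The row of [e12] is [basis_row] of the mode at infinity, so a singular vector is killed by the
    occupation number of that mode. *)
Lemma singular_coords v (J : Idx k) (i : 'I_k) : singular lam b v ->
  ~~ (i < size rootsG)%N -> J i -> coords v J = 0.
Proof.
rewrite /singular Tcoef21 => sv ir Ji.
have Wi J1 : crv cr (basis_col i) *m anv an (hrow h sites) *m W J1 =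
    (if J1 i then basis_norm i else 0) *: W J1.
  have -> : hrow h sites = basis_row i by rewrite /basis_row (negPf ir).
  rewrite (number_wedge car (@ann_vac R k) basis_dual) ?uniqI //.
  by rewrite mem_filter mem_enum andbT.
have : \sum_J1 (coords v J1 * (if J1 i then basis_norm i else 0)) *: W J1 = 0.
  transitivity (crv cr (basis_col i) *m anv an (hrow h sites) *m v).
    rewrite [in RHS](coordsE v) mulmx_sumr; apply: eq_bigr => J1 _.
    by rewrite -scalemxAr Wi scalerA.
  by rewrite -mulmxA sv mulmx0.
move=> /W_free/(_ J)/eqP; rewrite Ji mulf_eq0 (negPf (basis_norm_neq0 i)) orbF.
by move=> /eqP.
Qed.

Lemma bethe_span (J : Idx k) : (forall i : 'I_k, J i -> (i < size rootsG)%N) ->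
  exists l (t : 'I_l -> C) c, [/\ BAE lam b q1 q2 t, c != 0 & W J = c *: bethe_vec lam b t].
Proof.
move=> Jr; pose ts := map (fun i : 'I_k => nth 0 rootsG i) (filter J sites).
have uts : uniq ts.
  rewrite map_inj_in_uniq ?uniqI // => i j; rewrite !mem_filter => /andP[/Jr ir _] /andP[/Jr jr _].
  by move/eqP; rewrite nth_uniq ?uniq_rootsG // => /eqP/val_inj.
have rts : all (root G) ts.
  apply/allP=> z zts; case: (mapP zts) => i; rewrite mem_filter => /andP[/Jr ir _] ->.
  by apply/eqP/G_nth.
pose t (m : 'I_(size ts)) := nth 0 ts m.
have tE : map t (enum 'I_(size ts)) = ts.
  by rewrite (map_comp (nth 0 ts) val) val_enum_ord map_nth_iota0 // take_size.
exists (size ts), t, (vandermonde ts * (-1) ^+ size ts); split.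
- rewrite /BAE phi_polE psi_polE.
  have -> : y_pol t = \prod_(z <- ts) ('X - z%:P) by rewrite -[in RHS]tE big_map big_enum.
  by rewrite uniq_roots_dvdp // uniq_rootsE.
- by rewrite mulf_neq0 ?vandermonde_neq0 // signr_eq0.
rewrite /bethe_vec tE scalerA -mulrA -expr2 sqrr_sign mulr1.
rewrite -wedge_newton; last first.
  by move=> i; apply: leq_trans (size_ppol _ _ _ _) _; rewrite size_enum_ord.
rewrite /wedgeI /ts -map_comp; congr (wedge _ _ _); apply/eq_in_map => i.
by rewrite mem_filter => /andP[/Jr ir _]; rewrite /basis_col ir.
Qed.

Lemma bethe_is_complete : bethe_complete lam b q1 q2.
Proof.
split=> [l t|v vE sv]; first exact: bethe_on_shell_neq0.
have [J0 cJ0] : exists J, coords v J != 0.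
  case: (boolP [exists J, coords v J != 0]) => [/existsP //|/existsPn c0].
  case: vE => /eqP[]; rewrite (coordsE v) big1 // => J _.
  by have := c0 J; rewrite negbK => /eqP ->; rewrite scale0r.
have Jr J : coords v J != 0 -> forall i : 'I_k, J i -> (i < size rootsG)%N.
  move=> cJ i Ji; apply: contraNT cJ => ir; have [q12 _] := outside ir.
  by rewrite (singular_coords (sv q12) ir Ji).
have vW : v = coords v J0 *: W J0.
  rewrite {1}(coordsE v) (bigD1 J0) //= big1 ?addr0 // => J JJ0.
  case: (eqVneq (coords v J) 0) => [->|cJ]; first by rewrite scale0r.
  case/eqP: JJ0; apply/ffunP=> i; case: (boolP (i < size rootsG)%N) => [ir|ir].
    by apply: eigenval_inj ir => x x0 gx; exact: eigen_coords vE cJ cJ0 x0 gx.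
  by rewrite (negPf (contra (Jr _ cJ i) ir)) (negPf (contra (Jr _ cJ0 i) ir)).
have [l [t [c [tB c0 Wt]]]] := bethe_span (Jr _ cJ0).
exists l, t, (bethe_vec lam b t), (coords v J0 * c); split=> //.
split; first exact: bethe_vec_correct.
by rewrite mulf_neq0 // -scalerA -Wt.
Qed.

End TransferMatrix.

(** * Irreducibility *)

Section Irreducibility.
Variables (R : realType) (k : nat).
Local Notation C := (R[i])%C.
Local Notation n := (Defs.dim k).
Variables (lam : 'I_k -> C * C) (b : 'I_k -> C).
Local Notation sites := (enum 'I_k).
Local Notation a := (wa lam b).
Local Notation h := (wh lam).
Local Notation phi := (phis a sites).
Local Notation psi := (psis a h sites).
Local Notation p := (pvec a h sites).
Local Notation cr := (@cre R k).
Local Notation an := (@ann R k).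
Local Notation car := (car_cre_ann R k).

(** Stability of [U] is the vanishing of [U *m M^T *m cokermx U], whose entries are matrix elements
    of [M]; for these [Tcoef_of_Tpol] applies. *)
Lemma stable_Tcoef (U : 'M[C]_n) :
  (forall x i j, phi.[x] != 0 -> (U *m (Tpol lam b i j x)^T <= U)%MS) ->
  forall i j r, (U *m (Tcoef lam b i j r)^T <= U)%MS.
Proof.
move=> st i j r; rewrite submxE; apply/eqP/matrixP => q q'.
have e (M : 'M[C]_n) : (U *m M^T *m cokermx U) q q' =
    (row q' (cokermx U)^T *m M *m col q U^T) 0 0.
  have -> : U *m M^T *m cokermx U = ((cokermx U)^T *m M *m U^T)^T.
    by rewrite !trmx_mul !trmxK mulmxA.
  by rewrite -!row_mul colE mulmxA -colE !mxE.
rewrite e (Tcoef_of_Tpol (g := phi)) ?mxE ?phi_neq0 // => x px.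
have := st x i j px; rewrite submxE => /eqP e0.
by rewrite [LHS]mx11_scalar -e e0 mxE raddf0.
Qed.

Lemma crv_neq0 (v : 'cV[C]_k) : v != 0 -> crv cr v != 0.
Proof.
move=> /cV0Pn[s vs]; apply: contra vs => /eqP v0.
have := an_crv car s v; rewrite v0 mulmx0 mul0mx subr0 => /(congr1 (mulmx^~ (vac R k))).
rewrite mul0mx -scalemxAl mul1mx => /esym/eqP.
by rewrite scaler_eq0 (negPf (vac_neq0 _ _)) orbF.
Qed.

Lemma anv_neq0 (u : 'rV[C]_k) : u != 0 -> anv an u != 0.
Proof.
move=> /rV0Pn[s us]; apply: contra us => /eqP u0.
have := anv_cr car u s; rewrite u0 mulmx0 mul0mx subr0 => /(congr1 (mulmx^~ (vac R k))).
rewrite mul0mx -scalemxAl mul1mx => /esym/eqP.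
by rewrite scaler_eq0 (negPf (vac_neq0 _ _)) orbF.
Qed.

Section CommonRoot.
Hypothesis irr : irreducible_mod lam b.
Variable z : C.
Hypotheses (phiz : phi.[z] = 0) (psiz : psi.[z] = 0).

(* Otherwise the image of [c^+(p z)] is a submodule. *)
Lemma pvec_common_root : p z = 0.
Proof.
apply/eqP/negPn/negP => pz; set v := p z in pz.
have := irr (U := (crv cr v)^T); case.
- apply: stable_Tcoef => x i j px.
  suff [T' e] : exists T', Tpol lam b i j x *m crv cr v = crv cr v *m T'.
    by rewrite -trmx_mul e trmx_mul submxMl.
  have al0 := alx_neq0 px.
  have [R1 R2 R3 R4] := monodromy_rel car (bex a h x) al0 (enum_uniq 'I_k).
  have xz : x - z != 0 by rewrite subr_eq0; apply: contraNneq px => ->; apply/eqP.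
  (* The unwanted term carries the factor [phi(z) = 0], so [v] is an eigenvector of [A] at every
     [x]; likewise the contraction [Cv] vanishes because [phi(z) = psi(z) = 0]. *)
  have Av : Amx (alx a x) (bex a h x) sites *m v = (1 - (x - z)^-1) *: v.
    apply: (scalerI xz); rewrite Amx_pvec ?enum_uniq // phiz mul0r scale0r addr0 scalerA.
    by rewrite mulrBr mulr1 mulfV.
  have Cv : (Crow (alx a x) (bex a h x) sites *m v) 0 0 = 0.
    apply: (mulfI xz); have /matrixP/(_ 0 0) := Crow_pvec h al0 z (enum_uniq 'I_k).
    by rewrite phiz psiz mul0r subrr mxE => ->; rewrite !mxE mulr0 mul0rn.
  rewrite Tpol_mono; set f := fvec _ _ _ in R2 R4.
  have fv : crv cr f *m crv cr v = - (crv cr v *m crv cr f) := crv_anti car f v.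
  set c := 1 - (x - z)^-1 in Av; set M := monodromy _ _ _ _ _ in R1 R2 R3 R4 *.
  have {}R1 : M false false *m crv cr v = crv cr v *m (c *: M false false).
    by rewrite R1 Av crvZ -scalemxAl -scalemxAr.
  have {}R3 : M true false *m crv cr v = crv cr v *m (- c *: M true false).
    by rewrite R3 Av Cv crvZ scale0r sub0r -scalemxAl -scalemxAr scaleNr.
  have fM T T' : T *m crv cr v = crv cr v *m T' ->
      crv cr f *m T *m crv cr v = crv cr v *m - (crv cr f *m T').
    by move=> e; rewrite -mulmxA e mulmxA fv mulNmx -mulmxA mulmxN.
  case: i j => [] [].
  + by rewrite R4 mulmxDl -scalemxAl R1 (fM _ _ R3) scalemxAr -mulmxDr; eexists.
  + by rewrite R3; eexists.
  + by rewrite R2 (fM _ _ R1); eexists.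
  + by rewrite R1; eexists.
- by move=> e; have := crv_neq0 pz; rewrite -[crv cr v]trmxK e trmx0 eqxx.
rewrite row_full_unit unitmx_tr => u.
have := crv_neq0 pz; rewrite -[crv cr v](mulKmx u) (crv_sqr car) mulmx0.
by rewrite eqxx.
Qed.

Hypothesis k_gt0 : (0 < k)%N.

(* Since [p z = 0] the vectors [p t] do not span, and the common kernel of the [c(u)] with
   [u] orthogonal to all of them is a submodule containing the vacuum. *)
Lemma no_common_root : False.
Proof.
have pz := pvec_common_root.
(* The matrix of coefficients of [p]. From [p z = 0] it kills the column of powers of [z], whose
   entry 0 is 1, so it is singular and its left kernel [N] is non-zero. *)
pose P : 'M[C]_(k, k) := \matrix_(i, m) (ppol a h sites i)`_m.
have PE t : p t = P *m \col_m t ^+ m.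
  apply/colP=> i; rewrite !mxE (@horner_coef_wide _ k); last first.
    by apply: leq_trans (size_ppol _ _ _ _) _; rewrite size_enum_ord.
  by apply: eq_bigr => m _; rewrite !mxE.
pose N := kermx P.
have NP t : N *m p t = 0 by rewrite PE mulmxA mulmx_ker mul0mx.
have vz : \col_m z ^+ m != 0 :> 'cV[C]_k.
  by apply/cV0Pn; exists (Ordinal k_gt0); rewrite mxE expr0 oner_eq0.
have N0 : N != 0.
  rewrite kermx_eq0 row_free_unit; apply: contra vz => u.
  by rewrite -(mulKmx u (\col_m z ^+ m)) -PE pz mulmx0.
(* By [Amx_pvec] the vector [(x - t) A p(t)] is a combination of [p(t)] and [p(x)], both killed by
   [N]. Hence [N A P = 0], first for [t != x] and then coefficientwise: the row space of [N] is
   stable under [A]. *)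
have NA x : phi.[x] != 0 -> exists X, N *m Amx (alx a x) (bex a h x) sites = X *m N.
  move=> px; apply/submxP; rewrite sub_kermx; apply/eqP.
  set Z := N *m _ *m P; apply/row_matrixP=> i; rewrite row0.
  pose q := \poly_(m < k) (if insub m is Some m' then Z i m' else 0).
  have qm (m : 'I_k) : q`_m = Z i m by rewrite coef_poly ltn_ord valK.
  suff q0 : q = 0 by apply/rowP=> m; rewrite [LHS]mxE -qm q0 coef0 mxE.
  apply: (@poly_vanish_gen _ ('X - x%:P)) => [|t]; first by rewrite polyXsubC_eq0.
  rewrite hornerXsubC => tx; rewrite (horner_coef_wide _ (size_poly _ _)).
  have -> : \sum_(m < k) q`_m * t ^+ m = (Z *m \col_m t ^+ m) i 0.
    by rewrite mxE; apply: eq_bigr => m _; rewrite qm [X in _ = _ * X]mxE.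
  rewrite /Z -mulmxA -PE -mulmxA.
  have xt : x - t != 0 by rewrite -opprB oppr_eq0.
  suff -> : N *m (Amx (alx a x) (bex a h x) sites *m p t) = 0 by rewrite mxE.
  apply: (scalerI xt); rewrite scaler0 scalemxAr Amx_pvec ?enum_uniq //; last exact: alx_neq0.
  by rewrite mulmxDr -!scalemxAr !NP !scaler0 addr0.
pose U := (\bigcap_(i < k) kermx (anv an (row i N))^T)%MS.
have UN (y : 'rV_k) : U *m (anv an (y *m N))^T = 0.
  rewrite mulmx_sum_row anv_sum linear_sum mulmx_sumr big1 // => i _.
  rewrite anvZ linearZ /= -scalemxAr (_ : U *m _ = 0) ?scaler0 //.
  by apply/sub_kermxP; rewrite /U (bigcapmx_inf i).
have := irr (U := U); case.
- apply: stable_Tcoef => x i j px; apply/sub_bigcapmxP => s _; apply/sub_kermxP.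
  rewrite -mulmxA -trmx_mul.
  suff [T' [y e]] : exists T' (y : 'rV_k),
      anv an (row s N) *m Tpol lam b i j x = T' *m anv an (y *m N).
    by rewrite e trmx_mul mulmxA UN mul0mx.
  have al0 := alx_neq0 px; have [X NX] := NA x px.
  have [_ R2 _ R4] := monodromy_rel car (bex a h x) al0 (enum_uniq 'I_k).
  have [I1 I3] := anv_mono car (bex a h x) al0 (row s N) (enum_uniq 'I_k).
  have rX : row s N *m Amx (alx a x) (bex a h x) sites = row s X *m N.
    by rewrite -!row_mul NX.
  rewrite Tpol_mono; rewrite {}rX in I1 I3; set f := fvec _ _ _ in R2 R4.
  (* [f] is proportional to [p(x)], which [N] kills, so there is no contraction term. *)
  have Nf : anv an (row s N) *m crv cr f = - (crv cr f *m anv an (row s N)).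
    rewrite (anv_crv car) /f fvec_pvec // -scalemxAr -row_mul NP row0.
    by rewrite scaler0 mxE scale0r sub0r.
  set M := monodromy _ _ _ _ _ in I1 I3 R2 R4 *.
  have fM T T' : anv an (row s N) *m T = T' *m anv an (row s X *m N) ->
      anv an (row s N) *m (crv cr f *m T) = - (crv cr f *m T') *m anv an (row s X *m N).
    by move=> e; rewrite mulmxA Nf mulNmx -mulmxA e mulmxA mulNmx.
  rewrite -mulNmx in I3.
  case: i j => [] [].
  + by rewrite R4 mulmxDr -scalemxAr I1 (fM _ _ I3) scalemxAl -mulmxDl; do 2 eexists.
  + by rewrite I3; do 2 eexists.
  + by rewrite R2 (fM _ _ I1); do 2 eexists.
  + by rewrite I1; do 2 eexists.
- move=> U0; have : ((vac R k)^T <= U)%MS.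
    apply/sub_bigcapmxP => s _; apply/sub_kermxP; rewrite -trmx_mul.
    by rewrite (anv_vac (@ann_vac R k)) trmx0.
  rewrite U0 submx0 => /eqP /(congr1 trmx); rewrite trmxK trmx0 => /eqP.
  by rewrite (negPf (vac_neq0 _ _)).
rewrite row_full_unit => u; case/eqP: N0; apply/row_matrixP => i; rewrite row0.
apply/eqP/negPn/negP => /anv_neq0 /eqP; case.
apply: trmx_inj; rewrite trmx0 -[LHS](mulKmx u) (_ : U *m _ = 0) ?mulmx0 //.
by rewrite rowE UN.
Qed.

End CommonRoot.

End Irreducibility.

(** * Generic evaluation parameters *)

Section SimpleRoots.
Variable K : numClosedFieldType.

Lemma no_multiple_rootsP (q : {poly K}) : q != 0 ->
  no_multiple_roots q <-> (size (gcdp q q^`()) <= 1)%N.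
Proof.
move=> q0; split=> [simple|sg t]; last first.
  rewrite double_root; apply/negP => /andP[qt q't].
  have : 'X - t%:P %| gcdp q q^`() by rewrite dvdp_gcd !dvdp_XsubCl /root qt.
  move/dvdp_leq; rewrite gcdp_eq0 negb_and q0 size_XsubC => /(_ isT).
  by rewrite leqNgt ltnS sg.
rewrite leqNgt; apply/negP=> sg; have /closed_rootP[t] : size (gcdp q q^`()) != 1%N.
  by rewrite neq_ltn sg orbT.
rewrite root_gcd => /andP[/eqP qt /eqP q't].
by have := simple t; rewrite double_root qt q't eqxx.
Qed.

(** * Making the roots simple with one additional site *)

Section AddRoot.
Variables (k : nat) (a h : 'I_k -> K) (q1 q2 h0 : K).
Hypotheses (q1_neq0 : q1 != 0) (q2_neq0 : q2 != 0) (h0_neq0 : h0 != 0).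
Hypothesis sum_neq0 : q1 = q2 -> h0 + \sum_s h s != 0.
Variables f g G : {poly K}.
Hypotheses (fE : f = \prod_s ('X - (a s)%:P)) (gE : g = \prod_s ('X - (a s + h s)%:P)).
Hypotheses (fg : forall t, f.[t] = 0 -> g.[t] = 0 -> False) (GE : G = q1 *: f - q2 *: g).

Let Gt t : G.[t] = q1 * f.[t] - q2 * g.[t].
Proof. by rewrite GE hornerD hornerN !hornerZ. Qed.

(* The derivative of [x + q2 h0 g(x) / G(x)], the value of the additional parameter
   for which [x] becomes a root. *)
Definition ramification : {poly K} :=
  G ^+ 2 + (q2 * h0) *: (g^`() * G - g * G^`()).

(** Equal to [q1 ('X - a0) f - q2 ('X - (a0 + h0)) g], the polynomial [q1 phi - q2 psi] of the
    enlarged chain. *)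
Definition Gadd (a0 : K) : {poly K} := ('X - a0%:P) * G + (q2 * h0) *: g.

Lemma Gg t : G.[t] = 0 -> g.[t] = 0 -> False.
Proof.
move=> Gt0 gt; apply: (fg _ gt); move: Gt0; rewrite Gt gt mulr0 subr0 => /eqP.
by rewrite mulf_eq0 (negPf q1_neq0) => /eqP.
Qed.

(** A root [t] determines [a0] as the value at [t] of a rational function, and a double root is a
    critical point of it; a non-zero [ramification] therefore leaves finitely many bad [a0]. *)
Lemma Gadd_double a0 t : (('X - t%:P) ^+ 2 %| Gadd a0) ->
  ramification.[t] = 0 /\ a0 = t + q2 * h0 * g.[t] / G.[t].
Proof.
rewrite double_root => /andP[/eqP e1 /eqP e2].
have {}e1 : (t - a0) * G.[t] + q2 * h0 * g.[t] = 0.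
  by rewrite -e1 /Gadd hornerD hornerM hornerXsubC hornerZ.
have {}e2 : G.[t] + (t - a0) * G^`().[t] + q2 * h0 * g^`().[t] = 0.
  rewrite -e2 /Gadd derivD derivM derivXsubC derivZ mul1r hornerD.
  by rewrite [in RHS]hornerD hornerM hornerXsubC hornerZ.
have NE : ramification.[t] = G.[t] ^+ 2 + q2 * h0 * (g^`().[t] * G.[t] - g.[t] * G^`().[t]).
  by rewrite /ramification hornerD horner_exp hornerZ [in LHS]hornerD hornerN !hornerM.
have G0 : G.[t] != 0.
  apply/eqP=> G0; apply: (Gg G0); move/eqP: e1; rewrite G0 mulr0 add0r.
  by rewrite !mulf_eq0 (negPf q2_neq0) (negPf h0_neq0) => /eqP.
move: e1 e2 G0 NE; move: (G.[t]) (G^`().[t]) (g.[t]) (g^`().[t]) => y y' w w' e1 e2 y0 ->.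
have e3 : a0 = t + q2 * h0 * w / y.
  have -> : q2 * h0 * w = - ((t - a0) * y) by apply/eqP; rewrite -addr_eq0 addrC e1.
  by field.
split=> //; rewrite -[RHS](mulr0 y) -e2 e3; by field.
Qed.

(** If [G = 0], then [f] and [g] are proportional without a common root, so [g] has no root and
    neither has [Gadd]. Otherwise [G], being coprime to [g], divides [G'] and is constant; then [g']
    is a constant, which forces [k = 1] and [q1 = q2], and comparing constant terms gives
    [h0 + \sum_s h s = 0], contrary to assumption. *)
Lemma ramification_eq0 a0 : ramification = 0 -> no_multiple_roots (Gadd a0).
Proof.
move=> N0.
have G2 : G ^+ 2 = (q2 * h0) *: (g * G^`() - g^`() * G).
  by apply/eqP; rewrite -subr_eq0 -scalerN opprB; apply/eqP.
have qh : q2 * h0 != 0 by rewrite mulf_neq0.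
have [G0|G0] := eqVneq G 0.
  have fN t : f.[t] != 0.
    apply/eqP=> ft; apply: (fg ft); have := Gt t; rewrite G0 horner0 ft mulr0 sub0r.
    by move=> /esym/eqP; rewrite oppr_eq0 mulf_eq0 (negPf q2_neq0) => /eqP.
  move=> t; rewrite double_root /Gadd G0 mulr0 add0r hornerZ mulf_eq0 (negPf qh) /=.
  apply/negP=> /andP[/eqP gt _]; have := Gt t; rewrite G0 horner0 gt mulr0 subr0.
  by move=> /esym/eqP; rewrite mulf_eq0 (negPf q1_neq0) (negPf (fN t)).
have cG : coprimep G g.
  apply/negPn/negP; rewrite /coprimep => /closed_rootP[t].
  by rewrite root_gcd => /andP[/eqP Gt0 /eqP gt]; apply: (Gg Gt0).
have dG : G %| G^`().
  rewrite -(Gauss_dvdpr _ cG) -(dvdpZr _ _ qh).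
  have -> : (q2 * h0) *: (g * G^`()) = G * (G + (q2 * h0) *: g^`()).
    rewrite mulrDr -expr2 G2 scalerBr -scalerAr [G * _]mulrC.
    by rewrite subrK.
  exact: dvdp_mulr.
have G'0 : G^`() = 0.
  apply/eqP/negPn/negP => /dvdp_leq/(_ dG); rewrite leqNgt.
  by rewrite lt_size_deriv.
have g'E : g^`() = (- (q2 * h0)^-1) *: G.
  apply: (mulIf G0); rewrite -scalerAl -expr2 G2 G'0 mulr0 sub0r scalerA.
  by rewrite mulNr mulVf // scaleN1r opprK.
have G1 m : (0 < m)%N -> G`_m = 0.
  case: m => // m _; have := congr1 (fun r : {poly K} => r`_m) G'0.
  by rewrite coef_deriv coef0 => /eqP; rewrite mulrn_eq0 /= => /eqP.
have gk : g`_k = 1.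
  have := monic_prod_XsubC (index_enum 'I_k) predT (fun s => a s + h s).
  rewrite -gE => /monicP; rewrite /lead_coef gE size_prod_XsubC /=.
  by rewrite -[index_enum _]enumT size_enum_ord.
have sg : size g = k.+1.
  by rewrite gE size_prod_XsubC -[index_enum _]enumT size_enum_ord.
have k0 : (0 < k)%N.
  case: (posnP k) => // k0; move: sg g'E; rewrite k0 => /eqP/size_poly1P[c _ ->].
  rewrite derivC => /esym/eqP.
  by rewrite scaler_eq0 (negPf G0) orbF oppr_eq0 invr_eq0 (negPf qh).
have := coef_deriv g k.-1; rewrite prednK // gk g'E coefZ.
have [k1|k1] := posnP k.-1; last first.
  by rewrite G1 // mulr0 => /esym/eqP; rewrite pnatr_eq0 => /eqP kz; move: k0; rewrite kz.
have k1' : k = 1%N by lia.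
rewrite k1' /= mulr1n => e0.
have G0E : G`_0 = - (q2 * h0).
  have -> : G`_0 = - (q2 * h0) * (- (q2 * h0)^-1 * G`_0) by field; apply/andP.
  by rewrite e0 mulr1.
have suma (F : 'I_k -> K) : \prod_s ('X - (F s)%:P) = 'X - (\sum_s F s)%:P.
  by move: F; rewrite k1' => F; rewrite !big_ord1.
have G1' : q1 = q2.
  have := G1 1%N isT; rewrite GE coefB !coefZ fE gE !suma !coefB !coefX !coefC /=.
  by rewrite !subr0 !mulr1 => /eqP; rewrite subr_eq0 => /eqP.
have := G0E; rewrite GE coefB !coefZ fE gE !suma !coefB !coefX !coefC /= !sub0r.
rewrite G1' big_split /= => e.
case/eqP: (sum_neq0 G1'); apply: (mulfI q2_neq0); rewrite mulr0 mulrDr.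
by rewrite -[q2 * h0]opprK -e; ring.
Qed.

Lemma exists_add_root : exists a0,
  [/\ forall s, a0 != a s + h s, forall s, a s != a0 + h0 & no_multiple_roots (Gadd a0)].
Proof.
have fN0 : f != 0.
  by rewrite fE; apply/prodf_neq0 => s _; rewrite polyXsubC_eq0.
have gN0 : g != 0.
  by rewrite gE; apply/prodf_neq0 => s _; rewrite polyXsubC_eq0.
have [rs rsE] := closed_field_poly_normal ramification.
(* The factors exclude [a0] among the roots of [g], [a0 + h0] among those of [f], and the critical
   values of [Gadd_double]. Where [G.[r] = 0] the quotient is 0 by convention, which merely excludes
   one more value. *)
pose q := g * (f \Po ('X + h0%:P)) *
  \prod_(r <- rs) ('X - (r + q2 * h0 * g.[r] / G.[r])%:P).
have [a0] : exists a0, q.[a0] != 0.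
  apply: poly_nonroot; rewrite !mulf_neq0 //.
    by rewrite comp_poly2_eq0 // size_XaddC.
  by rewrite prodf_seq_neq0; apply/allP=> r _; rewrite polyXsubC_eq0.
rewrite !hornerM !mulf_eq0 !negb_or => /andP[/andP[g0 f0] r0].
exists a0; split.
- move: g0; rewrite gE horner_prod => /prodf_neq0 g0 s.
  by have := g0 s isT; rewrite hornerXsubC subr_eq0.
- move: f0; rewrite horner_comp hornerD hornerX hornerC fE horner_prod => /prodf_neq0 f0 s.
  by have := f0 s isT; rewrite hornerXsubC subr_eq0 eq_sym.
have [N0|N0] := eqVneq ramification 0; first exact: ramification_eq0.
move=> t; apply/negP => /Gadd_double[Nt e].
have trs : t \in rs.
  have : root ramification t by apply/eqP.
  by rewrite rsE rootZ ?lead_coef_eq0 // root_prod_XsubC.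
move: r0; rewrite horner_prod prodf_seq_neq0 => /allP/(_ t trs) /=.
by rewrite hornerXsubC -e subrr eqxx.
Qed.

End AddRoot.

Lemma exists_generic_point k (h : 'I_k -> K) (q1 q2 : K) :
  (forall s, h s != 0) -> q1 != 0 -> q2 != 0 -> (q1 = q2 -> \sum_s h s != 0) ->
  exists a : 'I_k -> K, (forall s t, a s != a t + h t) /\
    no_multiple_roots (q1 *: \prod_s ('X - (a s)%:P) - q2 *: \prod_s ('X - (a s + h s)%:P)).
Proof.
move=> h0 q10 q20; case: k h h0 => [|k] h h0 hs.
  exists (fun=> 0); split=> [[]//|t]; rewrite double_root !big_ord0 !hornerE /=.
  have [e|e] := eqVneq q1 q2; last by rewrite subr_eq0 (negPf e).
  by have := hs e; rewrite big_ord0 eqxx.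
pose h' s := h (lift ord0 s).
(* The factor at [(s, t)] vanishes when [s c = t c + h' t]. For [s = t] it is the non-zero constant
   [- h' t]. *)
have [c c0] : exists c, (\prod_(s < k) \prod_(t < k)
    (((s : nat)%:R - (t : nat)%:R) *: 'X - (h' t)%:P)).[c] != 0.
  apply: poly_nonroot; apply/prodf_neq0 => s _; apply/prodf_neq0 => t _.
  apply: contraNneq (h0 (lift ord0 t)) => /(congr1 (fun r : {poly K} => r`_0)).
  by rewrite coefB coefZ coefX mulr0 coefC coef0 sub0r => /eqP; rewrite oppr_eq0.
pose a' (s : 'I_k) := (s : nat)%:R * c.
have a'h s t : a' s != a' t + h' t.
  move: c0; rewrite horner_prod => /prodf_neq0/(_ s isT); rewrite horner_prod.
  move=> /prodf_neq0/(_ t isT); rewrite hornerD hornerN hornerZ hornerX hornerC.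
  by apply: contraNneq; rewrite /a' => e; rewrite mulrBl e; apply/eqP; ring.
pose f := \prod_s ('X - (a' s)%:P); pose g := \prod_s ('X - (a' s + h' s)%:P).
have fg t : f.[t] = 0 -> g.[t] = 0 -> False.
  rewrite /f /g !horner_prod => /eqP/prodf_eq0[s _]; rewrite hornerXsubC subr_eq0 => /eqP ->.
  move=> /eqP/prodf_eq0[t' _]; rewrite hornerXsubC subr_eq0.
  by rewrite (negPf (a'h s t')).
have hs' : q1 = q2 -> h ord0 + \sum_s h' s != 0 by move=> /hs; rewrite big_ord_recl.
have [a0 [a01 a02 a03]] := exists_add_root q10 q20 (h0 ord0) hs' erefl erefl fg erefl.
exists (fun s => if unlift ord0 s is Some s' then a' s' else a0); split.
  move=> s t /=; case: (unliftP ord0 s) => [s1 _|_]; case: (unliftP ord0 t) => [t1 ->|->] //.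
  by rewrite -subr_eq0 opprD addNKr oppr_eq0.
rewrite !big_ord_recl unlift_none.
under eq_bigr do rewrite liftK.
under [X in _ - _ *: (_ * X)]eq_bigr do rewrite liftK.
rewrite -/f -[\prod_i _]/g.
suff <- : Gadd q2 (h ord0) g (q1 *: f - q2 *: g) a0 =
  q1 *: (('X - a0%:P) * f) - q2 *: (('X - (a0 + h ord0)%:P) * g) by [].
rewrite /Gadd polyCD -!mul_polyC polyCM; ring.
Qed.

End SimpleRoots.

(** The size of the Sylvester matrix depends on the degrees, so both leading coefficients have to
    survive the specialization. *)
Lemma rmorph_resultant (S S' : nzRingType) (f : {rmorphism S -> S'}) (p q : {poly S}) :
  f (lead_coef p) != 0 -> f (lead_coef q) != 0 ->
  f (resultant p q) = resultant (map_poly f p) (map_poly f q).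
Proof.
move=> fp fq; rewrite /resultant -det_map_mx /Sylvester_mx !size_map_poly_id0 //.
congr (\det _); apply/matrixP=> i j; rewrite !mxE.
case: (split i) => i'; rewrite !mxE /= !rVpoly_delta !coefXnM coef_map.
  by case: ifP; rewrite ?rmorph0.
by case: ifP; rewrite ?rmorph0.
Qed.

Lemma lead_coef_top (S : nzRingType) (p : {poly S}) d :
  (size p <= d.+1)%N -> p`_d != 0 -> lead_coef p = p`_d.
Proof.
move=> pd p0; rewrite /lead_coef; suff -> : size p = d.+1 by [].
apply/eqP; rewrite eqn_leq pd ltnNge; apply: contra p0 => /(nth_default 0) ->.
exact: eqxx.
Qed.

Lemma map_poly_gamma (S S' : comNzRingType) (f : {rmorphism S -> S'}) k (a c : 'I_k -> S) q1 q2 :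
  map_poly f (q1 *: \prod_s ('X - (a s)%:P) - q2 *: \prod_s ('X - (c s)%:P)) =
  f q1 *: \prod_s ('X - (f (a s))%:P) - f q2 *: \prod_s ('X - (f (c s))%:P).
Proof.
rewrite rmorphB /= !map_polyZ !rmorph_prod.
by congr (_ *: _ - _ *: _); apply: eq_bigr => s _; rewrite /= map_polyXsubC.
Qed.

(** * Completeness for irreducible modules and for generic parameters *)

Section Conclusion.
Variables (R : realType) (k : nat) (lam : 'I_k -> ((R[i])%C * (R[i])%C)%type) (q1 q2 : (R[i])%C).
Local Notation C := (R[i])%C.
Hypotheses (h_neq0 : forall s, (lam s).1 + (lam s).2 != 0).
Hypotheses (q1_neq0 : q1 != 0) (q2_neq0 : q2 != 0).
Hypothesis sum_neq0 : q1 = q2 -> \sum_(s < k) ((lam s).1 + (lam s).2) != 0.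

Lemma complete_of_coprime (b : 'I_k -> C) :
  (forall x, (phi_pol lam b).[x] = 0 -> (psi_pol lam b).[x] = 0 -> False) ->
  no_multiple_roots (q1 *: phi_pol lam b - q2 *: psi_pol lam b) ->
  TQ_diagonalizable lam b q1 q2 /\ bethe_complete lam b q1 q2.
Proof.
rewrite phi_polE psi_polE => coprime simple; split.
  exact: TQ_is_diagonalizable.
exact: bethe_is_complete.
Qed.

Lemma irreducible_coprime (b : 'I_k -> C) : irreducible_mod lam b ->
  forall x, (phi_pol lam b).[x] = 0 -> (psi_pol lam b).[x] = 0 -> False.
Proof.
move=> irr x; rewrite phi_polE psi_polE => px qx.
case: (posnP k) => k0; last exact: (no_common_root irr px qx k0).
move/eqP: px; rewrite -prod_alx big1_seq ?oner_eq0 // => s _.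
by have := ltn_ord s; rewrite {2}k0.
Qed.

Let phi_root (s : 'I_k) : {mpoly C[k]} := 'X_s - (lam s).1%:MP.
Let psi_root (s : 'I_k) : {mpoly C[k]} := 'X_s + (lam s).2%:MP.
Let gamma : {poly {mpoly C[k]}} :=
  q1%:MP *: \prod_s ('X - (phi_root s)%:P) - q2%:MP *: \prod_s ('X - (psi_root s)%:P).
Let d := if q1 == q2 then k.-1 else k.
Let lc : C := if q1 == q2 then q1 * \sum_(s < k) ((lam s).1 + (lam s).2) else q1 - q2.

Lemma lc_neq0 : lc != 0.
Proof.
rewrite /lc; have [q12|q12] := eqVneq q1 q2; last by rewrite subr_eq0.
exact: mulf_neq0 q1_neq0 (sum_neq0 q12).
Qed.

(** The leading coefficient is independent of [b], so the degree never drops and the resultant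
    specializes correctly at every [b]. *)
Lemma gamma_top : (size gamma <= d.+1)%N /\ gamma`_d = lc%:MP.
Proof.
have qE : (q1%:MP == q2%:MP :> {mpoly C[k]}) = (q1 == q2).
  exact: mpolyC_eq.
have [] := @gamma_size _ _ phi_root psi_root q1%:MP q2%:MP.
  by move/eqP; rewrite qE => /eqP/sum_neq0/sum_ord_gt0.
rewrite -/gamma qE -/d => sg ->; split=> //; rewrite /lc; case: eqP => _; last by rewrite mpolyCB.
rewrite mpolyCM; congr (_ * _); rewrite raddf_sum /=; apply: eq_bigr => s _.
by rewrite /phi_root /psi_root mpolyCD; ring.
Qed.

Let phi_rootE b s : (phi_root s).@[b] = b s - (lam s).1.
Proof. by rewrite mevalB mevalXU mevalC. Qed.

Let psi_rootE b s : (psi_root s).@[b] = b s + (lam s).2.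
Proof. by rewrite mevalD mevalXU mevalC. Qed.

Lemma map_gamma (b : 'I_k -> C) :
  map_poly (meval b) gamma = q1 *: phi_pol lam b - q2 *: psi_pol lam b.
Proof.
rewrite [LHS]map_poly_gamma /= !mevalC; congr (_ *: _ - _ *: _).
  by apply: eq_bigr => s _; rewrite phi_rootE.
by apply: eq_bigr => s _; rewrite psi_rootE.
Qed.

(** The resultant of [phi] and [psi], written through their roots. *)
Let separation : {mpoly C[k]} := \prod_s \prod_t (phi_root s - psi_root t).

Lemma separation_coprime b : separation.@[b] != 0 ->
  forall x, (phi_pol lam b).[x] = 0 -> (psi_pol lam b).[x] = 0 -> False.
Proof.
move=> sb x; rewrite !horner_prod => /eqP/prodf_eq0[s _].
rewrite hornerXsubC subr_eq0 => /eqP -> /eqP/prodf_eq0[t _].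
rewrite hornerXsubC subr_eq0 => /eqP e.
move: sb; rewrite rmorph_prod => /prodf_neq0/(_ s isT) /=.
rewrite rmorph_prod => /prodf_neq0/(_ t isT) /=.
by rewrite mevalB phi_rootE psi_rootE e subrr eqxx.
Qed.

(** Kept apart from the resultant criterion: here the derivative is zero and has no leading
    coefficient to specialize. *)
Lemma gamma_const b : d = 0%N ->
  no_multiple_roots (q1 *: phi_pol lam b - q2 *: psi_pol lam b).
Proof.
move=> d0 t; rewrite double_root -map_gamma; have [] := gamma_top; rewrite d0.
move=> /size1_polyC g1 g0; rewrite {1}g1 g0 map_polyC hornerC /= mevalC.
by rewrite (negPf lc_neq0).
Qed.

Lemma gamma_resultant b : (0 < d)%N ->
  (resultant gamma gamma^`()).@[b] != 0 <->
  no_multiple_roots (q1 *: phi_pol lam b - q2 *: psi_pol lam b).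
Proof.
move=> d0; have [sg gd] := gamma_top.
have lg : lead_coef gamma = lc%:MP.
  by rewrite (lead_coef_top sg) ?gd // mpolyC_eq0 lc_neq0.
have g'd : gamma^`()`_d.-1 = (lc *+ d)%:MP.
  by rewrite coef_deriv prednK // gd mpolyCMn.
have lcd : lc *+ d != 0 by rewrite mulrn_eq0 negb_or -lt0n d0 lc_neq0.
have lg' : lead_coef gamma^`() = (lc *+ d)%:MP.
  rewrite (@lead_coef_top _ _ d.-1) ?g'd // ?mpolyC_eq0 // prednK //.
  by apply: leq_trans (size_poly _ _) _; have := sg; lia.
have res : (resultant gamma gamma^`()).@[b] =
    resultant (map_poly (meval b) gamma) (map_poly (meval b) gamma)^`().
  rewrite deriv_map; apply: rmorph_resultant => /=.
    by rewrite lg mevalC lc_neq0.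
  by rewrite lg' mevalC.
have G0 : map_poly (meval b) gamma != 0.
  rewrite -lead_coef_eq0 lead_coef_map_eq /= lg mevalC ?lc_neq0 //.
by rewrite res -map_gamma resultant_eq0 -leqNgt no_multiple_rootsP.
Qed.

(** Coprimality and simple roots are the non-vanishing of [separation] and of the resultant of
    [gamma] with its derivative. Neither is the zero polynomial, as the point of
    [exists_generic_point], shifted by [(lam s).1] to undo [wa], shows. *)
Lemma exists_generic : exists G : {mpoly C[k]}, G != 0 /\
  forall b : 'I_k -> C, G.@[b] != 0 ->
    TQ_diagonalizable lam b q1 q2 /\ bethe_complete lam b q1 q2.
Proof.
have [a [asep asimple]] := exists_generic_point h_neq0 q1_neq0 q2_neq0 sum_neq0.
pose b0 s := a s + (lam s).1.
have sep0 : separation.@[b0] != 0.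
  rewrite rmorph_prod; apply/prodf_neq0 => s _; rewrite rmorph_prod; apply/prodf_neq0 => t _ /=.
  rewrite mevalB phi_rootE psi_rootE /b0 addrK -addrA subr_eq0.
  exact: asep.
have simple0 : no_multiple_roots (q1 *: phi_pol lam b0 - q2 *: psi_pol lam b0).
  rewrite /phi_pol /psi_pol /b0.
  under eq_bigr do rewrite addrK.
  by under [X in _ - _ *: X]eq_bigr do rewrite -addrA.
have [d0|d0] := posnP d.
  exists separation; split=> [|b sb].
    by apply: contraNneq sep0 => ->; rewrite meval0.
  by apply: complete_of_coprime; [exact: separation_coprime|exact: gamma_const].
exists (separation * resultant gamma gamma^`()); split=> [|b].
  have r0 := (gamma_resultant b0 d0).2 simple0.
  by rewrite mulf_neq0 //; [apply: contraNneq sep0|apply: contraNneq r0] => ->; rewrite meval0.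
rewrite mevalM mulf_eq0 negb_or => /andP[sb rb].
by apply: complete_of_coprime; [exact: separation_coprime|exact/(gamma_resultant b d0)].
Qed.

End Conclusion.

Theorem theorem2p9 (R : realType) (k : nat) (lam : 'I_k -> (complex R * complex R)%type)
    (q1 q2 : complex R) :
  (forall s, (lam s).1 + (lam s).2 != 0) ->
  q1 != 0 -> q2 != 0 ->
  (q1 = q2 -> \sum_(s < k) ((lam s).1 + (lam s).2) != 0) ->
  (forall b : 'I_k -> complex R,
     irreducible_mod lam b ->
     no_multiple_roots (q1 *: phi_pol lam b - q2 *: psi_pol lam b) ->
     TQ_diagonalizable lam b q1 q2 /\ bethe_complete lam b q1 q2)
  /\
  (exists G : {mpoly complex R [k]}, G != 0 /\
     forall b : 'I_k -> complex R, G.@[b] != 0 ->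
       TQ_diagonalizable lam b q1 q2 /\ bethe_complete lam b q1 q2).
Proof.
move=> h_neq0 q1_neq0 q2_neq0 sum_neq0; split=> [b irr simple|]; last exact: exists_generic.
by apply: complete_of_coprime => //; apply: irreducible_coprime.
Qed.
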